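(* For each $p\in(2,\infty)$, there exist a function $f$ in the homogeneous Besov class $B^1_{\infty,1}(\mathbb{R}^2)$ and self-adjoint contractions $A_1$, $A_2$ and $B$ on a Hilbert space such that $A_1-A_2\in\boldsymbol{S}_p$ but $f(A_1,B)-f(A_2,B)\notin\boldsymbol{S}_p$.
   Context: $\boldsymbol{S}_p$ is the Schatten--von Neumann class. A contraction is an operator of norm at most $1$. The operators $A_j$ and $B$ need not commute. Besov class. Fix an infinitely differentiable function $w\ge 0$ on $\mathbb{R}$ with $\operatorname{supp}w\subset[\frac12,2]$ and $w(t)=1-w(t/2)$ for $t\in[1,2]$. Let $\mathscr{F}$ be the Fourier transform, normalized so that $f(x)=\int(\mathscr{F}f)(\xi)e^{i(x,\xi)}\,d\xi$. For a tempered distribution $f$ on $\mathbb{R}^d$ and $n\in\mathbb{Z}$ let $f_n$ be defined by $(\mathscr{F}f_n)(\xi)=w(\|\xi\|_2/2^n)(\mathscr{F}f)(\xi)$. Then $f\in B^1_{\infty,1}(\mathbb{R}^d)$ means that $\|f\|_{B^1_{\infty,1}}:=\sum_{n\in\mathbb{Z}}2^n\|f_n\|_{L^\infty}<\infty$ and $\frac{\partial f}{\partial x_j}=\sum_{n\in\mathbb{Z}}\frac{\partial f_n}{\partial x_j}$ for $1\le j\le d$. Functions of two operators. For $f\in B^1_{\infty,1}(\mathbb{R}^2)$ and bounded self-adjoint operators $A,B$, the function $f$ coincides on a neighbourhood of $\sigma(A)\times\sigma(B)$ with a function $g$ having $\mathscr{F}g\in L^1(\mathbb{R}^2)$, and $f(A,B):=\iint(\mathscr{F}g)(s,t)\,e^{isA}e^{itB}\,ds\,dt$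 (independent of the choice of $g$); equivalently $f(A,B)=\iint f(x,y)\,dE_A(x)\,dE_B(y)$ as a double operator integral. If $A,B$ have finite spectra, $f(A,B)=\sum_{\lambda\in\sigma(A)}\sum_{\mu\in\sigma(B)}f(\lambda,\mu)P_\lambda Q_\mu$, with $P_\lambda$, $Q_\mu$ the orthogonal projections onto $\ker(A-\lambda I)$, $\ker(B-\mu I)$. *)

(* Defs.v *)
From HB Require Import structures.
From mathcomp Require Import all_boot all_order all_algebra sesquilinear.
From mathcomp Require Import all_classical all_reals all_analysis.
From mathcomp Require Import complex.

Set Implicit Arguments.
Unset Strict Implicit.
Unset Printing Implicit Defensive.

Import Order.TTheory GRing.Theory Num.Theory.
Import numFieldNormedType.Exports.

Local Open Scope classical_set_scope.
Local Open Scope ring_scope.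
Local Open Scope complex_scope.

Section ComplexFunctions.
Context {R : realType}.
Implicit Types (f g h phi psi : R * R -> R[i]) (z xi : R * R).

Definition cabs (a : R[i]) : R := complex.Re `|a|.

Definition cis (t : R) : R[i] := cos t +i* sin t.

Definition leb2 :
    {measure set (measurableTypeR R * measurableTypeR R)%type -> \bar R} :=
  (@lebesgue_measure R \x @lebesgue_measure R)%E.

Definition cmeasurable f :=
  measurable_fun setT (fun z => complex.Re (f z)) /\
  measurable_fun setT (fun z => complex.Im (f z)).

Definition cintegrable f :=
  leb2.-integrable setT (fun z => (complex.Re (f z))%:E) /\
  leb2.-integrable setT (fun z => (complex.Im (f z))%:E).

Definition cintegral f : R[i] :=
  (\int[leb2]_z complex.Re (f z)) +i* (\int[leb2]_z complex.Im (f z)).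

Definition ccontinuous f :=
  continuous (fun z => complex.Re (f z)) /\
  continuous (fun z => complex.Im (f z)).

Definition dot2 z xi : R := z.1 * xi.1 + z.2 * xi.2.
Definition norm2 z : R := Num.sqrt (dot2 z z).

(* [false] stands for the first coordinate and [true] for the second one. *)
Definition basis2 (j : bool) : R * R := if j then (0, 1) else (1, 0).

Definition cderivable f (j : bool) z :=
  derivable (fun x => complex.Re (f x)) z (basis2 j) /\
  derivable (fun x => complex.Im (f x)) z (basis2 j).

Definition pderiv (j : bool) f : R * R -> R[i] := fun z =>
  'D_(basis2 j) (fun x => complex.Re (f x)) z +i*
  'D_(basis2 j) (fun x => complex.Im (f x)) z.

Definition pderivs (s : seq bool) f : R * R -> R[i] := foldr pderiv f s.

Definition smooth f := forall s : seq bool,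
  ccontinuous (pderivs s f) /\ forall j z, cderivable (pderivs s f) j z.

Definition schwartz phi := smooth phi /\
  forall (s : seq bool) (k : nat), exists M : R,
    forall z, (1 + norm2 z) ^+ k * cabs (pderivs s phi z) <= M.

(* The inverse of this transform is [h |-> \int h(xi) e^{i(x,xi)} dxi]. *)
Definition fourier phi : R * R -> R[i] := fun xi =>
  ((2 * pi) ^- 2)%:C * cintegral (fun x => phi x * cis (- dot2 x xi)).

Definition inv_fourier h : R * R -> R[i] := fun x =>
  cintegral (fun xi => h xi * cis (dot2 x xi)).

End ComplexFunctions.

Section Distributions.
Context {R : realType}.

(* Only the values on Schwartz functions are meaningful. *)
Definition distr := (R * R -> R[i]) -> R[i].
Implicit Types (u v : distr) (f m phi psi : R * R -> R[i]).

Definition distr_eq u v := forall phi, schwartz phi -> u phi = v phi.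

Definition tempered u :=
  (forall (a : R[i]) phi psi, schwartz phi -> schwartz psi ->
     u (fun z => a * phi z + psi z) = a * u phi + u psi) /\
  exists (N : nat) (M : R), forall phi (b : R), schwartz phi ->
    (forall (s : seq bool) z, (size s <= N)%N ->
       (1 + norm2 z) ^+ N * cabs (pderivs s phi z) <= b) ->
    cabs (u phi) <= M * b.

Definition regular f : distr := fun phi => cintegral (fun z => f z * phi z).
(* No complex conjugation or reflection appears: the pairing is bilinear and
   [fourier] is symmetric for it. *)
Definition dfourier u : distr := fun phi => u (fourier phi).
Definition dmul m u : distr := fun phi => u (fun z => m z * phi z).
Definition dpderiv (j : bool) u : distr := fun phi => - u (pderiv j phi).

Definition zseries_cvg (a : int -> R) (l : R) :=
  exists l1 l2 : R, [/\ series (fun n : nat => a n%:Z) @ \oo --> l1,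
    series (fun n : nat => a (- (n.+1)%:Z)) @ \oo --> l2 & l = l1 + l2].

Definition czseries_cvg (a : int -> R[i]) (l : R[i]) :=
  zseries_cvg (fun n => complex.Re (a n)) (complex.Re l) /\
  zseries_cvg (fun n => complex.Im (a n)) (complex.Im l).

End Distributions.
Arguments distr : clear implicits.

Section Besov.
Context {R : realType}.

Definition besov_window (w : R -> R) :=
  [/\ forall (n : nat) t, derivable (derive1n n w) t 1,
      forall t, 0 <= w t,
      forall t, w t != 0 -> 2^-1 <= t <= 2 &
      forall t, 1 <= t <= 2 -> w t = 1 - w (t / 2)].

Definition Linfty_norm (g : R * R -> R[i]) : \bar R :=
  Lnorm leb2 +oo (fun z => (cabs (g z))%:E).

(* The Littlewood-Paley block f_n of the distribution [u] is the function [g];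
   it is determined by this up to a null set. *)
Definition is_block (w : R -> R) (u : distr R) (n : int) (g : R * R -> R[i]) :=
  cmeasurable g /\
  distr_eq (dfourier (regular g))
           (dmul (fun xi => (w (norm2 xi / 2 ^ n))%:C) (dfourier u)).

(* The series of derivatives converges in the sense of distributions. *)
Definition besov_distr (w : R -> R) (u : distr R) :=
  tempered u /\ exists g : int -> R * R -> R[i],
    [/\ forall n, is_block w u n (g n),
        (\esum_(n in [set: int]) ((2 ^ n)%:E * Linfty_norm (g n)) < +oo)%E &
        forall (j : bool) phi, schwartz phi ->
          czseries_cvg (fun n => dpderiv j (regular (g n)) phi)
                       (dpderiv j u phi)].

(* Distributions of this class are given by continuous functions of at most
   linear growth; the class is identified with the set of these functions. *)
Definition besov (w : R -> R) (f : R * R -> R[i]) :=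
  [/\ ccontinuous f,
      forall phi, schwartz phi -> cintegrable (fun z => f z * phi z) &
      besov_distr w (regular f)].

End Besov.

Record hilbert (R : realType) := Hilbert {
  hilbert_car :> completeNormedModType R[i];
  hdot : {dot hilbert_car for (Num.conj : R[i] -> R[i])};
  hnormE : forall x : hilbert_car, `|x| ^+ 2 = hdot x x }.

Section Operators.
Context {R : realType} {H : hilbert R}.
Implicit Types (A B S T K : {linear H -> H}).

Definition hnorm (x : H) : R := complex.Re `|x|.

Definition selfadjoint A :=
  continuous A /\ forall x y : H, hdot H (A x) y = hdot H x (A y).

Definition contractive A := forall x : H, hnorm (A x) <= hnorm x.

Definition spectrum A : set R[i] := [set l | ~ exists S : {linear H -> H},
  [/\ continuous S, forall x, S (A x - l *: x) = x &
      forall x, A (S x) - l *: S x = x]].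

(* The exponential of i s A, as the sum of its power series. *)
Definition opexp A (s : R) (x : H) : H :=
  limn (series (fun k : nat => ((0 +i* s) ^+ k / k`!%:R) *: iter k A x)).

(* T = f(A, B); the operator integral is understood in the weak sense. *)
Definition is_fun2 (f : R * R -> R[i]) A B T :=
  continuous T /\ exists h : R * R -> R[i],
    [/\ cintegrable h,
        set_nbhs [set z : R * R | spectrum A z.1%:C /\ spectrum B z.2%:C]
                 [set z | f z = inv_fourier h z] &
        forall x y : H, hdot H (T x) y =
          cintegral (fun st => h st * hdot H (opexp A st.1 (opexp B st.2 x)) y)].

Definition opnorm T : R := sup [set hnorm (T x) | x in [set x : H | hnorm x <= 1]].

Definition rank_le K (n : nat) := exists e : 'I_n -> H,
  forall x, exists c : 'I_n -> R[i], K x = \sum_(i < n) c i *: e i.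

Definition singular_value T (n : nat) : R :=
  inf [set opnorm (T \- K) | K in
        [set K : {linear H -> H} | continuous K /\ rank_le K n]].

(* For finite p the summability forces the singular values to tend to 0, that
   is, T is compact. *)
Definition schatten (p : R) T := continuous T /\
  (\sum_(0 <= n <oo) (singular_value T n `^ p)%:E < +oo)%E.

End Operators.

(* Main.v *)
(* The function is a lacunary series of pieces
   c_m 2^{-q_m} e^{i 2^{q_m} x} g_m(x, y) with c_m = 2^{-m}, N_m = 2^{4^{m+2}} and
   2^{q_m} = N_m^4. Here g_m is a trigonometric polynomial with |g_m| <= 1,
   frequencies O(N_m) and coefficients of total mass N_m, which interpolates the
   unimodular matrix e^{-2 pi i j k / N_m} on an N_m x N_m grid. Since all frequencies
   of the m-th piece lie near 2^{q_m}, its Besov norm is O(c_m).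

   The m-th block of the Hilbert space is C^{N_m} with multiplicity r_m. There A_1 is
   diagonal with the grid points as eigenvalues, B is conjugate to it by the discrete
   Fourier transform, and A_2 = A_1 + pi / 2^{q_m}. This shift changes the sign of the
   m-th piece, and the matrix of f(A_1, B) - f(A_2, B) is nearly twice c_m 2^{-q_m}
   times a product of conjugate unimodular matrices: it maps some unit vector to a
   vector of norm at least c_m 2^{-q_m} N_m^{1/2}, which beats the norm of A_1 - A_2 by
   a factor of order c_m N_m^{1/2}. With r_m of order 2^{q_m p} / (N_m 2^m), the p-th
   powers of the singular values of A_1 - A_2 are summable, while those of the
   difference of the functions are at least 2^{-m (p + 1)} N_m^{p / 2 - 1}, which is
   unbounded for p > 2. *)
Require Import Defs.
From HB Require Import structures.
From mathcomp Require Import all_boot all_order all_algebra sesquilinear.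
From mathcomp Require Import all_classical all_reals all_analysis.
From mathcomp Require Import measurable_realfun ess_sup_inf complex.
From mathcomp Require Import ring lra zify.

Set Implicit Arguments.
Unset Strict Implicit.
Unset Printing Implicit Defensive.

Import Order.TTheory GRing.Theory Num.Theory.
Import numFieldNormedType.Exports.

Local Open Scope classical_set_scope.
Local Open Scope ring_scope.
Local Open Scope complex_scope.

Local Notation plane R := (measurableTypeR R * measurableTypeR R)%type.
Local Notation int2 f := (leb2.-integrable setT (fun z => (f z)%:E)).
Local Notation int1 f := (lebesgue_measure.-integrable setT (fun t => (f t)%:E)).

(** * Integrals on the plane *)

(** The Fourier transform of [f] is a sum of point masses, whereas [is_fun2] asks that [f] agree
    near the product of the spectra with the inverse transform of an integrable function. All nodes
    lie in [5/8, 7/8], so that product lies in 1/2 < |z| < 2, where three dilates of the given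
    window [w] add up to 1. Multiplying [f] by this bump turns each point mass into a translate of
    one integrable profile. This step and the identification of the Littlewood-Paley blocks rest on
    Fourier inversion in the plane, which is derived from Abel and Poisson kernels. The exponents
    come from the error terms in block M. On the test vector the pieces below M change by at most a
    constant times 2^{-q_M} \sum_{m<M} c_m N_m, while the main term has order c_M 2^{-q_M}
    N_M^{1/2}; since N_M = N_{M-1}^4, this root is N_{M-1}^2 and wins. The frequencies of the M-th
    piece deviate from 2^{q_M} by O(N_M), and its coefficients have mass N_M relative to its
    amplitude, so both the sign change and the replacement of the window by its value at the carrier
    have relative error O(N_M^2 / 2^{q_M}); the fourth power makes it small. *)

Lemma open_measurable2 {R : realType} (U : set (R * R)) :
  open U -> measurable (U : set (plane R)).
Proof.
move=> oU.
(* The plane carries the product sigma-algebra, so an open set is exhibited as a countable union of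
   rational squares. *)
pose box (a b e : rat) : set (R * R) :=
  [set` `]ratr a - ratr e, ratr a + ratr e[%R] `*`
  [set` `]ratr b - ratr e, ratr b + ratr e[%R].
pose F a b e : set (plane R) := [set z | box a b e `<=` U /\ box a b e z].
have -> : U = \bigcup_a \bigcup_b \bigcup_e F a b e.
  apply/seteqP; split => [[x y] Uxy|z [a _ [b _ [e _ [+ +]]]]]; last exact.
  have /nbhs_ballP[/= r r0 rU] : nbhs (x, y) U by exact: open_nbhs_nbhs.
  have [e] := rat_in_itvoo (divr_gt0 r0 (ltr0n R 2)).
  rewrite in_itv/= => /andP[e0 er].
  have [a] : exists q : rat, ratr q \in `]x - ratr e, x + ratr e[.
    by apply: rat_in_itvoo; lra.
  rewrite in_itv/= => /andP[xa ax].
  have [b] : exists q : rat, ratr q \in `]y - ratr e, y + ratr e[.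
    by apply: rat_in_itvoo; lra.
  rewrite in_itv/= => /andP[yb by_].
  exists a => //; exists b => //; exists e => //; split.
    move=> [u v] [/=]; rewrite !in_itv/= => /andP[? ?] /andP[? ?].
    by apply: rU; split; rewrite /ball/= ltr_norml; apply/andP; split; lra.
  by split; rewrite /= in_itv/=; apply/andP; split; lra.
apply: bigcupT_measurable_rat => a; apply: bigcupT_measurable_rat => b.
apply: bigcupT_measurable_rat => e.
have [sub|nsub] := pselect (box a b e `<=` U).
  rewrite (_ : F a b e = box a b e).
    by apply: measurableX; exact: measurable_itv.
  by apply/seteqP; split => z //= -[].
by rewrite (_ : F a b e = set0) //; apply/seteqP; split => z //= -[].
Qed.

Lemma continuous_measurable2 {R : realType} (f : R * R -> R) :
  continuous f -> measurable_fun setT (f : plane R -> R).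
Proof.
move=> /continuousP cf.
apply: (measurability _ (RGenOpens.measurableE R)).
move=> _ [_ [a [b ->] <-]]; rewrite setTI; apply: open_measurable2.
exact/cf/interval_open.
Qed.

(** * The Poisson kernel on the line, normalized to have mass pi *)

Definition poisson {R : realType} (e a t : R) : R := e / (e ^+ 2 + (t - a) ^+ 2).

Lemma poisson_den_gt0 {R : realType} (e a t : R) : 0 < e -> 0 < e ^+ 2 + (t - a) ^+ 2.
Proof. by move=> e0; rewrite ltr_wpDr ?sqr_ge0 ?exprn_gt0. Qed.

Lemma poisson_gt0 {R : realType} (e a t : R) : 0 < e -> 0 < poisson e a t.
Proof. by move=> e0; rewrite divr_gt0// poisson_den_gt0. Qed.

Lemma continuous_poisson {R : realType} (e a : R) : 0 < e -> continuous (poisson e a).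
Proof.
move=> e0 t; apply: cvgM; first exact: cvg_cst.
apply: cvgV; first by rewrite gt_eqF// poisson_den_gt0.
apply: cvgD; first exact: cvg_cst.
by apply: cvgM; apply: cvgB; [exact: cvg_id|exact: cvg_cst|exact: cvg_id|exact: cvg_cst].
Qed.

Lemma integral_oneDsqr {R : realType} :
  (\int[@lebesgue_measure R]_x ((oneDsqr x)^-1)%:E)%E = pi%:E.
Proof.
rewrite (ge0_symfun_integralT (f := (fun x => (oneDsqr x)^-1))).
- rewrite -set_itvcy integral0y_oneDsqr -EFinM; congr EFin; field.
  by [].
- by move=> x; rewrite invr_ge0 ltW// oneDsqr_gt0.
- exact: continuous_oneDsqrV.
- by move=> x /=; rewrite /oneDsqr sqrrN.
Qed.

Lemma integral_poisson {R : realType} (e a : R) : 0 < e ->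
  (\int[@lebesgue_measure R]_t (poisson e a t)%:E)%E = pi%:E.
Proof.
move=> e0; rewrite -integral_oneDsqr.
pose F (t : R) := (t - a) / e.
have dF t : is_derive t (1 : R) F e^-1.
  have : is_derive t (1 : R) (e^-1 \*: (id - cst a)) (e^-1 *: (1 - 0)) by exact: is_deriveZ.
  rewrite subr0 scaler1 (_ : e^-1 \*: _ = F)//.
  by apply/funext => x; rewrite /F mulrC.
have F'E : F^`()%classic = cst e^-1.
  by apply/funext => t; rewrite derive1E; apply: derive_val.
rewrite (@increasing_ge0_integration_by_substitutionT _ F (fun x => (oneDsqr x)^-1)).
- apply: eq_integral => t _; congr EFin.
  change (poisson e a t = (oneDsqr (F t))^-1 * F^`()%classic t).
  rewrite F'E /poisson /F /oneDsqr /=.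
  have := poisson_den_gt0 a t e0 => h; field.
  rewrite gt_eqF// gt_eqF//=; apply: lt_eqF; move: h; lra.
- by move=> x y xy; rewrite /F ltr_pM2r ?invr_gt0//; lra.
- by rewrite F'E => x; exact: cvg_cst.
- by rewrite F'E; exact: is_cvg_cst.
- by rewrite F'E; exact: is_cvg_cst.
- by move=> x; apply: ex_derive.
- rewrite /F; apply: gt0_cvgMlNy; rewrite ?invr_gt0//. exact: cvg_addrr_Ny (- a).
- rewrite /F; apply: gt0_cvgMly; rewrite ?invr_gt0//. exact: (cvg_addrr (- a)).
- exact: continuous_oneDsqrV.
- by move=> x; rewrite invr_ge0 ltW// oneDsqr_gt0.
Qed.

(** * Integrability and integrals of real functions on the plane *)

Lemma int2_le {R : realType} (f g : R * R -> R) :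
  measurable_fun setT (f : plane R -> R) -> (forall z, `|f z| <= g z) ->
  int2 g -> int2 f.
Proof.
move=> mf fg ig; apply: (le_integrable _ _ _ ig) => //.
  exact/measurable_EFinP.
by move=> z _ /=; rewrite lee_fin (le_trans (fg z))// ler_norm.
Qed.

Lemma int2_measurable {R : realType} (f : R * R -> R) :
  int2 f -> measurable_fun setT (f : plane R -> R).
Proof. by move=> /measurable_int/measurable_EFinP. Qed.

Lemma int2D {R : realType} (f g : R * R -> R) :
  int2 f -> int2 g -> int2 (fun z => f z + g z).
Proof. by move=> hf hg; have := integrableD measurableT hf hg. Qed.

Lemma int2B {R : realType} (f g : R * R -> R) :
  int2 f -> int2 g -> int2 (fun z => f z - g z).
Proof. by move=> hf hg; have := integrableB measurableT hf hg. Qed.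

Lemma int2Z {R : realType} (c : R) (f : R * R -> R) :
  int2 f -> int2 (fun z => c * f z).
Proof. by move=> hf; have := integrableZl measurableT c hf. Qed.

Lemma int2_abs {R : realType} (f : R * R -> R) :
  int2 f -> int2 (fun z => `|f z|).
Proof. by move=> /integrable_norm. Qed.

Lemma int2_0 {R : realType} : int2 (fun _ : R * R => 0).
Proof. exact: integrable0. Qed.

Lemma int2_sum {R : realType} (I : Type) (s : seq I) (f : I -> R * R -> R) :
  (forall i, int2 (f i)) -> int2 (fun z => \sum_(i <- s) f i z).
Proof.
move=> hf; elim: s => [|i s IH].
  by under eq_fun do rewrite big_nil; exact: int2_0.
by under eq_fun do rewrite big_cons; exact: int2D.
Qed.

Lemma int2_mul_bounded {R : realType} (f b : R * R -> R) (M : R) :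
  int2 f -> measurable_fun setT (b : plane R -> R) -> (forall z, `|b z| <= M) ->
  int2 (fun z => f z * b z).
Proof.
move=> hf mb bM; apply: (@int2_le _ _ (fun z => M * `|f z|)).
- by apply: measurable_funM => //; exact: int2_measurable.
- by move=> z; rewrite normrM mulrC ler_wpM2r.
- exact/int2Z/int2_abs.
Qed.

Lemma I2D {R : realType} (f g : R * R -> R) : int2 f -> int2 g ->
  \int[leb2]_z (f z + g z) = \int[leb2]_z f z + \int[leb2]_z g z.
Proof. by move=> hf hg; rewrite -RintegralD. Qed.

Lemma I2B {R : realType} (f g : R * R -> R) : int2 f -> int2 g ->
  \int[leb2]_z (f z - g z) = \int[leb2]_z f z - \int[leb2]_z g z.
Proof. by move=> hf hg; rewrite -RintegralB. Qed.

Lemma I2Z {R : realType} (c : R) (f : R * R -> R) : int2 f ->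
  \int[leb2]_z (c * f z) = c * \int[leb2]_z f z.
Proof. by move=> hf; rewrite RintegralZl. Qed.

Lemma I2_0 {R : realType} : \int[@leb2 R]_z 0 = 0.
Proof. by rewrite /Rintegral integral0_eq. Qed.

Lemma I2_sum {R : realType} (I : Type) (s : seq I) (f : I -> R * R -> R) :
  (forall i, int2 (f i)) ->
  \int[leb2]_z (\sum_(i <- s) f i z) = \sum_(i <- s) \int[leb2]_z f i z.
Proof.
move=> hf; elim: s => [|i s IH].
  rewrite big_nil -[RHS](@I2_0 R); apply: eq_Rintegral => z _; exact: big_nil.
rewrite big_cons -IH -I2D//; last exact: int2_sum.
by apply: eq_Rintegral => z _; exact: big_cons.
Qed.

Lemma I2_norm {R : realType} (f : R * R -> R) : int2 f ->
  `|\int[leb2]_z f z| <= \int[leb2]_z `|f z|.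
Proof. by move=> hf; apply: le_normr_Rintegral. Qed.

Lemma I2_le {R : realType} (f g : R * R -> R) : int2 f -> int2 g ->
  (forall z, f z <= g z) -> \int[leb2]_z f z <= \int[leb2]_z g z.
Proof. by move=> hf hg fg; apply: le_Rintegral => // z _. Qed.

Lemma I2_norm_le {R : realType} (f g : R * R -> R) : int2 f -> int2 g ->
  (forall z, `|f z| <= g z) -> `|\int[leb2]_z f z| <= \int[leb2]_z g z.
Proof.
move=> hf hg fg; apply: (le_trans (I2_norm hf)).
by apply: I2_le => //; exact: int2_abs.
Qed.

Lemma I2_ge0 {R : realType} (f : R * R -> R) : (forall z, 0 <= f z) ->
  0 <= \int[leb2]_z f z.
Proof. by move=> hf; apply: Rintegral_ge0. Qed.

Lemma I2_dominated {R : realType} (f_ : nat -> R * R -> R) (f g : R * R -> R) :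
  (forall n, measurable_fun setT (f_ n : plane R -> R)) ->
  (forall z, f_ ^~ z @ \oo --> f z) -> int2 g ->
  (forall n z, `|f_ n z| <= g z) ->
  int2 f /\ (fun n => \int[leb2]_z f_ n z) @ \oo --> \int[leb2]_z f z.
Proof.
move=> mf ff ig fg.
have mlim : measurable_fun setT (f : plane R -> R).
  by apply: (measurable_fun_cvg (h := (f_ : nat -> plane R -> R))) => // z _; exact: ff.
have ilim : int2 f.
  apply: (int2_le mlim _ ig) => z.
  rewrite -(cvg_lim _ (cvg_norm (ff z)))//; apply: limr_le; last exact: nearW.
  exact: cvgP (cvg_norm (ff z)).
split=> //; apply: fine_cvg; rewrite fineK; last exact: integrable_fin_num.
apply: (@dominated_cvg _ _ _ leb2 setT measurableT (fun n z => (f_ n z)%:E)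
  (fun z => (f z)%:E) (fun z => (g z)%:E)) => //.
- by move=> n; exact/measurable_EFinP.
- by move=> z _; apply: cvg_EFin; [exact: nearW|exact: ff].
- by move=> n z _ /=; rewrite lee_fin.
Qed.

Lemma integral_prod {R : realType} (f g : R -> R) :
  continuous f -> continuous g -> (forall t, 0 <= f t) -> (forall t, 0 <= g t) ->
  (\int[leb2]_z (f z.1 * g z.2)%:E =
   \int[@lebesgue_measure R]_t (f t)%:E * \int[@lebesgue_measure R]_t (g t)%:E)%E.
Proof.
move=> cf cg f0 g0.
have mf : measurable_fun setT (f : measurableTypeR R -> R).
  exact: continuous_measurable_fun.
have mg : measurable_fun setT (g : measurableTypeR R -> R).
  exact: continuous_measurable_fun.
have /measurable_EFinP mEf := mf; have /measurable_EFinP mEg := mg.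
rewrite /leb2 fubini_tonelli1//=; last 2 first.
- apply/measurable_EFinP; apply: measurable_funM.
    exact: (measurableT_comp mf).
  exact: (measurableT_comp mg).
- by move=> z; rewrite lee_fin mulr_ge0.
rewrite -ge0_integralZr//=; last 2 first.
- by move=> t _; rewrite lee_fin.
- by apply: integral_ge0 => t _; rewrite lee_fin.
apply: eq_integral => x _; rewrite /fubini_F /=.
under eq_integral do rewrite EFinM.
by rewrite ge0_integralZl//= ?lee_fin// => t _; rewrite lee_fin.
Qed.

(** A product of two one-dimensional kernels, so that it factors under Fubini. For small [e] it is
    an approximate identity; with [e = 1] and [a = 0] it is the integrable weight against which all
    decay is measured. *)
Definition poisson2 {R : realType} (e : R) (a z : R * R) : R :=
  poisson e a.1 z.1 * poisson e a.2 z.2.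

Lemma poisson2_gt0 {R : realType} (e : R) (a z : R * R) : 0 < e -> 0 < poisson2 e a z.
Proof. by move=> e0; rewrite mulr_gt0// poisson_gt0. Qed.

Lemma continuous_prod_fun {R : realType} (f g : R -> R) :
  continuous f -> continuous g -> continuous (fun z : R * R => f z.1 * g z.2).
Proof.
move=> cf cg z; apply: cvgM.
  by apply: continuous_comp; [exact: cvg_fst|exact: cf].
by apply: continuous_comp; [exact: cvg_snd|exact: cg].
Qed.

Lemma continuous_poisson2 {R : realType} (e : R) a : 0 < e ->
  continuous (poisson2 e a : R * R -> R).
Proof. by move=> e0; apply: continuous_prod_fun; exact: continuous_poisson. Qed.

Lemma integral_poisson2 {R : realType} (e : R) (a : R * R) : 0 < e ->
  (\int[leb2]_z (poisson2 e a z)%:E = (pi ^+ 2)%:E)%E.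
Proof.
move=> e0; rewrite (integral_prod (f := poisson e a.1) (g := poisson e a.2)).
- by rewrite !integral_poisson// -EFinM.
- exact: continuous_poisson.
- exact: continuous_poisson.
- by move=> t; exact/ltW/poisson_gt0.
- by move=> t; exact/ltW/poisson_gt0.
Qed.

Lemma int2_poisson2 {R : realType} (e : R) (a : R * R) : 0 < e -> int2 (poisson2 e a).
Proof.
move=> e0; apply/integrableP; split.
  apply/measurable_EFinP; apply: continuous_measurable2.
  exact: continuous_poisson2.
under eq_integral do rewrite gee0_abs ?lee_fin ?(ltW (poisson2_gt0 _ _ e0))//.
by rewrite integral_poisson2// ltry.
Qed.

Lemma I2_poisson2 {R : realType} (e : R) (a : R * R) : 0 < e ->
  \int[leb2]_z poisson2 e a z = pi ^+ 2.
Proof. by move=> e0; rewrite /Rintegral integral_poisson2. Qed.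

(** * Exchange of integrals against a bounded kernel *)

Lemma integrable_mul_prod {R : realType} d1 d2 (T1 : measurableType d1)
    (T2 : measurableType d2) (m1 : {sigma_finite_measure set T1 -> \bar R})
    (m2 : {sigma_finite_measure set T2 -> \bar R}) (g : T1 -> R) (e : T2 -> R)
    (b : T1 -> T2 -> R) :
  m1.-integrable setT (EFin \o g) -> m2.-integrable setT (EFin \o e) ->
  measurable_fun setT (fun w : T1 * T2 => b w.1 w.2) ->
  (forall x y, `|b x y| <= 1) ->
  (m1 \x m2)%E.-integrable setT (fun w => (g w.1 * e w.2 * b w.1 w.2)%:E).
Proof.
move=> ig ie mb b1.
pose F (w : T1 * T2) := (g w.1 * e w.2 * b w.1 w.2)%:E.
have /measurable_EFinP mg := measurable_int _ ig.
have /measurable_EFinP me := measurable_int _ ie.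
have mF : measurable_fun setT F.
  apply/measurable_EFinP; apply: measurable_funM => //; apply: measurable_funM.
    exact: (measurableT_comp mg).
  exact: (measurableT_comp me).
have mEg : measurable_fun setT (fun x => `|(g x)%:E|%E).
  by apply: measurableT_comp => //; exact/measurable_EFinP.
have mEe : measurable_fun setT (fun x => `|(e x)%:E|%E).
  by apply: measurableT_comp => //; exact/measurable_EFinP.
have mEF : measurable_fun setT (fun w => `|F w|%E) by apply: measurableT_comp.
have mEg2 : measurable_fun setT (fun w : T1 * T2 => `|(g w.1)%:E|%E).
  exact: (measurableT_comp mEg measurable_fst).
have mEe2 : measurable_fun setT (fun w : T1 * T2 => `|(e w.2)%:E|%E).
  exact: (measurableT_comp mEe measurable_snd).
apply/integrableP; split => //.
apply: (@le_lt_trans _ _ (\int[m1 \x m2]_w (`|(g w.1)%:E| * `|(e w.2)%:E|))%E).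
  apply: ge0_le_integral => //=.
  - exact: emeasurable_funM.
  by move=> w _; rewrite -EFinM lee_fin -normrM [leLHS]normrM ler_piMr.
rewrite fubini_tonelli1//=; last exact: emeasurable_funM.
rewrite (eq_integral (fun x => `|(g x)%:E| * \int[m2]_y `|(e y)%:E|)%E); last first.
  by move=> x _; rewrite /fubini_F /= ge0_integralZl.
rewrite ge0_integralZr//; last exact: integral_ge0.
have /integrableP[_ lg] := ig; have /integrableP[_ le] := ie.
by rewrite lte_mul_pinfty// ?integral_ge0// ge0_fin_numE// ?integral_ge0.
Qed.

Lemma integrable_mul_slice {R : realType} d1 d2 (T1 : measurableType d1)
    (T2 : measurableType d2) (m1 : {measure set T1 -> \bar R}) (g : T1 -> R)
    (b : T1 -> T2 -> R) y :
  m1.-integrable setT (EFin \o g) ->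
  measurable_fun setT (fun w : T1 * T2 => b w.1 w.2) ->
  (forall x y, `|b x y| <= 1) -> m1.-integrable setT (fun x => (g x * b x y)%:E).
Proof.
move=> ig mb b1; have /measurable_EFinP mg := measurable_int _ ig.
apply: (le_integrable _ _ _ ig) => //.
  apply/measurable_EFinP; apply: measurable_funM => //.
  exact: (measurableT_comp mb (measurable_pair2 y)).
by move=> x _ /=; rewrite lee_fin normrM ler_piMr.
Qed.

Lemma Rintegral_mul_swap {R : realType} d1 d2 (T1 : measurableType d1)
    (T2 : measurableType d2) (m1 : {sigma_finite_measure set T1 -> \bar R})
    (m2 : {sigma_finite_measure set T2 -> \bar R}) (g : T1 -> R) (e : T2 -> R)
    (b : T1 -> T2 -> R) :
  m1.-integrable setT (EFin \o g) -> m2.-integrable setT (EFin \o e) ->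
  measurable_fun setT (fun w : T1 * T2 => b w.1 w.2) ->
  (forall x y, `|b x y| <= 1) ->
  \int[m2]_y (e y * \int[m1]_x (g x * b x y)) =
  \int[m1]_x (g x * \int[m2]_y (e y * b x y)).
Proof.
move=> ig ie mb b1.
have ig1 y := integrable_mul_slice y ig mb b1.
have ie1 x : m2.-integrable setT (fun y => (e y * b x y)%:E).
  apply: (@integrable_mul_slice _ _ _ _ _ _ _ (fun y x => b x y)) => //.
  exact: (measurableT_comp mb (measurable_fun_pair measurable_snd measurable_fst)).
have := Fubini (integrable_mul_prod ig ie mb b1) => /= h.
rewrite /Rintegral; congr fine; transitivity (\int[m2]_y \int[m1]_x (g x * e y * b x y)%:E)%E.
  apply: eq_integral => y _.
  rewrite EFinM fineK ?integrable_fin_num// -integralZl//.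
  by apply: eq_integral => x _; rewrite -EFinM; congr EFin; ring.
rewrite -h; apply: eq_integral => x _.
rewrite EFinM fineK ?integrable_fin_num// -integralZl//.
by apply: eq_integral => y _; rewrite -EFinM; congr EFin; ring.
Qed.

(* The library only registers products of probability measures as
   sigma-finite. *)
Definition plane_measure {R : realType} : set (plane R) -> \bar R := @leb2 R.

HB.instance Definition _ (R : realType) :=
  Measure.copy (@plane_measure R) (Measure.sort (@leb2 R)).

Lemma plane_measure_sigma_finite {R : realType} :
  sigma_finite setT (@plane_measure R).
Proof.
have /sigma_finiteP[F [TF ndF Foo]] := sigma_finiteT (@lebesgue_measure R).
exists (fun n => F n `*` F n).
  rewrite -setXTT TF predeqE => -[x y]; split.
    move=> [/= [n _ Fnx] [k _ Gky]]; exists (maxn n k) => //; split.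
      by move: x Fnx; exact/subsetPset/ndF/leq_maxl.
    by move: y Gky; exact/subsetPset/ndF/leq_maxr.
  by move=> [n _ []/= ? ?]; split; exists n.
move=> k; have [? ?] := Foo k; split; first exact: measurableX.
by rewrite [ltLHS]product_measure1E// lte_mul_pinfty// ge0_fin_numE.
Qed.

HB.instance Definition _ (R : realType) := Measure_isSigmaFinite.Build _ _ _
  (@plane_measure R) plane_measure_sigma_finite.

Lemma I2_mul_swap {R : realType} (g e : R * R -> R) (b : R * R -> R * R -> R) :
  int2 g -> int2 e ->
  measurable_fun setT (fun w : plane R * plane R => b w.1 w.2) ->
  (forall x y, `|b x y| <= 1) ->
  \int[leb2]_y (e y * \int[leb2]_x (g x * b x y)) =
  \int[leb2]_x (g x * \int[leb2]_y (e y * b x y)).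
Proof.
move=> ig ie mb b1.
exact: (@Rintegral_mul_swap R _ _ (plane R) (plane R)
  (@plane_measure R) (@plane_measure R) g e b ig ie mb b1).
Qed.

(** Fubini gives measurability in the parameter once the integrand is jointly integrable. The
    positive integrable weight [poisson2 1 0 y] is inserted for that purpose and divided out at the
    end. *)
Lemma measurable_I2_slice {R : realType} (g : R * R -> R) (b : R * R -> R * R -> R) :
  int2 g -> measurable_fun setT (fun w : plane R * plane R => b w.1 w.2) ->
  (forall x y, `|b x y| <= 1) ->
  measurable_fun setT ((fun y => \int[leb2]_x (g x * b x y)) : plane R -> R).
Proof.
move=> ig mb b1; have ie := @int2_poisson2 R 1 0 ltr01.
have := @integrable_mul_prod R _ _ (plane R) (plane R) (@plane_measure R) (@plane_measure R)
  g (poisson2 1 0) b ig ie mb b1 => /measurable_fubini_G.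
rewrite /fubini_G /= => mG.
have p0 y : poisson2 1 0 y != 0 :> R by rewrite gt_eqF// poisson2_gt0.
have mP : measurable_fun setT ((fun y => (poisson2 1 0 y)^-1) : plane R -> R).
  by apply: continuous_measurable2 => y; apply: cvgV => //; exact: continuous_poisson2.
rewrite [X in measurable_fun _ X](_ : _ = fun y => (poisson2 1 0 y)^-1 *
  fine (\int[plane_measure]_x (g x * poisson2 1 0 y * b x y)%:E)).
  by apply: measurable_funM => //; apply: measurableT_comp mG.
apply/funext => y; rewrite -[LHS](mulKf (p0 y)); congr (_ * _).
rewrite -I2Z; last exact: (@integrable_mul_slice _ _ _ (plane R) (plane R) _ _ _ _ ig mb b1).
by rewrite /Rintegral; congr fine; apply: eq_integral => x _; congr EFin; ring.
Qed.

(** * Integrals of derivatives over the line *)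

Lemma integral_derive {R : realType} (F f : R -> R) (a b : R) :
  (forall x, is_derive x (1 : R) F (f x)) -> continuous f -> a < b ->
  (\int[@lebesgue_measure R]_(x in `[a, b]) (f x)%:E = (F b - F a)%:E)%E.
Proof.
move=> dF cf ab; rewrite EFinB.
have cF : continuous F.
  by move=> x; apply/differentiable_continuous/derivable1_diffP; exact: ex_derive.
apply: continuous_FTC2 => //.
- exact: continuous_subspaceT.
- split; first by move=> x _; exact: ex_derive.
    exact/cvg_at_right_filter/cF.
  exact/cvg_at_left_filter/cF.
- by move=> x _; rewrite derive1E; exact: derive_val.
Qed.

Lemma cvg_integral_growing_itv {R : realType} (g : R -> R) : int1 g ->
  (fun n : nat => \int[@lebesgue_measure R]_(x in `[(- n%:R)%R, n%:R%R]) (g x)%:E)%E @ \oo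
    --> (\int[@lebesgue_measure R]_x (g x)%:E)%E.
Proof.
move=> ig.
have mg := measurable_int _ ig.
under eq_fun do rewrite integral_mkcond.
apply: (@dominated_cvg _ _ _ (@lebesgue_measure R) setT measurableT _ _
  (fun t => `|(g t)%:E|%E)) => //.
- by move=> n; apply/(measurable_restrictT _ _).1 => //; exact: measurable_funTS.
- move=> t _; apply: cvg_near_cst; near=> n.
  rewrite patchE mem_set//= in_itv/= -ler_norml.
  by near: n; exact: nbhs_infty_ger.
- by apply: integrable_abse.
- by move=> n t _; rewrite patchE; case: ifP => //; rewrite abse0.
Unshelve. all: by end_near. Qed.

Lemma int1_poisson {R : realType} (e a : R) : 0 < e -> int1 (poisson e a).
Proof.
move=> e0; apply/integrableP; split.
  apply/measurable_EFinP; apply: continuous_measurable_fun; exact: continuous_poisson.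
under eq_integral do rewrite gee0_abs ?lee_fin ?(ltW (poisson_gt0 _ _ e0))//.
by rewrite integral_poisson// ltry.
Qed.

Lemma int1_le {R : realType} (f g : R -> R) :
  measurable_fun setT f -> (forall t, `|f t| <= g t) -> int1 g -> int1 f.
Proof.
move=> mf fg ig; apply: (le_integrable _ _ _ ig) => //.
  exact/measurable_EFinP.
by move=> z _ /=; rewrite lee_fin (le_trans (fg z))// ler_norm.
Qed.

Lemma cvg_poisson_nat {R : realType} (s : R) : `|s| = 1 ->
  (fun n : nat => poisson 1 0 (s * n%:R)) @ \oo --> (0 : R).
Proof.
move=> s1.
have h : (fun n : nat => harmonic n : R) @ \oo --> (0 : R) by exact: cvg_harmonic.
rewrite -cvg_shiftS.
apply: (@squeeze_cvgr _ _ _ _ (fun=> 0) harmonic _ _ _ _ h); last exact: cvg_cst.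
apply: nearW => n.
rewrite ltW ?poisson_gt0//= /poisson /harmonic subr0 div1r expr1n.
rewrite exprMn -[s ^+ 2]ger0_norm ?sqr_ge0// normrX s1 expr1n mul1r.
rewrite lef_pV2 ?posrE ?ltr_wpDr ?sqr_ge0 ?ltr0n//.
have : (1 : R) <= n.+1%:R by rewrite ler1n.
nra.
Qed.

Lemma integral_derive_decay {R : realType} (u v : R -> R) (M : R) :
  (forall x, is_derive x (1 : R) u (v x)) -> continuous v ->
  (forall x, `|u x| <= M * poisson 1 0 x) -> (forall x, `|v x| <= M * poisson 1 0 x) ->
  (\int[@lebesgue_measure R]_x (v x)%:E = 0)%E.
Proof.
move=> dv cv uM vM.
have iv : int1 v.
  apply: (@int1_le _ _ (fun x => M * poisson 1 0 x)) => //.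
    exact: continuous_measurable_fun.
  by have := integrableZl measurableT M (@int1_poisson R 1 0 ltr01).
have u0 (s : R) : `|s| = 1 -> (fun n : nat => u (s * n%:R)) @ \oo --> (0 : R).
  move=> s1; apply: norm_cvg0.
  have h : (fun n : nat => M * poisson 1 0 (s * n%:R)) @ \oo --> (0 : R).
    by rewrite -[X in _ --> X](mulr0 M); apply: cvgM; [exact: cvg_cst|exact: cvg_poisson_nat].
  apply: (@squeeze_cvgr _ _ _ _ (fun=> 0) _ _ _ _ _ h); last exact: cvg_cst.
  by apply: nearW => n; rewrite normr_ge0 uM.
have := cvg_integral_growing_itv iv.
have -> : (\int[@lebesgue_measure R]_x (v x)%:E)%E = (\int[@lebesgue_measure R]_x v x)%:E.
  by rewrite fineK// integrable_fin_num.
move=> h; congr EFin.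
have h2 : (fun n : nat => u n%:R - u (- n%:R)) @ \oo --> (0 : R).
  rewrite -[X in _ --> X](subrr 0); apply: cvgB.
    by have := u0 1 (normr1 _); under eq_fun do rewrite mul1r.
  by have := u0 (-1); rewrite normrN1; under eq_fun do rewrite mulN1r; exact.
have {}h : (fun n : nat => (u n%:R - u (- n%:R))%:E) @ \oo --> (\int[@lebesgue_measure R]_x v x)%:E.
  apply: cvg_trans h; apply: near_eq_cvg; near=> n.
  have n0 : (0 : R) < n%:R by rewrite ltr0n; near: n; exact: nbhs_infty_gt.
  by apply: integral_derive => //; lra.
exact: cvg_unique (fine_cvg h) h2.
Unshelve. all: by end_near. Qed.

Lemma cvg_Rintegral_growing_itv {R : realType} (g : R -> R) : int1 g ->
  (fun n : nat => \int[@lebesgue_measure R]_(x in `[(- n%:R)%R, n%:R%R]) g x) @ \oo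
    --> \int[@lebesgue_measure R]_x g x.
Proof.
move=> ig; apply: fine_cvg; rewrite fineK; last exact: integrable_fin_num.
exact: cvg_integral_growing_itv.
Qed.

(** * The Abel factor and its Fourier transform, twice the Poisson kernel *)

Definition abel {R : realType} (e x : R) : R := expR (- (e * `|x|)).

Lemma abel_gt0 {R : realType} (e x : R) : 0 < abel e x.
Proof. exact: expR_gt0. Qed.

Lemma abel_le1 {R : realType} (e x : R) : 0 < e -> abel e x <= 1.
Proof.
by move=> e0; rewrite -[leRHS]expR0 ler_expR oppr_le0 mulr_ge0// ltW.
Qed.

Lemma continuous_abel {R : realType} (e : R) : continuous (abel e).
Proof.
move=> x; apply: continuous_comp; last exact: continuous_expR.
apply: cvgN; apply: cvgM; first exact: cvg_cst.
exact: norm_continuous.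
Qed.

Lemma abel_le {R : realType} (e x : R) : 0 < e ->
  abel e x <= (1 + 2 / e ^+ 2) * poisson 1 0 x.
Proof.
move=> e0; rewrite /abel expRN /poisson subr0 expr1n div1r.
have h : 1 + (e * `|x|) ^+ 2 / 2 <= expR (e * `|x|).
  by apply: (expR_ge1Dxn 1); rewrite mulr_ge0// ltW.
have x0 : 0 < 1 + x ^+ 2 by rewrite ltr_wpDr ?sqr_ge0.
rewrite -(ler_pM2r x0) mulfVK ?gt_eqF// ler_pdivrMl ?expR_gt0//.
have e2 : 0 < e ^+ 2 by rewrite exprn_gt0.
have sq : `|x| ^+ 2 = x ^+ 2 by rewrite real_normK ?num_real.
rewrite exprMn sq in h.
have -> : 1 + x ^+ 2 = (1 + 2 / e ^+ 2) * 1 + x ^+ 2 - 2 / e ^+ 2 by ring.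
apply: (@le_trans _ _ ((1 + 2 / e ^+ 2) * (1 + e ^+ 2 * x ^+ 2 / 2))).
  rewrite [leRHS](_ : _ = 1 + 2 / e ^+ 2 + x ^+ 2 + e ^+ 2 * x ^+ 2 / 2); last first.
    by field; rewrite gt_eqF.
  have : 0 <= 2 / e ^+ 2 by rewrite divr_ge0// ltW.
  have : 0 <= e ^+ 2 * x ^+ 2 / 2 by rewrite divr_ge0// mulr_ge0 ?sqr_ge0.
  by lra.
rewrite mulrC ler_wpM2r// addr_ge0// divr_ge0// ltW//.
Qed.

Lemma int1_abel {R : realType} (e : R) : 0 < e -> int1 (abel e).
Proof.
move=> e0; apply: (@int1_le _ _ (fun x => (1 + 2 / e ^+ 2) * poisson 1 0 x)).
- apply: continuous_measurable_fun; exact: continuous_abel.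
- by move=> x; rewrite gtr0_norm ?abel_gt0// abel_le.
- by have := integrableZl measurableT (1 + 2 / e ^+ 2) (@int1_poisson R 1 0 ltr01).
Qed.

Lemma cvg_expR_nat {R : realType} (e : R) : 0 < e ->
  (fun n : nat => expR (- (e * n%:R))) @ \oo --> (0 : R).
Proof.
move=> e0; have e1 : `|expR (- e)| < 1.
  by rewrite gtr0_norm ?expR_gt0// expR_lt1 oppr_lt0.
have := cvg_geometric 1 e1; rewrite /geometric /=.
by under eq_fun do rewrite mul1r -expRM_natl mulrN mulrC.
Qed.

(** The kink of [abel e] at 0 forces two primitives: [F] on the right half-line, where the factor is
    e^{-ex}, and [G] on the left one. The exponential bounds make them vanish at the respective
    infinities, and the values at 0 remain. *)
Lemma integral_abel_mul {R : realType} (e C : R) (k F G : R -> R) : 0 < e ->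
  continuous k -> (forall x, `|k x| <= 1) ->
  (forall x, is_derive x (1 : R) F (expR (- (e * x)) * k x)) ->
  (forall x, is_derive x (1 : R) G (expR (e * x) * k x)) ->
  (forall x, `|F x| <= C * expR (- (e * x))) ->
  (forall x, `|G x| <= C * expR (e * x)) ->
  int1 (fun x => abel e x * k x) /\
  \int[@lebesgue_measure R]_x (abel e x * k x) = G 0 - F 0.
Proof.
move=> e0 ck k1 dF dG FC GC.
have cf : continuous (fun x => abel e x * k x).
  by move=> x; apply: cvgM; [exact: continuous_abel|exact: ck].
have ifx : int1 (fun x => abel e x * k x).
  apply: (@int1_le _ _ (abel e)); last exact: int1_abel.
    exact: continuous_measurable_fun.
  by move=> x; rewrite normrM (gtr0_norm (abel_gt0 _ _)) ler_piMr// ltW ?abel_gt0.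
split=> //.
apply: cvg_unique (cvg_Rintegral_growing_itv ifx) _ => //.
have small (H : R -> R) : (forall x, `|H x| <= C * expR (- (e * x))) ->
    (fun n : nat => H n%:R) @ \oo --> (0 : R).
  move=> HC; apply: norm_cvg0.
  have h : (fun n : nat => C * expR (- (e * n%:R))) @ \oo --> (0 : R).
    by rewrite -[X in _ --> X](mulr0 C); apply: cvgM; [exact: cvg_cst|exact: cvg_expR_nat].
  apply: (@squeeze_cvgr _ _ _ _ (fun=> 0) _ _ _ _ _ h); last exact: cvg_cst.
  by apply: nearW => n; rewrite normr_ge0 HC.
have GC' x : `|G (- x)| <= C * expR (- (e * x)) by rewrite -mulrN.
have h : (fun n : nat => (G 0 - G (- n%:R)) + (F n%:R - F 0)) @ \oo --> G 0 - F 0.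
  rewrite -[X in _ --> X](_ : (G 0 - 0) + (0 - F 0) = _); last by rewrite subr0 sub0r.
  apply: cvgD; apply: cvgB; try exact: cvg_cst.
    exact: (small (G \o -%R)).
  exact: small.
apply: cvg_trans h; apply: near_eq_cvg; near=> n.
have n0 : (0 : R) < n%:R by rewrite ltr0n; near: n; exact: nbhs_infty_gt.
have ifS (A : set R) : measurable A -> lebesgue_measure.-integrable A (EFin \o (fun x => abel e x * k x)).
  by move=> mA; apply: (integrableS measurableT).
have := @Rintegral_itvB R (fun x => abel e x * k x) (BLeft (- n%:R)) (BRight n%:R) 0
  (ifS _ (measurable_itv _)).
rewrite !bnd_simp/= oppr_le0 => /(_ (ltW n0) (ltW n0)).
rewrite Rintegral_itv_obnd_cbnd; last exact: ifS.
move=> /(canRL (subrK _)) ->; rewrite addrC; congr (_ + _).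
  transitivity (fine (F n%:R - F 0)%:E) => //; rewrite -(integral_derive dF)//; last first.
    move=> x; apply: cvgM; last exact: ck.
    apply: continuous_comp; last exact: continuous_expR.
    by apply: cvgN; apply: cvgM; [exact: cvg_cst|exact: cvg_id].
  congr fine; apply: eq_integral => x; rewrite inE/= in_itv/= => /andP[x0 _].
  by rewrite /abel ger0_norm.
transitivity (fine (G 0 - G (- n%:R))%:E) => //; rewrite -(integral_derive dG)//; last 2 first.
- move=> x; apply: cvgM; last exact: ck.
  apply: continuous_comp; last exact: continuous_expR.
  by apply: cvgM; [exact: cvg_cst|exact: cvg_id].
- by rewrite oppr_lt0.
congr fine; apply: eq_integral => x; rewrite inE/= in_itv/= => /andP[_ x0].
by rewrite /abel ler0_norm// mulrN opprK.
Unshelve. all: by end_near. Qed.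

Lemma is_derive_scale {R : realType} (c x : R) : is_derive x (1 : R) (fun y => c * y) c.
Proof.
have : is_derive x (1 : R) (c \*: id) (c *: 1) by exact: is_deriveZ.
by rewrite scaler1.
Qed.

Lemma is_derive_expR_scale {R : realType} (c x : R) :
  is_derive x (1 : R) (fun y => expR (c * y)) (c * expR (c * x)).
Proof.
rewrite mulrC; exact: (is_derive1_comp (is_derive_expR _) (is_derive_scale c x)).
Qed.

Lemma is_derive_sin_scale {R : realType} (c x : R) :
  is_derive x (1 : R) (fun y => sin (c * y)) (c * cos (c * x)).
Proof.
rewrite mulrC; exact: (is_derive1_comp (is_derive_sin _) (is_derive_scale c x)).
Qed.

Lemma is_derive_cos_scale {R : realType} (c x : R) :
  is_derive x (1 : R) (fun y => cos (c * y)) (- (c * sin (c * x))).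
Proof.
rewrite -mulrN mulrC; exact: (is_derive1_comp (is_derive_cos _) (is_derive_scale c x)).
Qed.

Lemma is_derive_exp_trig {R : realType} (c t a b x : R) :
  is_derive x (1 : R) (fun y => expR (c * y) * (a * cos (t * y) + b * sin (t * y)))
    (expR (c * x) * ((c * a + t * b) * cos (t * x) + (c * b - t * a) * sin (t * x))).
Proof.
have h1 := is_derive_expR_scale c x.
have h2 := is_deriveZ a (is_derive_cos_scale t x).
have h3 := is_deriveZ b (is_derive_sin_scale t x).
apply: (is_derive_eq (is_deriveM h1 (is_deriveD h2 h3))).
change (expR (c * x) * (a * - (t * sin (t * x)) + b * (t * cos (t * x))) +
  (a * cos (t * x) + b * sin (t * x)) * (c * expR (c * x)) =
  expR (c * x) * ((c * a + t * b) * cos (t * x) + (c * b - t * a) * sin (t * x))).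
ring.
Qed.

Lemma exp_trig_le {R : realType} (c t a b x : R) :
  `|expR (c * x) * (a * cos (t * x) + b * sin (t * x))| <= (`|a| + `|b|) * expR (c * x).
Proof.
rewrite normrM (gtr0_norm (expR_gt0 _)) mulrC ler_wpM2r ?expR_ge0//.
rewrite (le_trans (ler_normD _ _))// !normrM lerD// ler_piMr//.
  by rewrite ler_norml cos_geN1 cos_le1.
by rewrite ler_norml sin_geN1 sin_le1.
Qed.

Lemma integral_abel_cos {R : realType} (e t : R) : 0 < e ->
  int1 (fun x => abel e x * cos (t * x)) /\
  \int[@lebesgue_measure R]_x (abel e x * cos (t * x)) = 2 * poisson e 0 t.
Proof.
move=> e0; pose d := e ^+ 2 + t ^+ 2.
have d0 : d != 0 by rewrite gt_eqF// /d ltr_wpDr ?sqr_ge0 ?exprn_gt0.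
have [] := @integral_abel_mul R e (e / d + `|t| / d) (fun x => cos (t * x))
  (fun y => expR ((- e) * y) * (- (e / d) * cos (t * y) + t / d * sin (t * y)))
  (fun y => expR (e * y) * (e / d * cos (t * y) + t / d * sin (t * y))) e0.
- move=> x; apply: continuous_comp; last exact: continuous_cos.
  by apply: cvgM; [exact: cvg_cst|exact: cvg_id].
- by move=> x; rewrite ler_norml cos_geN1 cos_le1.
- move=> x; apply: (is_derive_eq (is_derive_exp_trig (- e) t (- (e / d)) (t / d) x)); rewrite mulNr; congr (_ * _).
  rewrite (_ : _ + _ = (e ^+ 2 + t ^+ 2) / d * cos (t * x)); last by ring.
  by rewrite divff// mul1r.
- move=> x; apply: (is_derive_eq (is_derive_exp_trig e t (e / d) (t / d) x)); congr (_ * _).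
  rewrite (_ : _ + _ = (e ^+ 2 + t ^+ 2) / d * cos (t * x)); last by ring.
  by rewrite divff// mul1r.
- move=> x; rewrite (le_trans (exp_trig_le _ _ _ _ _))// mulNr normrN !normrM.
  by rewrite (gtr0_norm e0) normfV (ger0_norm (x := d))// /d addr_ge0 ?sqr_ge0.
- move=> x; rewrite (le_trans (exp_trig_le _ _ _ _ _))// !normrM.
  by rewrite (gtr0_norm e0) normfV (ger0_norm (x := d))// /d addr_ge0 ?sqr_ge0.
move=> i1 ->; split=> //.
by rewrite !mulr0 expR0 cos0 sin0 /poisson subr0 -/d; ring.
Qed.

Lemma integral_abel_sin {R : realType} (e t : R) : 0 < e ->
  int1 (fun x => abel e x * sin (t * x)) /\
  \int[@lebesgue_measure R]_x (abel e x * sin (t * x)) = 0.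
Proof.
move=> e0; pose d := e ^+ 2 + t ^+ 2.
have d0 : d != 0 by rewrite gt_eqF// /d ltr_wpDr ?sqr_ge0 ?exprn_gt0.
have [] := @integral_abel_mul R e (`|t| / d + e / d) (fun x => sin (t * x))
  (fun y => expR ((- e) * y) * (- (t / d) * cos (t * y) + - (e / d) * sin (t * y)))
  (fun y => expR (e * y) * (- (t / d) * cos (t * y) + e / d * sin (t * y))) e0.
- move=> x; apply: continuous_comp; last exact: continuous_sin.
  by apply: cvgM; [exact: cvg_cst|exact: cvg_id].
- by move=> x; rewrite ler_norml sin_geN1 sin_le1.
- move=> x; apply: (is_derive_eq (is_derive_exp_trig (- e) t (- (t / d)) (- (e / d)) x)); rewrite mulNr; congr (_ * _).
  rewrite (_ : _ + _ = (e ^+ 2 + t ^+ 2) / d * sin (t * x)); last by ring.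
  by rewrite divff// mul1r.
- move=> x; apply: (is_derive_eq (is_derive_exp_trig e t (- (t / d)) (e / d) x)); congr (_ * _).
  rewrite (_ : _ + _ = (e ^+ 2 + t ^+ 2) / d * sin (t * x)); last by ring.
  by rewrite divff// mul1r.
- move=> x; rewrite (le_trans (exp_trig_le _ _ _ _ _))// mulNr !normrN !normrM.
  by rewrite (gtr0_norm e0) normfV (ger0_norm (x := d))// /d addr_ge0 ?sqr_ge0.
- move=> x; rewrite (le_trans (exp_trig_le _ _ _ _ _))// normrN !normrM.
  by rewrite (gtr0_norm e0) normfV (ger0_norm (x := d))// /d addr_ge0 ?sqr_ge0.
move=> i1 ->; split=> //.
by rewrite !mulr0 expR0 cos0 sin0; ring.
Qed.

Lemma Rintegral_prod {R : realType} (f g : R -> R) :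
  continuous f -> continuous g -> int1 f -> int1 g ->
  int2 (fun z => f z.1 * g z.2) /\
  \int[leb2]_z (f z.1 * g z.2) =
    \int[@lebesgue_measure R]_t f t * \int[@lebesgue_measure R]_t g t.
Proof.
move=> cf cg if1 ig1.
have i2 : int2 (fun z => f z.1 * g z.2).
  apply/integrableP; split.
    by apply/measurable_EFinP; apply: continuous_measurable2; exact: continuous_prod_fun.
  rewrite [ltLHS](_ : _ = \int[leb2]_z (`|f z.1| * `|g z.2|)%:E)%E; last first.
    by apply: eq_integral => z _; rewrite abse_EFin normrM.
  rewrite (integral_prod (f := fun t => `|f t|) (g := fun t => `|g t|))//; last 2 first.
  - by move=> x; apply: continuous_comp; [exact: cf|exact: norm_continuous].
  - by move=> x; apply: continuous_comp; [exact: cg|exact: norm_continuous].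
  have /integrableP[_ lf] := if1; have /integrableP[_ lg] := ig1.
  by rewrite lte_mul_pinfty ?integral_ge0// ge0_fin_numE ?integral_ge0.
split=> //; rewrite /Rintegral /leb2 -integral12_prod_meas1//= /fubini_F/=.
rewrite [X in fine X = _](_ : _ = \int[@lebesgue_measure R]_x
    ((\int[@lebesgue_measure R]_t g t)%:E * (f x)%:E))%E.
  rewrite integralZl//= fineM//; last exact: integrable_fin_num.
  by rewrite mulrC.
apply: eq_integral => x _; rewrite muleC fineK; last exact: integrable_fin_num.
by rewrite -integralZl.
Qed.

Definition abel2 {R : realType} (e : R) (z : R * R) : R := abel e z.1 * abel e z.2.

Lemma integral_abel2_cos {R : realType} (e : R) (t : R * R) : 0 < e ->
  \int[leb2]_z (abel2 e z * cos (dot2 t z)) = 4 * poisson2 e 0 t.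
Proof.
move=> e0.
have [ic1 ec1] := integral_abel_cos t.1 e0; have [ic2 ec2] := integral_abel_cos t.2 e0.
have [is1 es1] := integral_abel_sin t.1 e0; have [is2 es2] := integral_abel_sin t.2 e0.
have cc s : continuous (fun x : R => abel e x * cos (s * x)).
  move=> x; apply: cvgM; first exact: continuous_abel.
  apply: continuous_comp; last exact: continuous_cos.
  by apply: cvgM; [exact: cvg_cst|exact: cvg_id].
have cs s : continuous (fun x : R => abel e x * sin (s * x)).
  move=> x; apply: cvgM; first exact: continuous_abel.
  apply: continuous_comp; last exact: continuous_sin.
  by apply: cvgM; [exact: cvg_cst|exact: cvg_id].
have [i1 e1] := Rintegral_prod (cc t.1) (cc t.2) ic1 ic2.
have [i2 e2] := Rintegral_prod (cs t.1) (cs t.2) is1 is2.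
transitivity (\int[leb2]_z ((abel e z.1 * cos (t.1 * z.1)) * (abel e z.2 * cos (t.2 * z.2))
  - (abel e z.1 * sin (t.1 * z.1)) * (abel e z.2 * sin (t.2 * z.2)))).
  by apply: eq_Rintegral => z _; rewrite /abel2 /dot2 cosD; ring.
by rewrite I2B// e1 e2 ec1 ec2 es1 /poisson2 /=; ring.
Qed.

Lemma integral_abel2_sin {R : realType} (e : R) (t : R * R) : 0 < e ->
  \int[leb2]_z (abel2 e z * sin (dot2 t z)) = 0.
Proof.
move=> e0.
have [ic1 ec1] := integral_abel_cos t.1 e0; have [ic2 ec2] := integral_abel_cos t.2 e0.
have [is1 es1] := integral_abel_sin t.1 e0; have [is2 es2] := integral_abel_sin t.2 e0.
have cc s : continuous (fun x : R => abel e x * cos (s * x)).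
  move=> x; apply: cvgM; first exact: continuous_abel.
  apply: continuous_comp; last exact: continuous_cos.
  by apply: cvgM; [exact: cvg_cst|exact: cvg_id].
have cs s : continuous (fun x : R => abel e x * sin (s * x)).
  move=> x; apply: cvgM; first exact: continuous_abel.
  apply: continuous_comp; last exact: continuous_sin.
  by apply: cvgM; [exact: cvg_cst|exact: cvg_id].
have [i1 e1] := Rintegral_prod (cs t.1) (cc t.2) is1 ic2.
have [i2 e2] := Rintegral_prod (cc t.1) (cs t.2) ic1 is2.
transitivity (\int[leb2]_z ((abel e z.1 * sin (t.1 * z.1)) * (abel e z.2 * cos (t.2 * z.2))
  + (abel e z.1 * cos (t.1 * z.1)) * (abel e z.2 * sin (t.2 * z.2)))).
  by apply: eq_Rintegral => z _; rewrite /abel2 /dot2 sinD; ring.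
by rewrite I2D// e1 e2 es1 es2; ring.
Qed.

Lemma int2_abel2 {R : realType} (e : R) : 0 < e -> int2 (abel2 e).
Proof.
by move=> e0; have [] := @Rintegral_prod R _ _ (@continuous_abel R e) (@continuous_abel R e)
  (int1_abel e0) (int1_abel e0).
Qed.

Lemma poisson_far {R : realType} (e r a t : R) : 0 < e -> 0 < r -> r <= `|t - a| ->
  poisson e a t <= e * (1 + r ^- 2) * poisson 1 a t.
Proof.
move=> e0 r0 rt; rewrite /poisson -!mulrA ler_wpM2l ?(ltW e0)// mul1r expr1n.
have st : r ^+ 2 <= (t - a) ^+ 2.
  by rewrite -[leRHS]real_normK ?num_real// ler_sqr ?nnegrE// ltW.
have r2 : 0 < r ^+ 2 by rewrite exprn_gt0.
have x0 : 0 < 1 + (t - a) ^+ 2 by rewrite ltr_wpDr ?sqr_ge0.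
rewrite ler_pdivlMr// ler_pdivrMl ?poisson_den_gt0//.
have h : 1 <= r ^- 2 * (t - a) ^+ 2 by rewrite ler_pdivlMl// mulr1.
have e2 : 0 <= e ^+ 2 * (1 + r ^- 2).
  by rewrite mulr_ge0 ?sqr_ge0// addr_ge0// invr_ge0 sqr_ge0.
rewrite [leRHS]mulrDl; move: h e2; move: (r ^- 2) => u; lra.
Qed.

(** Approximate identity. Near [a] the oscillation of [G] is small. Elsewhere one of the two
    coordinates is far from its centre, and [poisson_far] bounds that factor by [e] times a fixed
    integrable function. The majorant [B] adds the near bound and the far bounds of both
    coordinates. *)
Lemma cvg_poisson2 {R : realType} (G : R * R -> R) (M : R) (a : R * R) :
  continuous G -> (forall z, `|G z| <= M) ->
  (fun n : nat => \int[leb2]_z (G z * poisson2 (n.+1%:R^-1) a z)) @ \oo --> pi ^+ 2 * G a.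
Proof.
move=> cG GM; have M0 : 0 <= M by exact: le_trans (GM a).
have mG := continuous_measurable2 cG.
apply/cvgrPdist_le => /= d d0.
have p2 : 0 < (pi : R) ^+ 2 by rewrite exprn_gt0// pi_gt0.
(* The kernel has mass [pi ^+ 2], so an oscillation [eta] contributes [d / 2]; the far region gets
   the other half. *)
pose eta : R := d / (2 * pi ^+ 2).
have eta0 : 0 < eta by rewrite divr_gt0// mulr_gt0.
have /cvgrPdist_lt/(_ _ eta0)/nbhs_ballP[r /= r0 rG] := cG a.
pose c := 1 + r ^- 2.
have c0 : 0 < c by rewrite ltr_wpDr// invr_ge0 sqr_ge0.
have h0 : (fun n : nat => 4 * M * c * pi ^+ 2 * harmonic n) @ \oo --> (0 : R).
  by rewrite -[X in _ --> X](mulr0 (4 * M * c * pi ^+ 2)); apply: cvgM; [exact: cvg_cst|exact: cvg_harmonic].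
have d2 : 0 < d / 2 by rewrite divr_gt0.
have /cvgrPdist_le/(_ _ d2) := h0.
apply: filterS => n; rewrite sub0r normrN => hn.
have e0 : 0 < n.+1%:R^-1 :> R by rewrite invr_gt0 ltr0n.
move: hn => /(le_trans (ler_norm _)); rewrite /harmonic /=.
move: (n.+1%:R^-1 : R) e0 => e e0 hn.
pose B (z : R * R) := eta * poisson2 e a z + 2 * M * (e * c) *
  (poisson 1 a.1 z.1 * poisson e a.2 z.2 + poisson e a.1 z.1 * poisson 1 a.2 z.2).
have [i1 e1] := Rintegral_prod (@continuous_poisson R 1 a.1 ltr01) (continuous_poisson (a:=a.2) e0)
  (int1_poisson a.1 ltr01) (int1_poisson a.2 e0).
have [i2 e2] := Rintegral_prod (continuous_poisson (a:=a.1) e0) (@continuous_poisson R 1 a.2 ltr01)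
  (int1_poisson a.1 e0) (int1_poisson a.2 ltr01).
have iB : int2 B by apply: int2D; [exact/int2Z/int2_poisson2|exact/int2Z/int2D].
have iP := int2_poisson2 a e0.
have iG : int2 (fun z => G z * poisson2 e a z).
  have := int2_mul_bounded iP mG GM; apply: eq_integrable => // z _; congr EFin; exact: mulrC.
rewrite -(I2_poisson2 a e0) mulrC -I2Z// -I2B//; last exact: int2Z.
apply: (@le_trans _ _ (\int[leb2]_z B z)).
  apply: I2_norm_le => //; first by apply: int2B => //; exact: int2Z.
  move=> z; rewrite -mulrBl normrM (gtr0_norm (poisson2_gt0 _ _ e0)) /B.
  have P0 := poisson2_gt0 a z e0.
  have q1 : 0 < poisson 1 a.1 z.1 * poisson e a.2 z.2 by rewrite mulr_gt0 ?poisson_gt0.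
  have q2 : 0 < poisson e a.1 z.1 * poisson 1 a.2 z.2 by rewrite mulr_gt0 ?poisson_gt0.
  have K0 : 0 <= 2 * M * (e * c) by rewrite !mulr_ge0// ltW.
  have GG : `|G a - G z| <= 2 * M.
    by rewrite (le_trans (ler_normB _ _))// mulr_natl mulr2n lerD.
  have [near_|far] := boolP ((`|z.1 - a.1| < r) && (`|z.2 - a.2| < r)).
    apply: (@le_trans _ _ (eta * poisson2 e a z)).
      rewrite ler_pM2r// ltW//; apply: rG.
      by split; rewrite /ball/= distrC; case/andP: near_.
    by rewrite lerDl mulr_ge0// addr_ge0// ltW.
  have hP : poisson2 e a z <= e * c * (poisson 1 a.1 z.1 * poisson e a.2 z.2 +
      poisson e a.1 z.1 * poisson 1 a.2 z.2).
    have ec : 0 <= e * c by rewrite mulr_ge0 ?ltW.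
    move: far; rewrite negb_and -!leNgt => /orP[h|h].
      apply: (@le_trans _ _ (e * c * poisson 1 a.1 z.1 * poisson e a.2 z.2)).
        by rewrite /poisson2 ler_pM2r ?poisson_gt0//; exact: poisson_far.
      rewrite -subr_ge0.
      rewrite (_ : _ - _ = e * c * (poisson e a.1 z.1 * poisson 1 a.2 z.2)); last by ring.
      by rewrite mulr_ge0// ltW.
    apply: (@le_trans _ _ (poisson e a.1 z.1 * (e * c * poisson 1 a.2 z.2))).
      by rewrite /poisson2 ler_pM2l ?poisson_gt0//; exact: poisson_far.
    rewrite -subr_ge0.
    rewrite (_ : _ - _ = e * c * (poisson 1 a.1 z.1 * poisson e a.2 z.2)); last by ring.
    by rewrite mulr_ge0// ltW.
  apply: (le_trans (ler_pM (normr_ge0 _) (ltW P0) GG hP)).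
  rewrite -subr_ge0 (_ : _ - _ = eta * poisson2 e a z); last by ring.
  by rewrite mulr_ge0// ltW.
rewrite I2D; last 2 first.
- exact/int2Z.
- exact/int2Z/int2D.
rewrite !I2Z//; last exact: int2D.
rewrite I2D// e1 e2 I2_poisson2// /Rintegral !integral_poisson//=.
rewrite (_ : eta * pi ^+ 2 = d / 2); last first.
  have half (D P : R) : 0 < P -> D / (2 * P) * P = D / 2.
    by move=> P0; field; rewrite gt_eqF.
  exact: half.
move: hn; rewrite -!expr2 => hn.
rewrite (_ : 2 * M * (e * c) * (pi ^+ 2 + pi ^+ 2) = 4 * M * c * pi ^+ 2 * e); last by ring.
lra.
Qed.

(** * Fourier inversion *)

(** [cintegral] is built from real and imaginary parts, so inversion is carried out on real cosine
    and sine transforms and reassembled in [fourier_inversion]. *)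
Definition fcos {R : realType} (G : R * R -> R) (xi : R * R) : R :=
  \int[leb2]_x (G x * cos (dot2 x xi)).

Definition fsin {R : realType} (G : R * R -> R) (xi : R * R) : R :=
  \int[leb2]_x (G x * sin (dot2 x xi)).

Lemma continuous_dot2 {R : realType} (z : R * R) : continuous (dot2 z).
Proof.
move=> x; apply: cvgD; apply: cvgM; try exact: cvg_cst.
  exact: cvg_fst.
exact: cvg_snd.
Qed.

Lemma dot2C {R : realType} (z x : R * R) : dot2 z x = dot2 x z.
Proof. by rewrite /dot2 mulrC [X in _ + X]mulrC. Qed.

Lemma measurable_dot2 {R : realType} :
  measurable_fun setT (fun w : plane R * plane R => dot2 w.1 w.2).
Proof.
have m11 : measurable_fun setT (fun w : plane R * plane R => w.1.1).
  exact: measurableT_comp measurable_fst measurable_fst.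
have m12 : measurable_fun setT (fun w : plane R * plane R => w.1.2).
  exact: measurableT_comp measurable_snd measurable_fst.
have m21 : measurable_fun setT (fun w : plane R * plane R => w.2.1).
  exact: measurableT_comp measurable_fst measurable_snd.
have m22 : measurable_fun setT (fun w : plane R * plane R => w.2.2).
  exact: measurableT_comp measurable_snd measurable_snd.
by apply: measurable_funD; apply: measurable_funM.
Qed.

Lemma continuous_cos_dot2 {R : realType} (z : R * R) :
  continuous (fun x => cos (dot2 x z)).
Proof.
under eq_fun do rewrite dot2C.
move=> x; apply: continuous_comp; [exact: continuous_dot2|exact: continuous_cos].
Qed.

Lemma continuous_sin_dot2 {R : realType} (z : R * R) :
  continuous (fun x => sin (dot2 x z)).
Proof.
under eq_fun do rewrite dot2C.
move=> x; apply: continuous_comp; [exact: continuous_dot2|exact: continuous_sin].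
Qed.

Lemma norm_cos_le1 {R : realType} (t : R) : `|cos t| <= 1.
Proof. by rewrite ler_norml cos_geN1 cos_le1. Qed.

Lemma norm_sin_le1 {R : realType} (t : R) : `|sin t| <= 1.
Proof. by rewrite ler_norml sin_geN1 sin_le1. Qed.

Lemma int2_mul_cos {R : realType} (G : R * R -> R) xi : int2 G ->
  int2 (fun x => G x * cos (dot2 x xi)).
Proof.
move=> iG; apply: int2_mul_bounded => //.
  by apply: continuous_measurable2; exact: continuous_cos_dot2.
by move=> x; exact: norm_cos_le1.
Qed.

Lemma int2_mul_sin {R : realType} (G : R * R -> R) xi : int2 G ->
  int2 (fun x => G x * sin (dot2 x xi)).
Proof.
move=> iG; apply: int2_mul_bounded => //.
  by apply: continuous_measurable2; exact: continuous_sin_dot2.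
by move=> x; exact: norm_sin_le1.
Qed.

Lemma dot2BC {R : realType} (x z xi : R * R) : dot2 (x - z) xi = dot2 x xi - dot2 z xi.
Proof. by rewrite /dot2 /=; ring. Qed.

(* Abel summation of the inversion integral of a kernel [k], which will be
   [cos] or [sin]. *)
Lemma cvg_abel_inversion {R : realType} (k : R -> R) (G : R * R -> R) (z : R * R) :
  continuous k -> (forall t, `|k t| <= 1) -> int2 G ->
  int2 (fun xi => \int[leb2]_x (G x * k (dot2 (x - z) xi))) ->
  (fun n : nat => \int[leb2]_x (G x *
      \int[leb2]_xi (abel2 (n.+1%:R^-1) xi * k (dot2 (x - z) xi)))) @ \oo -->
    \int[leb2]_xi \int[leb2]_x (G x * k (dot2 (x - z) xi)).
Proof.
move=> ck k1 iG iK.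
pose K xi := \int[leb2]_x (G x * k (dot2 (x - z) xi)).
have e0 n : 0 < n.+1%:R^-1 :> R by rewrite invr_gt0 ltr0n.
have mb : measurable_fun setT (fun w : plane R * plane R => k (dot2 (w.1 - z) w.2)).
  apply: (measurableT_comp (continuous_measurable_fun ck)).
  under eq_fun do rewrite dot2BC.
  apply: measurable_funB; first exact: measurable_dot2.
  apply: (measurableT_comp (f := dot2 z : plane R -> R)); last exact: measurable_snd.
  by apply: continuous_measurable2; exact: continuous_dot2.
under eq_fun do rewrite -(I2_mul_swap iG (int2_abel2 (e0 _)) mb)//.
have mK : measurable_fun setT (K : plane R -> R) := int2_measurable iK.
apply: (@I2_dominated _ _ _ (fun xi => `|K xi|) _ _ _ _).2.
- move=> n; apply: measurable_funM => //; apply: continuous_measurable2.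
  by apply: continuous_prod_fun; exact: continuous_abel.
- move=> xi; rewrite -[X in _ --> X]mul1r -/(K xi); apply: cvgM; last exact: cvg_cst.
  have a1 (t : R) : (fun n : nat => abel (n.+1%:R^-1) t) @ \oo --> (1 : R).
    have h : (fun n : nat => - (harmonic n * `|t|)) @ \oo --> (0 : R).
      rewrite -oppr0 -[X in _ --> - X](mul0r `|t|); apply: cvgN; apply: cvgM; last exact: cvg_cst.
      exact: cvg_harmonic.
    have : (fun n : nat => expR (- (harmonic n * `|t|))) @ \oo --> expR (0 : R).
      by apply: continuous_cvg; [exact: continuous_expR|exact: h].
    by rewrite expR0.
  by rewrite -[X in _ --> X]mulr1; apply: cvgM; exact: a1.
- exact: int2_abs.
- move=> n xi; rewrite normrM ler_piMl// ger0_norm; last first.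
    by rewrite mulr_ge0// ltW// abel_gt0.
  by rewrite mulr_ile1 ?abel_le1// ltW// abel_gt0.
Qed.

(** The addition formulas turn the left-hand sides into iterated integrals of cos and sin of
    [dot2 (x - z) xi]. With the Abel factor the order may be exchanged: the inner cosine integral is
    then four times a Poisson kernel centred at [z], and the inner sine integral is 0 by oddness. *)
Lemma fourier_inversion_real {R : realType} (G : R * R -> R) (M : R) (z : R * R) :
  continuous G -> (forall z, `|G z| <= M) -> int2 G -> int2 (fcos G) -> int2 (fsin G) ->
  \int[leb2]_xi (fcos G xi * cos (dot2 z xi) + fsin G xi * sin (dot2 z xi))
    = (2 * pi) ^+ 2 * G z /\
  \int[leb2]_xi (fsin G xi * cos (dot2 z xi) - fcos G xi * sin (dot2 z xi)) = 0.
Proof.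
move=> cG GM iG ic is_.
have e0 n : 0 < n.+1%:R^-1 :> R by rewrite invr_gt0 ltr0n.
have Ec xi : fcos G xi * cos (dot2 z xi) + fsin G xi * sin (dot2 z xi) =
    \int[leb2]_x (G x * cos (dot2 (x - z) xi)).
  rewrite [X in X + _]mulrC [X in _ + X]mulrC /fcos /fsin -!I2Z; last 2 first.
  - exact: int2_mul_sin.
  - exact: int2_mul_cos.
  rewrite -I2D; last 2 first.
  - exact/int2Z/int2_mul_cos.
  - exact/int2Z/int2_mul_sin.
  by apply: eq_Rintegral => x _; rewrite dot2BC cosB; ring.
have Es xi : fsin G xi * cos (dot2 z xi) - fcos G xi * sin (dot2 z xi) =
    \int[leb2]_x (G x * sin (dot2 (x - z) xi)).
  rewrite [X in X - _]mulrC [X in _ - X]mulrC /fcos /fsin -!I2Z; last 2 first.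
  - exact: int2_mul_cos.
  - exact: int2_mul_sin.
  rewrite -I2B; last 2 first.
  - exact/int2Z/int2_mul_sin.
  - exact/int2Z/int2_mul_cos.
  by apply: eq_Rintegral => x _; rewrite dot2BC sinB; ring.
have icc xi0 : int2 (fun xi => fcos G xi * cos (dot2 xi0 xi)).
  by under eq_fun do rewrite dot2C; exact: int2_mul_cos.
have ics xi0 : int2 (fun xi => fcos G xi * sin (dot2 xi0 xi)).
  by under eq_fun do rewrite dot2C; exact: int2_mul_sin.
have isc xi0 : int2 (fun xi => fsin G xi * cos (dot2 xi0 xi)).
  by under eq_fun do rewrite dot2C; exact: int2_mul_cos.
have iss xi0 : int2 (fun xi => fsin G xi * sin (dot2 xi0 xi)).
  by under eq_fun do rewrite dot2C; exact: int2_mul_sin.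
have iKc : int2 (fun xi => \int[leb2]_x (G x * cos (dot2 (x - z) xi))).
  by under eq_fun do rewrite -Ec; exact: int2D.
have iKs : int2 (fun xi => \int[leb2]_x (G x * sin (dot2 (x - z) xi))).
  by under eq_fun do rewrite -Es; exact: int2B.
have hc := cvg_abel_inversion (@continuous_cos R) norm_cos_le1 iG iKc.
have hs := cvg_abel_inversion (@continuous_sin R) norm_sin_le1 iG iKs.
split.
  under eq_Rintegral do rewrite Ec.
  apply: cvg_unique hc _ => //.
  have h : (fun n : nat => 4 * \int[leb2]_x (G x * poisson2 (n.+1%:R^-1) z x)) @ \oo -->
      4 * (pi ^+ 2 * G z).
    by apply: cvgM; [exact: cvg_cst|exact: (cvg_poisson2 (M:=M))].
  rewrite (_ : (2 * pi) ^+ 2 * G z = 4 * (pi ^+ 2 * G z)); last by ring.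
  apply: cvg_trans h; apply: near_eq_cvg; apply: nearW => n.
  rewrite -I2Z; last first.
    have := int2_mul_bounded (int2_poisson2 z (e0 n)) (continuous_measurable2 cG) GM.
    by apply: eq_integrable => // x _; congr EFin; exact: mulrC.
  apply: eq_Rintegral => x _; rewrite integral_abel2_cos// /poisson2 /poisson /=.
  by rewrite !subr0; ring.
under eq_Rintegral do rewrite Es.
have h0 : (fun n : nat => \int[leb2]_x (G x *
    \int[leb2]_xi (abel2 (n.+1%:R^-1) xi * sin (dot2 (x - z) xi)))) = fun=> 0.
  apply/funext => n; rewrite -[RHS](@I2_0 R); apply: eq_Rintegral => x _.
  by rewrite integral_abel2_sin// mulr0.
by rewrite h0 in hs; exact: cvg_unique hs (cvg_cst _).
Qed.

(** * Real and imaginary parts, modulus, unimodular numbers *)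

Section ComplexParts.
Context {R : rcfType}.
Implicit Types x y : R[i].

Lemma complexP x y : complex.Re x = complex.Re y -> complex.Im x = complex.Im y -> x = y.
Proof. by case: x => a b; case: y => c d /= -> ->. Qed.

Lemma ReM x y : complex.Re (x * y) =
  complex.Re x * complex.Re y - complex.Im x * complex.Im y.
Proof. by case: x => a b; case: y. Qed.

Lemma ImM x y : complex.Im (x * y) =
  complex.Re x * complex.Im y + complex.Im x * complex.Re y.
Proof. by case: x => a b; case: y. Qed.

Lemma ReD x y : complex.Re (x + y) = complex.Re x + complex.Re y.
Proof. by case: x => a b; case: y. Qed.

Lemma ImD x y : complex.Im (x + y) = complex.Im x + complex.Im y.
Proof. by case: x => a b; case: y. Qed.

Lemma ReN x : complex.Re (- x) = - complex.Re x.
Proof. by case: x. Qed.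

Lemma ImN x : complex.Im (- x) = - complex.Im x.
Proof. by case: x. Qed.

Lemma Re_sum (I : Type) (s : seq I) (P : pred I) (f : I -> R[i]) :
  complex.Re (\sum_(i <- s | P i) f i) = \sum_(i <- s | P i) complex.Re (f i).
Proof. by elim/big_rec2: _ => //= i y1 y2 _ <-; rewrite ReD. Qed.

Lemma Im_sum (I : Type) (s : seq I) (P : pred I) (f : I -> R[i]) :
  complex.Im (\sum_(i <- s | P i) f i) = \sum_(i <- s | P i) complex.Im (f i).
Proof. by elim/big_rec2: _ => //= i y1 y2 _ <-; rewrite ImD. Qed.
End ComplexParts.

Section Cabs.
Context {R : realType}.
Implicit Types x y : R[i].

Lemma cabsE x : `|x| = (cabs x)%:C.
Proof. by case: x. Qed.

Lemma cabs_ge0 x : 0 <= cabs x.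
Proof. by case: x => a b; rewrite /cabs /= sqrtr_ge0. Qed.

Lemma cabs_sqr x : cabs x ^+ 2 = complex.Re x ^+ 2 + complex.Im x ^+ 2.
Proof. by case: x => a b; rewrite /cabs /= sqr_sqrtr// addr_ge0 ?sqr_ge0. Qed.

Lemma cabsM x y : cabs (x * y) = cabs x * cabs y.
Proof.
have : `|x * y| = `|x| * `|y| by rewrite normrM.
by rewrite !cabsE -rmorphM/= => -[].
Qed.

Lemma cabsD x y : cabs (x + y) <= cabs x + cabs y.
Proof. by have := ler_normD x y; rewrite !cabsE -rmorphD/= lecR. Qed.

Lemma cabsN x : cabs (- x) = cabs x.
Proof. by rewrite /cabs normrN. Qed.

Lemma cabs0 : cabs (0 : R[i]) = 0.
Proof. by rewrite /cabs normr0. Qed.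

Lemma cabs1 : cabs (1 : R[i]) = 1.
Proof. by rewrite /cabs normr1. Qed.

Lemma cabs_real (a : R) : cabs a%:C = `|a|.
Proof. by rewrite /cabs normc_def /= expr0n addr0 sqrtr_sqr. Qed.

Lemma cabs_sum (I : Type) (s : seq I) (P : pred I) (f : I -> R[i]) :
  cabs (\sum_(i <- s | P i) f i) <= \sum_(i <- s | P i) cabs (f i).
Proof.
elim/big_rec2: _ => [|i y1 y2 _ h]; first by rewrite cabs0.
by rewrite (le_trans (cabsD _ _))// lerD2l.
Qed.

Lemma Re_le_cabs x : `|complex.Re x| <= cabs x.
Proof.
rewrite -[leRHS]ger0_norm ?cabs_ge0// -ler_sqr ?nnegrE ?normr_ge0// !real_normK ?num_real//.
by rewrite cabs_sqr lerDl sqr_ge0.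
Qed.

Lemma Im_le_cabs x : `|complex.Im x| <= cabs x.
Proof.
rewrite -[leRHS]ger0_norm ?cabs_ge0// -ler_sqr ?nnegrE ?normr_ge0// !real_normK ?num_real//.
by rewrite cabs_sqr lerDr sqr_ge0.
Qed.

Lemma cabs_le_ReIm x : cabs x <= `|complex.Re x| + `|complex.Im x|.
Proof.
rewrite -ler_sqr ?nnegrE ?cabs_ge0 ?addr_ge0//.
rewrite cabs_sqr sqrrD !real_normK ?num_real// addrAC lerDl.
by rewrite mulrn_wge0// mulr_ge0.
Qed.

Lemma cabs_cis (t : R) : cabs (cis t) = 1.
Proof. by rewrite /cabs normc_def /= cos2Dsin2 sqrtr1. Qed.

Lemma cisD (s t : R) : cis (s + t) = cis s * cis t.
Proof. by apply: complexP; rewrite ?ReM ?ImM /= ?cosD ?sinD; ring. Qed.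

Lemma cis0 : cis (0 : R) = 1.
Proof. by rewrite /cis cos0 sin0. Qed.

Lemma cisN (t : R) : cis (- t) = (cis t)^*.
Proof. by rewrite /cis cosN sinN. Qed.
End Cabs.

Section Inversion.
Context {R : realType}.

Definition fourier_nice (G : R * R -> R) :=
  [/\ continuous G, exists M, forall z, `|G z| <= M, int2 G, int2 (fcos G) & int2 (fsin G)].

Lemma fourierE (phi : R * R -> R[i]) xi :
  int2 (fun z => complex.Re (phi z)) -> int2 (fun z => complex.Im (phi z)) ->
  fourier phi xi = ((2 * pi) ^- 2 * (fcos (fun z => complex.Re (phi z)) xi
                                    + fsin (fun z => complex.Im (phi z)) xi)) +i*
    ((2 * pi) ^- 2 * (fcos (fun z => complex.Im (phi z)) xi
                      - fsin (fun z => complex.Re (phi z)) xi)).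
Proof.
move=> iP iQ; apply: complexP; rewrite /fourier ?ReM ?ImM /= mul0r ?subr0 ?addr0; congr (_ * _).
  rewrite /fcos /fsin -I2D; last 2 first.
  - exact: int2_mul_cos.
  - exact: int2_mul_sin.
  by apply: eq_Rintegral => z _; rewrite ReM /= cosN sinN; ring.
rewrite /fcos /fsin -I2B; last 2 first.
- exact: int2_mul_cos.
- exact: int2_mul_sin.
by apply: eq_Rintegral => z _; rewrite ImM /= cosN sinN; ring.
Qed.

Lemma cintegrable_fourier (phi : R * R -> R[i]) :
  fourier_nice (fun z => complex.Re (phi z)) ->
  fourier_nice (fun z => complex.Im (phi z)) -> cintegrable (fourier phi).
Proof.
move=> [_ _ iP cP sP] [_ _ iQ cQ sQ]; split.
  by under eq_fun do rewrite fourierE//=; apply: int2Z; exact: int2D.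
by under eq_fun do rewrite fourierE//=; apply: int2Z; exact: int2B.
Qed.

Lemma fourier_inversion (phi : R * R -> R[i]) z :
  fourier_nice (fun z => complex.Re (phi z)) ->
  fourier_nice (fun z => complex.Im (phi z)) ->
  inv_fourier (fourier phi) z = phi z.
Proof.
set P := fun z => complex.Re _; set Q := fun z => complex.Im _.
move=> [cP [MP bP] iP cPi sPi] [cQ [MQ bQ] iQ cQi sQi].
have [P1 P2] := fourier_inversion_real z cP bP iP cPi sPi.
have [Q1 Q2] := fourier_inversion_real z cQ bQ iQ cQi sQi.
have ic G : int2 G -> int2 (fun xi => G xi * cos (dot2 z xi)).
  by move=> iG; under eq_fun do rewrite dot2C; exact: int2_mul_cos.
have is_ G : int2 G -> int2 (fun xi => G xi * sin (dot2 z xi)).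
  by move=> iG; under eq_fun do rewrite dot2C; exact: int2_mul_sin.
have pn : ((2 : R) * pi) ^+ 2 != 0 by rewrite sqrf_eq0 mulf_neq0// lt0r_neq0// pi_gt0.
have iP1 : int2 (fun xi => fcos P xi * cos (dot2 z xi) + fsin P xi * sin (dot2 z xi)).
  by apply: int2D; [exact: ic|exact: is_].
have iQ1 : int2 (fun xi => fcos Q xi * cos (dot2 z xi) + fsin Q xi * sin (dot2 z xi)).
  by apply: int2D; [exact: ic|exact: is_].
have iP2 : int2 (fun xi => fsin P xi * cos (dot2 z xi) - fcos P xi * sin (dot2 z xi)).
  by apply: int2B; [exact: ic|exact: is_].
have iQ2 : int2 (fun xi => fsin Q xi * cos (dot2 z xi) - fcos Q xi * sin (dot2 z xi)).
  by apply: int2B; [exact: ic|exact: is_].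
apply: complexP.
  change (\int[leb2]_xi complex.Re (fourier phi xi * cis (dot2 z xi)) = P z).
  transitivity (\int[leb2]_xi ((2 * pi) ^- 2 *
    ((fcos P xi * cos (dot2 z xi) + fsin P xi * sin (dot2 z xi)) +
     (fsin Q xi * cos (dot2 z xi) - fcos Q xi * sin (dot2 z xi))))).
    apply: eq_Rintegral => xi _; rewrite ReM fourierE//= -/P -/Q; ring.
  by rewrite (I2Z _ (int2D iP1 iQ2)) (I2D iP1 iQ2) P1 Q2 addr0 mulKf.
change (\int[leb2]_xi complex.Im (fourier phi xi * cis (dot2 z xi)) = Q z).
transitivity (\int[leb2]_xi ((2 * pi) ^- 2 *
  ((fcos Q xi * cos (dot2 z xi) + fsin Q xi * sin (dot2 z xi)) -
   (fsin P xi * cos (dot2 z xi) - fcos P xi * sin (dot2 z xi))))).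
  apply: eq_Rintegral => xi _; rewrite ImM fourierE//= -/P -/Q; ring.
by rewrite (I2Z _ (int2B iQ1 iP2)) (I2B iQ1 iP2) Q1 P2 subr0 mulKf.
Qed.
End Inversion.

(** * Partial derivatives and weighted bounds on them *)

Definition upd2 {R : realType} (j : bool) (z : R * R) (t : R) : R * R :=
  if j then (z.1, t) else (t, z.2).

Definition coord2 {R : realType} (j : bool) (z : R * R) : R := if j then z.2 else z.1.

Lemma upd2_coord2 {R : realType} j (z : R * R) : upd2 j z (coord2 j z) = z.
Proof. by case: j z => -[]. Qed.

Lemma coord2_upd2 {R : realType} j (z : R * R) t : coord2 j (upd2 j z t) = t.
Proof. by case: j. Qed.

Lemma is_derive_slice {R : realType} j (F : R * R -> R) (z : R * R) (d : R) :
  is_derive z (basis2 j) F d <-> is_derive (coord2 j z) (1 : R) (fun t => F (upd2 j z t)) d.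
Proof.
have E (h : R) : F (h *: basis2 j + z) = F (upd2 j z (h *: (1 : R) + coord2 j z)).
  congr F; case: j z => -[x y] /=; congr pair; rewrite /= ?scaler0 ?add0r//.
have Q : (fun h : R => h^-1 *: ((F \o shift z) (h *: basis2 j) - F z)) =
    (fun h : R => h^-1 *: (((fun t => F (upd2 j z t)) \o shift (coord2 j z)) (h *: (1 : R)) -
      F (upd2 j z (coord2 j z)))).
  by apply/funext => h /=; rewrite E upd2_coord2.
split=> -[dF <-]; apply: DeriveDef.
- by move: dF; rewrite /derivable Q.
- by rewrite /derive Q.
- by rewrite /derivable Q.
- by rewrite /derive Q.
Qed.

(** Iterated derivatives in the single direction [j] control the Fourier transform in the [j]-th
    coordinate. The weight [r] is 1 for multipliers and [poisson2 1 0] for decaying functions;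
    [CweightM] lets the first kind act on the second. *)
Fixpoint Cweight {R : realType} (r : R * R -> R) (k : nat) (j : bool) (F : R * R -> R) : Prop :=
  [/\ continuous F, exists M, forall z, `|F z| <= M * r z &
    if k is k'.+1 then (forall z, derivable F z (basis2 j)) /\
      Cweight r k' j (fun z => 'D_(basis2 j) F z) else True].

Section CweightTheory.
Context {R : realType}.
Implicit Types (r : R * R -> R) (F G : R * R -> R).

Lemma Cweight_continuous r k j F : Cweight r k j F -> continuous F.
Proof. by case: k => [|k] []. Qed.

Lemma Cweight_bound r k j F : Cweight r k j F -> exists M, forall z, `|F z| <= M * r z.
Proof. by case: k => [|k] []. Qed.

Lemma CweightS r k j F : Cweight r k.+1 j F -> Cweight r k j F.
Proof.
elim: k F => [|k IH] F [cF bF [dF CF]]; first by split.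
by split => //; split => //; exact: IH.
Qed.

Lemma Cweight_le r k k' j F : (k <= k')%N -> Cweight r k' j F -> Cweight r k j F.
Proof. by move=> /subnK <-; elim: (k' - k)%N => // m IH /CweightS. Qed.

Lemma Cweight_derive r k j F F' : (forall z, is_derive z (basis2 j) F (F' z)) ->
  continuous F -> (exists M, forall z, `|F z| <= M * r z) ->
  Cweight r k j F' -> Cweight r k.+1 j F.
Proof.
move=> dF cF bF CF'; split => //; split; first by move=> z; exact: ex_derive.
by rewrite (_ : (fun z => _) = F') //; apply/funext => z; exact: derive_val.
Qed.

Lemma CweightD r k j F G : (forall z, 0 <= r z) ->
  Cweight r k j F -> Cweight r k j G -> Cweight r k j (fun z => F z + G z).
Proof.
move=> r0; elim: k F G => [|k IH] F G.
  move=> [cF [M bF] _] [cG [N bG] _]; split => //.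
    by move=> z; apply: cvgD; [exact: cF|exact: cG].
  exists (M + N) => z; rewrite (le_trans (ler_normD _ _))// mulrDl lerD//.
move=> [cF [M bF] [dF CF]] [cG [N bG] [dG CG]].
apply: Cweight_derive (IH _ _ CF CG).
- by move=> z; apply: is_deriveD; exact: derivableP.
- by move=> z; apply: cvgD; [exact: cF|exact: cG].
- by exists (M + N) => z; rewrite (le_trans (ler_normD _ _))// mulrDl lerD//.
Qed.

Lemma CweightM r k j F G :
  Cweight (fun=> 1) k j F -> Cweight r k j G -> (forall z, 0 <= r z) ->
  Cweight r k j (fun z => F z * G z).
Proof.
move=> + + r0; elim: k F G => [|k IH] F G.
  move=> [cF [M bF] _] [cG [N bG] _]; split => //.
    by move=> z; apply: cvgM; [exact: cF|exact: cG].
  exists (M * N) => z; rewrite normrM -mulrA ler_pM//.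
  by rewrite (le_trans (bF z))// mulr1.
move=> CF0 CG0; move: (CF0) (CG0) => [cF [M bF] [dF CF]] [cG [N bG] [dG CG]].
apply: Cweight_derive (CweightD r0 (IH _ _ (CweightS CF0) CG) (IH _ _ CF (CweightS CG0))).
- move=> z; apply: (is_derive_eq (is_deriveM (derivableP (dF z)) (derivableP (dG z)))).
  by rewrite /GRing.scale/= [X in _ + X = _]mulrC.
- by move=> z; apply: cvgM; [exact: cF|exact: cG].
- exists (M * N) => z; rewrite normrM -mulrA ler_pM//.
  by rewrite (le_trans (bF z))// mulr1.
Qed.

Lemma Cweight_cst k j (c : R) : Cweight (fun=> 1) k j (fun=> c).
Proof.
elim: k c => [|k IH] c.
  split => //; first by move=> z; exact: cvg_cst.
  by exists `|c| => z; rewrite mulr1.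
apply: Cweight_derive (IH 0).
  by move=> z; exact: cvg_cst.
by exists `|c| => z; rewrite mulr1.
Qed.

Lemma is_derive_dot2 j (xi z : R * R) :
  is_derive z (basis2 j) (fun z => dot2 z xi) (coord2 j xi).
Proof.
apply/is_derive_slice.
have h := is_derive_scale (coord2 j xi) (coord2 j z).
rewrite -[X in is_derive _ _ _ X]addr0.
rewrite (_ : (fun t => _) = (fun t => coord2 j xi * t) +
  cst (coord2 (~~ j) xi * coord2 (~~ j) z)).
  by apply: is_deriveD.
apply/funext => t; rewrite !fctE /dot2; case: j h => _ /=; ring.
Qed.

Lemma is_derive_comp_dot2 j (k k' : R -> R) (xi z : R * R) :
  (forall t, is_derive t (1 : R) k (k' t)) ->
  is_derive z (basis2 j) (fun z => k (dot2 z xi)) (coord2 j xi * k' (dot2 z xi)).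
Proof.
move=> dk; apply/is_derive_slice; have /is_derive_slice h := is_derive_dot2 j xi z.
rewrite mulrC.
have := @is_derive1_comp R k (fun t => dot2 (upd2 j z t) xi) (coord2 j z) _ _ (dk _) h.
by rewrite upd2_coord2.
Qed.

Lemma Cweight_cos_sin k j (xi : R * R) :
  Cweight (fun=> 1) k j (fun z => cos (dot2 z xi)) /\
  Cweight (fun=> 1) k j (fun z => sin (dot2 z xi)).
Proof.
have bc : exists M, forall z : R * R, `|cos (dot2 z xi)| <= M * 1.
  by exists 1 => z; rewrite mulr1 norm_cos_le1.
have bs : exists M, forall z : R * R, `|sin (dot2 z xi)| <= M * 1.
  by exists 1 => z; rewrite mulr1 norm_sin_le1.
elim: k => [|k [IHc IHs]].
  split; split => //; [exact: continuous_cos_dot2|exact: continuous_sin_dot2].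
have h (c : R) : Cweight (fun=> 1) k j (fun=> c) by exact: Cweight_cst.
split.
  apply: Cweight_derive (CweightM (h (- coord2 j xi)) IHs _) => //.
    move=> z; apply: (is_derive_eq (is_derive_comp_dot2 j xi z (@is_derive_cos R))).
    by rewrite mulrN mulNr.
  exact: continuous_cos_dot2.
apply: Cweight_derive (CweightM (h (coord2 j xi)) IHc _) => //.
  by move=> z; apply: (is_derive_eq (is_derive_comp_dot2 j xi z (@is_derive_sin R))).
exact: continuous_sin_dot2.
Qed.
End CweightTheory.

(** * Smoothness of a decaying function and decay of its Fourier transform *)

Section Decay.
Context {R : realType}.
Implicit Types (F G : R * R -> R).
Local Notation P := (poisson2 1 0 : R * R -> R).
Local Notation decay := (Cweight P).

Lemma poisson2_ge0 (z : R * R) : 0 <= P z.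
Proof. exact/ltW/poisson2_gt0. Qed.

Lemma poisson_le1 (t : R) : poisson 1 0 t <= 1.
Proof.
rewrite /poisson subr0 expr1n div1r invf_le1 ?lerDl ?sqr_ge0//.
by rewrite ltr_wpDr ?sqr_ge0.
Qed.

Lemma int2_decay k j F : decay k j F -> int2 F.
Proof.
move=> CF; have [M FM] := Cweight_bound CF.
apply: (@int2_le _ _ (fun z => M * P z)) => //.
  by apply: continuous_measurable2; exact: Cweight_continuous CF.
exact/int2Z/int2_poisson2.
Qed.

Lemma poisson2_upd2 j (z : R * R) t :
  P (upd2 j z t) = poisson 1 0 t * poisson 1 0 (coord2 (~~ j) z).
Proof. by rewrite /poisson2; case: j => //=; rewrite mulrC. Qed.

Lemma integral_slice_derive j F z : decay 1 j F ->
  (\int[@lebesgue_measure R]_t ('D_(basis2 j) F (upd2 j z t))%:E = 0)%E.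
Proof.
move=> [cF [M FM] [dF [cdF [N dFN] _]]].
have M0 : 0 <= M by move: (le_trans (normr_ge0 _) (FM 0)); rewrite pmulr_lge0// poisson2_gt0.
have N0 : 0 <= N by move: (le_trans (normr_ge0 _) (dFN 0)); rewrite pmulr_lge0// poisson2_gt0.
have cu : continuous (upd2 j z).
  case: j {dF cdF dFN} => t; first exact: (cvg_pair (cvg_cst z.1) cvg_id).
  exact: (cvg_pair cvg_id (cvg_cst z.2)).
have bnd (L : R) t : 0 <= L -> L * P (upd2 j z t) <= L * poisson 1 0 t.
  move=> L0; rewrite ler_wpM2l// poisson2_upd2 ler_piMr ?poisson_le1//.
  exact/ltW/poisson_gt0.
apply: (@integral_derive_decay R (fun t => F (upd2 j z t)) _ (M + N)).
- move=> t; have /is_derive_slice := derivableP (dF (upd2 j z t)).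
  rewrite coord2_upd2 (_ : (fun u => F (upd2 j (upd2 j z t) u)) = (fun u => F (upd2 j z u)))//.
  by apply/funext => u; case: j {dF cdF dFN cu bnd}.
- by move=> t; exact: (continuous_comp (cu t) (cdF _)).
- move=> t; rewrite (le_trans (FM _))// (le_trans (bnd _ _ _))// ler_wpM2r ?lerDl//.
  exact/ltW/poisson_gt0.
- move=> t; rewrite (le_trans (dFN _))// (le_trans (bnd _ _ _))// ler_wpM2r ?lerDr//.
  exact/ltW/poisson_gt0.
Qed.

Lemma I2_derive j F : decay 1 j F -> \int[leb2]_z ('D_(basis2 j) F z) = 0.
Proof.
move=> CF; have CdF : decay 0 j (fun z => 'D_(basis2 j) F z) by have [_ _ []] := CF.
have idF := int2_decay CdF.
rewrite /Rintegral /leb2; case: j CF {CdF} idF => CF idF.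
  rewrite -(integral12_prod_meas1 idF) integral0_eq// => x _.
  exact: (integral_slice_derive (x, 0) CF).
rewrite -(integral21_prod_meas1 idF) integral0_eq// => y _.
exact: (integral_slice_derive (0, y) CF).
Qed.

(** Integration by parts: the product of [F] with the trigonometric factor is again of class
    [decay 1 j], so its derivative integrates to 0 by [I2_derive]. *)
Lemma fcos_fsin_derive j F xi : decay 1 j F ->
  fcos (fun z => 'D_(basis2 j) F z) xi = coord2 j xi * fsin F xi /\
  fsin (fun z => 'D_(basis2 j) F z) xi = - (coord2 j xi * fcos F xi).
Proof.
move=> CF; have [cF bF [dF _]] := CF.
have CdF : decay 0 j (fun z => 'D_(basis2 j) F z) by have [_ _ []] := CF.
have iF := int2_decay CF; have idF := int2_decay CdF.
have [Cc Cs] := Cweight_cos_sin 1 j xi.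
have key k l (c : R) : Cweight (fun=> 1) 1 j (fun z => k (dot2 z xi)) ->
    (forall t, is_derive t (1 : R) k (c * l t)) ->
    int2 (fun z => F z * l (dot2 z xi)) ->
    int2 (fun z => 'D_(basis2 j) F z * k (dot2 z xi)) ->
    \int[leb2]_z ('D_(basis2 j) F z * k (dot2 z xi)) =
    - (c * (coord2 j xi * \int[leb2]_z (F z * l (dot2 z xi)))).
  move=> Ck dk il ik.
  have := I2_derive (CweightM Ck CF poisson2_ge0).
  rewrite (_ : (fun z => _) = (fun z => 'D_(basis2 j) F z * k (dot2 z xi) +
      (c * coord2 j xi) * (F z * l (dot2 z xi)))); last first.
    apply/funext => z; have dk2 := is_derive_comp_dot2 j xi z dk.
    have := is_deriveM dk2 (derivableP (dF z)) => /@derive_val ->.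
    by rewrite /GRing.scale/=; ring.
  rewrite I2D//; last exact: int2Z.
  by rewrite I2Z// => /eqP; rewrite addr_eq0 => /eqP ->; rewrite mulrA.
have dc t : is_derive t (1 : R) cos (-1 * sin t) by rewrite mulN1r; exact: is_derive_cos.
have ds t : is_derive t (1 : R) sin (1 * cos t) by rewrite mul1r; exact: is_derive_sin.
have hc := key cos sin (-1) Cc dc (int2_mul_sin _ iF) (int2_mul_cos _ idF).
have hs := key sin cos 1 Cs ds (int2_mul_cos _ iF) (int2_mul_sin _ idF).
by split; [rewrite /fcos hc mulN1r opprK|rewrite /fsin hs mul1r].
Qed.

Lemma fcos_fsin_decay k j F : decay k j F -> exists K, forall xi,
  `|coord2 j xi| ^+ k * `|fcos F xi| <= K /\ `|coord2 j xi| ^+ k * `|fsin F xi| <= K.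
Proof.
elim: k F => [|k IH] F CF.
  have iF := int2_decay CF.
  exists (\int[leb2]_z `|F z|) => xi; rewrite expr0 !mul1r; split.
    apply: I2_norm_le; [exact: int2_mul_cos|exact: int2_abs|] => z.
    by rewrite normrM ler_piMr// norm_cos_le1.
  apply: I2_norm_le; [exact: int2_mul_sin|exact: int2_abs|] => z.
  by rewrite normrM ler_piMr// norm_sin_le1.
have C1 : decay 1 j F by apply: Cweight_le CF.
have CdF : decay k j (fun z => 'D_(basis2 j) F z) by have [_ _ []] := CF.
have [K hK] := IH _ CdF; exists K => xi; have [h1 h2] := hK xi.
have [e1 e2] := fcos_fsin_derive xi C1.
by move: h1 h2; rewrite e1 e2 normrN !normrM !exprSr -!mulrA.
Qed.

Lemma measurable_fcos F : int2 F -> measurable_fun setT (fcos F : plane R -> R).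
Proof.
move=> iF; apply: (measurable_I2_slice (b := fun x y => cos (dot2 x y))) => //.
  exact: measurableT_comp (continuous_measurable_fun (@continuous_cos R)) measurable_dot2.
by move=> x y; exact: norm_cos_le1.
Qed.

Lemma measurable_fsin F : int2 F -> measurable_fun setT (fsin F : plane R -> R).
Proof.
move=> iF; apply: (measurable_I2_slice (b := fun x y => sin (dot2 x y))) => //.
  exact: measurableT_comp (continuous_measurable_fun (@continuous_sin R)) measurable_dot2.
by move=> x y; exact: norm_sin_le1.
Qed.

(** This is the source of the order 4 in [rapid]: with u and v the squares of the coordinates, (1 +
    u)(1 + v) <= 2 + u^2 + v^2, so fourth powers of each coordinate separately dominate the product
    weight. *)
Lemma le_poisson2 (a K : R) (xi : R * R) : 0 <= a -> a <= K ->
  `|xi.1| ^+ 4 * a <= K -> `|xi.2| ^+ 4 * a <= K -> a <= 4 * K * P xi.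
Proof.
move=> a0 aK a1 a2; rewrite /poisson2 /poisson !subr0 expr1n !div1r -invfM.
have s1 : 0 < 1 + xi.1 ^+ 2 by rewrite ltr_wpDr ?sqr_ge0.
have s2 : 0 < 1 + xi.2 ^+ 2 by rewrite ltr_wpDr ?sqr_ge0.
rewrite ler_pdivlMr ?mulr_gt0//.
move: a1 a2; rewrite (_ : `|xi.1| ^+ 4 = (xi.1 ^+ 2) ^+ 2); last first.
  by rewrite -(real_normK (num_real xi.1)) -exprM.
rewrite (_ : `|xi.2| ^+ 4 = (xi.2 ^+ 2) ^+ 2); last first.
  by rewrite -(real_normK (num_real xi.2)) -exprM.
move: (xi.1 ^+ 2) (xi.2 ^+ 2) {s1 s2} => u v h1 h2.
have h : a * (2 + u ^+ 2 + v ^+ 2 - (1 + u) * (1 + v)) >= 0.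
  apply: mulr_ge0 => //.
  have := sqr_ge0 (u - v); have := sqr_ge0 (u - 1); have := sqr_ge0 (v - 1); nra.
nra.
Qed.

Definition rapid F := decay 4 false F /\ decay 4 true F.

Lemma rapid_fourier_nice F : rapid F -> fourier_nice F /\
  exists K, forall xi, `|fcos F xi| <= K * P xi /\ `|fsin F xi| <= K * P xi.
Proof.
move=> [C1 C2]; have iF := int2_decay C1.
have [K0 h0] := fcos_fsin_decay (Cweight_le (leq0n 4) C1).
have [K1 h1] := fcos_fsin_decay C1; have [K2 h2] := fcos_fsin_decay C2.
have K0_ge0 : 0 <= K0 by have [+ _] := h0 0; apply: le_trans; rewrite expr0 mul1r.
have K1_ge0 : 0 <= K1 by have [+ _] := h1 0; apply: le_trans; rewrite mulr_ge0.
have K2_ge0 : 0 <= K2 by have [+ _] := h2 0; apply: le_trans; rewrite mulr_ge0.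
pose K := K0 + K1 + K2.
have KK : forall xi, `|fcos F xi| <= 4 * K * P xi /\ `|fsin F xi| <= 4 * K * P xi.
  move=> xi; have [a1 b1] := h0 xi; have [a2 b2] := h1 xi; have [a3 b3] := h2 xi.
  move: a1 b1; rewrite expr0 !mul1r => a1 b1.
  have [k0 k1 k2] : [/\ K0 <= K, K1 <= K & K2 <= K] by rewrite /K; split; lra.
  by split; apply: le_poisson2 => //; [exact: le_trans k0|exact: le_trans k1|exact: le_trans k2
    |exact: le_trans k0|exact: le_trans k1|exact: le_trans k2].
split; last by exists (4 * K).
have iP : int2 (fun z => 4 * K * P z) by exact/int2Z/int2_poisson2.
split => //.
- exact: Cweight_continuous C1.
- have [M hM] := Cweight_bound C1; exists `|M| => z.
  rewrite (le_trans (hM z))// (le_trans (ler_norm _))// normrM ler_piMr//.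
  rewrite ger0_norm ?poisson2_ge0// /poisson2 mulr_ile1 ?poisson_le1//; exact/ltW/poisson_gt0.
- by apply: (int2_le _ _ iP); [exact: measurable_fcos|move=> xi; have [] := KK xi].
- by apply: (int2_le _ _ iP); [exact: measurable_fsin|move=> xi; have [] := KK xi].
Qed.
End Decay.

(** * Differentiable functions on the line supported in [1/2, 2] *)

Fixpoint annular {R : realType} (k : nat) (v : R -> R) : Prop :=
  [/\ continuous v, forall t, v t != 0 -> 2^-1 <= t <= 2 &
    if k is k'.+1 then (forall t, derivable v t 1) /\ annular k' v^`()%classic else True].

Section AnnularTheory.
Context {R : realType}.
Implicit Types v : R -> R.

Lemma annular_continuous k v : annular k v -> continuous v.
Proof. by case: k => [|k] []. Qed.

Lemma annular_support k v t : annular k v -> v t != 0 -> 2^-1 <= t <= 2.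
Proof. by case: k => [|k] [_ h _]; exact: h. Qed.

Lemma annular_lt k v t : annular k v -> t < 2^-1 -> v t = 0.
Proof.
move=> av tl; apply/eqP; apply: contraTT tl => /(annular_support av)/andP[h _].
by rewrite -leNgt.
Qed.

Lemma annular_gt k v t : annular k v -> 2 < t -> v t = 0.
Proof.
move=> av tl; apply/eqP; apply: contraTT tl => /(annular_support av)/andP[_ h].
by rewrite -leNgt.
Qed.

Lemma annularS k v : annular k.+1 v -> annular k v.
Proof.
elim: k v => [|k IH] v [cv sv [dv av]]; first by split.
by split => //; split => //; exact: IH.
Qed.

Lemma annular_bound k v : annular k v -> exists M, forall t, `|v t| <= M.
Proof.
move=> av; have cv := annular_continuous av.
have le12 : (2^-1 : R) <= 2 by lra.
have [|c _ hc] := @EVT_max R (fun t => `|v t|) _ _ le12.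
  by apply: continuous_subspaceT => t; apply: continuous_comp; [exact: cv|exact: norm_continuous].
exists `|v c| => t; have [->|/(annular_support av) h] := eqVneq (v t) 0.
  by rewrite normr0.
by apply: hc; rewrite in_itv.
Qed.

Lemma annular_near0 k v (t : R) : annular k v -> t < 2^-1 -> \forall s \near t, 0 = v s.
Proof.
move=> av tl; near=> s; apply/esym/(annular_lt av).
by near: s; exact: lt_nbhsl.
Unshelve. all: by end_near. Qed.

Lemma annular_derive1 k v v' : (forall t, is_derive t (1 : R) v (v' t)) ->
  continuous v -> (forall t, v t != 0 -> 2^-1 <= t <= 2) -> annular k v' -> annular k.+1 v.
Proof.
move=> dv cv sv av; split => //; split; first by move=> t; exact: ex_derive.
by rewrite (_ : v^`()%classic = v')//; apply/funext => t; rewrite derive1E; exact: derive_val.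
Qed.

Lemma is_derive_annular k v t : annular k.+1 v -> is_derive t (1 : R) v (v^`()%classic t).
Proof. by move=> [_ _ [dv _]]; rewrite derive1E; exact: derivableP. Qed.

Lemma annularB k v u : annular k v -> annular k u -> annular k (fun t => v t - u t).
Proof.
elim: k v u => [|k IH] v u av au.
all: have cvu : continuous (fun t => v t - u t) by move=> t; apply: cvgB;
  [exact: (annular_continuous av)|exact: (annular_continuous au)].
all: have svu : forall t, v t - u t != 0 -> 2^-1 <= t <= 2 by move=> t;
  have [v0|/(annular_support av)//] := eqVneq (v t) 0; rewrite v0 sub0r oppr_eq0;
  exact: annular_support au.
  by split.
have [_ _ [_ av']] := av; have [_ _ [_ au']] := au.
apply: annular_derive1 (IH _ _ av' au') => // t.
exact: is_deriveB (is_derive_annular t av) (is_derive_annular t au).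
Qed.

(** Differentiating a radial function produces such quotients. Below 1/2 the numerator vanishes
    identically, so the singularity at 0 is never met. *)
Lemma annular_div k v : annular k v -> annular k (fun t => v t / t).
Proof.
elim: k v => [|k IH] v av.
all: have sv : forall t, v t / t != 0 -> 2^-1 <= t <= 2 by move=> t;
  have [->|/(annular_support av)//] := eqVneq (v t) 0; rewrite mul0r eqxx.
all: have zv (t : R) : t < 2^-1 -> \forall s \near t, 0 = v s / s by move=> tl;
  apply: filterS (annular_near0 av tl) => s <-; rewrite mul0r.
all: have cv : continuous (fun t => v t / t) by move=> t; have [t0|t0] := ltP t 2^-1;
  [have z := zv _ t0; apply: (cvg_trans (near_eq_cvg z)); rewrite -(nbhs_singleton z); exact: cvg_cst
  |apply: cvgM; [exact: (annular_continuous av)|apply: cvgV; [rewrite gt_eqF//; lra|exact: cvg_id]]].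
  by split.
have [_ _ [_ av']] := av.
apply: annular_derive1 (annularB (IH _ av') (IH _ (IH _ (annularS av)))) => // t.
have [t0|t0] := ltP t 2^-1.
  have -> : v^`()%classic t / t - v t / t / t = 0.
    by rewrite (annular_lt av' t0) (annular_lt av t0) !mul0r subr0.
  apply: near_eq_is_derive (zv _ t0) _; exact: is_derive_cst.
have tn : t != 0 by rewrite gt_eqF//; lra.
have h := is_deriveM (is_derive_annular t av) (@is_deriveV R id t 1 1 tn (is_derive_id _ _)).
apply: (is_derive_eq h); rewrite /GRing.scale/=; field; exact: tn.
Qed.

Lemma annular_window (w : R -> R) k : besov_window w -> annular k w.
Proof.
move=> [dw _ sw _].
have cn n : continuous w^`(n)%classic.
  by move=> t; apply/differentiable_continuous/derivable1_diffP.
have sn n t : w^`(n)%classic t != 0 -> 2^-1 <= t <= 2.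
  elim: n t => [|n IH] t; first exact: sw.
  apply: contraR => h; rewrite derive1nS derive1E; apply/eqP.
  (* The complement of the closed interval is open, so a function vanishing there vanishes near each
     of its points, and so does its derivative. *)
  have o : open [set s : R | ~~ (2^-1 <= s <= 2)].
    rewrite [X in open X](_ : _ = ~` `[2^-1, 2]%classic).
      by apply/closed_openC/interval_closed.
    by apply/seteqP; split => s /=; rewrite in_itv/= => /negP.
  have /near_eq_derive -> : \forall s \near t, w^`(n)%classic s = cst 0 s.
    apply: filterS (open_nbhs_nbhs (conj o h)) => s; apply: contraNeq; exact: IH.
  exact: derive_cst.
suff H : forall n, annular k w^`(n)%classic by exact: (H 0%N).
elim: k => [|k IH] n; first by split; [exact: cn|exact: sn|].
split; [exact: cn|exact: sn|split; first by move=> t; exact: dw].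
by rewrite -derive1nS.
Qed.
End AnnularTheory.

(** * Radial multipliers and Schwartz functions *)

Section Radial.
Context {R : realType}.
Implicit Types (v : R -> R) (z : R * R).

Lemma norm2_ge0 z : 0 <= norm2 z.
Proof. exact: sqrtr_ge0. Qed.

Lemma dot2_ge0 z : 0 <= dot2 z z.
Proof. by rewrite /dot2 -!expr2 addr_ge0 ?sqr_ge0. Qed.

Lemma norm2_sqr z : norm2 z ^+ 2 = z.1 ^+ 2 + z.2 ^+ 2.
Proof. by rewrite /norm2 sqr_sqrtr ?dot2_ge0// /dot2 !expr2. Qed.

Lemma coord2_le_norm2 j z : `|coord2 j z| <= norm2 z.
Proof.
rewrite -ler_sqr ?nnegrE ?norm2_ge0// real_normK ?num_real// norm2_sqr.
by case: j => /=; rewrite ?lerDl ?lerDr sqr_ge0.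
Qed.

Lemma continuous_norm2 : continuous (norm2 : R * R -> R).
Proof.
move=> z; apply: continuous_comp; last exact: sqrt_continuous.
by apply: cvgD; apply: cvgM; (exact: cvg_fst || exact: cvg_snd).
Qed.

Lemma continuous_coord2 j : continuous (coord2 j : R * R -> R).
Proof. by case: j => z; [exact: cvg_snd|exact: cvg_fst]. Qed.

Lemma is_derive_norm2 j z : 0 < norm2 z ->
  is_derive z (basis2 j) norm2 (coord2 j z / norm2 z).
Proof.
move=> z0; apply/is_derive_slice.
have d0 : 0 < dot2 z z by move: z0; rewrite /norm2 sqrtr_gt0.
have E t : dot2 (upd2 j z t) (upd2 j z t) = t ^+ 2 + coord2 (~~ j) z ^+ 2.
  by case: j; rewrite /dot2 /= -!expr2 // addrC.
have h : is_derive (coord2 j z) (1 : R) (fun t => dot2 (upd2 j z t) (upd2 j z t))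
    (2 * coord2 j z).
  under eq_fun do rewrite E.
  rewrite (_ : (fun t => _) = id * id + cst (coord2 (~~ j) z ^+ 2)); last first.
    by apply/funext => t; rewrite expr2.
  have h := is_derive_id (coord2 j z) (1 : R).
  apply: (is_derive_eq (is_deriveD (is_deriveM h h) (is_derive_cst _ _ _))).
  by rewrite /GRing.scale/= addr0 mulr1 mulr2n mulrDl mul1r.
have s : is_derive (dot2 (upd2 j z (coord2 j z)) (upd2 j z (coord2 j z))) (1 : R) Num.sqrt
    (2 * norm2 z)^-1.
  by rewrite upd2_coord2; exact: is_derive1_sqrt.
have := @is_derive1_comp R Num.sqrt (fun t => dot2 (upd2 j z t) (upd2 j z t))
  (coord2 j z) _ _ s h.
rewrite (_ : _^-1 * _ = coord2 j z / norm2 z)//; field; exact: lt0r_neq0.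
Qed.

(** The power of the coordinate makes the family stable under ['D_(basis2 j)]: the derivative is i
    times the member with power i - 1, plus c^2 times the member with profile v'(t) / t and power i
    + 1. *)
Definition radial (c : R) v (j : bool) (i : nat) z : R := coord2 j z ^+ i * v (c * norm2 z).

Lemma continuous_radial (c : R) v j i : continuous v -> continuous (radial c v j i).
Proof.
move=> cv z; apply: cvgM.
  apply: (@continuous_comp _ _ _ (coord2 j) (fun t : R => t ^+ i)).
    exact: continuous_coord2.
  exact: exprn_continuous.
apply: (@continuous_comp _ _ _ (fun z => c * norm2 z) v); last exact: cv.
by apply: cvgM; [exact: cvg_cst|exact: continuous_norm2].
Qed.

Lemma radial_bound k (c : R) v j i : 0 < c -> annular k v ->
  exists M, forall z, `|radial c v j i z| <= M * 1.
Proof.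
move=> c0 av; have [M vM] := annular_bound av; exists ((2 / c) ^+ i * M) => z.
have M0 : 0 <= M by exact: le_trans (vM 0).
rewrite mulr1 normrM normrX; have [h|h] := ltP 2 (c * norm2 z).
  by rewrite (annular_gt av h) normr0 mulr0 mulr_ge0// exprn_ge0// divr_ge0// ltW.
apply: ler_pM => //.
apply: lerXn2r; rewrite ?nnegrE// ?divr_ge0 ?(ltW c0)//.
by rewrite (le_trans (coord2_le_norm2 j z))// ler_pdivlMr// mulrC.
Qed.

Lemma Cweight_radial k (c : R) v j i : 0 < c -> annular k v -> Cweight (fun=> 1) k j (radial c v j i).
Proof.
move=> c0; elim: k v i => [|k IH] v i av.
all: have cR := @continuous_radial c v j i (annular_continuous av).
all: have bR := radial_bound j i c0 av.
  by split.
have [_ _ [_ av']] := av.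
pose u t := v^`()%classic t / t.
have r1 : forall z : R * R, 0 <= (fun=> 1 : R) z by [].
have C1 : Cweight (fun=> 1) k j (fun z => i%:R * radial c v j i.-1 z).
  exact: (CweightM (Cweight_cst k j (i%:R : R)) (IH _ _ (annularS av))).
have C2 : Cweight (fun=> 1) k j (fun z => c ^+ 2 * radial c u j i.+1 z).
  exact: (CweightM (Cweight_cst k j (c ^+ 2)) (IH _ _ (annular_div av'))).
apply: Cweight_derive (CweightD r1 C1 C2) => // z.
(* [norm2] is not differentiable at the origin, but the function is locally zero there. *)
have [h|h] := ltP (c * norm2 z) 2^-1.
  have -> : i%:R * radial c v j i.-1 z + c ^+ 2 * radial c u j i.+1 z = 0.
    by rewrite /radial /u (annular_lt av' h) (annular_lt av h) mul0r !mulr0 addr0.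
  apply: (@near_eq_is_derive _ _ _ (cst 0)).
  have : \forall s \near z, c * norm2 s < 2^-1.
    have cc : {for z, continuous (fun s => c * norm2 s)}.
      by apply: cvgM; [exact: cvg_cst|exact: continuous_norm2].
    exact: (cvgr_lt _ cc).
  by apply: filterS => s hs; rewrite /radial (annular_lt av hs) mulr0.
have n0 : 0 < norm2 z by rewrite -(pmulr_rgt0 _ c0) (lt_le_trans _ h)// invr_gt0.
have dn := is_deriveZ c (is_derive_norm2 j n0).
have dv : is_derive z (basis2 j) (fun z => v (c * norm2 z))
    (v^`()%classic (c * norm2 z) * (c * (coord2 j z / norm2 z))).
  apply/is_derive_slice; have /is_derive_slice dn' := dn.
  have dv := is_derive_annular ((c \*: norm2) (upd2 j z (coord2 j z))) av.
  have := @is_derive1_comp R v (fun t => (c \*: norm2) (upd2 j z t)) (coord2 j z) _ _ dv dn'.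
  by rewrite upd2_coord2.
have dc : is_derive z (basis2 j) (coord2 j : R * R -> R) 1.
  apply/is_derive_slice; under eq_fun do rewrite coord2_upd2; exact: is_derive_id.
have dX : is_derive z (basis2 j) (fun z => coord2 j z ^+ i) (i%:R * coord2 j z ^+ i.-1).
  by have := is_deriveX i dc; rewrite exprfctE /GRing.scale/= mulr1.
apply: (is_derive_eq (is_deriveM dX dv)).
rewrite /radial /u /GRing.scale/= (exprS (coord2 j z) i).
have alg (A B V D N x I : R) : N != 0 -> c != 0 -> A * (D * (c * (x / N))) + V * (I * B) =
    I * (B * V) + c ^+ 2 * (x * A * (D / (c * N))).
  by move=> N0 c1; field; rewrite N0 c1.
by apply: alg; apply: lt0r_neq0.
Qed.

Lemma Cweight_window k j (w : R -> R) (c : R) : 0 < c -> besov_window w ->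
  Cweight (fun=> 1) k j (fun z => w (c * norm2 z)).
Proof.
move=> c0 hw; have := @Cweight_radial k c w j 0%N c0 (annular_window k hw).
rewrite (_ : radial c w j 0 = fun z => w (c * norm2 z))//.
by apply/funext => z; rewrite /radial expr0 mul1r.
Qed.

Lemma schwartz_decay (phi : R * R -> R[i]) k j s : schwartz phi ->
  Cweight (poisson2 1 0) k j (fun z => complex.Re (pderivs s phi z)) /\
  Cweight (poisson2 1 0) k j (fun z => complex.Im (pderivs s phi z)).
Proof.
move=> [sm dec]; elim: k s => [|k IH] s.
(* The exponent 4 suffices because (1 + x^2)(1 + y^2) <= (1 + |z|^2)^2 <= (1 + |z|)^4. *)
all: have [[cR cI] dRI] := sm s; have [M hM] := dec s 4%N.
all: have hP z : cabs (pderivs s phi z) <= M * poisson2 1 0 z by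
  rewrite /poisson2 /poisson !subr0 expr1n !div1r -invfM ler_pdivlMr ?mulr_gt0//
    ?ltr_wpDr ?sqr_ge0//; apply: le_trans (hM z); rewrite mulrC ler_wpM2r ?cabs_ge0//;
  have n0 := norm2_ge0 z; have ns := norm2_sqr z;
  apply: (@le_trans _ _ ((1 + norm2 z ^+ 2) ^+ 2));
  [rewrite ns; have := sqr_ge0 z.1; have := sqr_ge0 z.2; nra
  |rewrite (exprM _ 2 2) lerXn2r ?nnegrE ?addr_ge0 ?sqr_ge0//; nra].
  split; split => //; exists M => z; rewrite (le_trans _ (hP z))//.
    exact: Re_le_cabs.
  exact: Im_le_cabs.
have [IR II] := IH (j :: s).
split; split => //.
- by exists M => z; rewrite (le_trans _ (hP z))// Re_le_cabs.
- by split=> // z; have [] := dRI j z.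
- by exists M => z; rewrite (le_trans _ (hP z))// Im_le_cabs.
- by split=> // z; have [] := dRI j z.
Qed.

Lemma rapid_window_schwartz (w : R -> R) (c : R) (phi : R * R -> R[i]) : 0 < c ->
  besov_window w -> schwartz phi ->
  rapid (fun z => complex.Re ((w (c * norm2 z))%:C * phi z)) /\
  rapid (fun z => complex.Im ((w (c * norm2 z))%:C * phi z)).
Proof.
move=> c0 hw sphi.
have p0 (z : R * R) : 0 <= poisson2 1 0 z := poisson2_ge0 z.
have C j := CweightM (Cweight_window 4 j c0 hw) (schwartz_decay 4 j [::] sphi).1 p0.
have D j := CweightM (Cweight_window 4 j c0 hw) (schwartz_decay 4 j [::] sphi).2 p0.
under eq_fun do rewrite ReM /= mul0r subr0.
under [X in _ /\ rapid X]eq_fun do rewrite ImM /= mul0r addr0.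
by split; split; (exact: C || exact: D).
Qed.

Lemma rapid_schwartz (phi : R * R -> R[i]) : schwartz phi ->
  rapid (fun z => complex.Re (phi z)) /\ rapid (fun z => complex.Im (phi z)).
Proof.
move=> sphi; split; split; have := schwartz_decay 4 _ [::] sphi => h;
  (exact: (h _).1 || exact: (h _).2).
Qed.
End Radial.

(** * Series of exponentials *)

Section CIntegral.
Context {R : realType}.
Implicit Types (f g h : R * R -> R[i]).

Lemma cintegrableD f g : cintegrable f -> cintegrable g -> cintegrable (fun z => f z + g z).
Proof.
move=> [f1 f2] [g1 g2]; split.
  by under eq_fun do rewrite ReD; exact: int2D.
by under eq_fun do rewrite ImD; exact: int2D.
Qed.

Lemma cintegrable0 : cintegrable (fun _ : R * R => 0).
Proof. by split; exact: int2_0. Qed.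

Lemma cintegrable_sum (I : Type) (s : seq I) (f : I -> R * R -> R[i]) :
  (forall i, cintegrable (f i)) -> cintegrable (fun z => \sum_(i <- s) f i z).
Proof.
move=> hf; elim: s => [|i s IH].
  by under eq_fun do rewrite big_nil; exact: cintegrable0.
by under eq_fun do rewrite big_cons; exact: cintegrableD.
Qed.

Lemma cintegrableM f g (M : R) : cintegrable f -> cmeasurable g ->
  (forall z, cabs (g z) <= M) -> cintegrable (fun z => g z * f z).
Proof.
move=> [f1 f2] [g1 g2] gM.
have gR z : `|complex.Re (g z)| <= M by rewrite (le_trans (Re_le_cabs _)).
have gI z : `|complex.Im (g z)| <= M by rewrite (le_trans (Im_le_cabs _)).
split.
  under eq_fun do rewrite ReM [X in X - _]mulrC [X in _ - X]mulrC.
  by apply: int2B; apply: int2_mul_bounded; eauto.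
under eq_fun do rewrite ImM [X in X + _]mulrC [X in _ + X]mulrC.
by apply: int2D; apply: int2_mul_bounded; eauto.
Qed.

Lemma cmeasurable_cst (a : R[i]) : cmeasurable (fun _ : R * R => a).
Proof. by split; exact: measurable_cst. Qed.

Lemma cintegrableZ (a : R[i]) f : cintegrable f -> cintegrable (fun z => a * f z).
Proof. by move=> hf; apply: (cintegrableM hf (cmeasurable_cst a) (M := cabs a)). Qed.

Lemma cintegralD f g : cintegrable f -> cintegrable g ->
  cintegral (fun z => f z + g z) = cintegral f + cintegral g.
Proof.
move=> [f1 f2] [g1 g2]; apply: complexP; rewrite ?ReD ?ImD /=.
  by rewrite -I2D//; apply: eq_Rintegral => z _; rewrite ReD.
by rewrite -I2D//; apply: eq_Rintegral => z _; rewrite ImD.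
Qed.

Lemma cintegralZ (a : R[i]) f : cintegrable f ->
  cintegral (fun z => a * f z) = a * cintegral f.
Proof.
move=> [f1 f2]; apply: complexP; rewrite ?ReM ?ImM /=.
  by rewrite -!I2Z// -I2B; [|exact: int2Z..]; apply: eq_Rintegral => z _; rewrite ReM.
by rewrite -!I2Z// -I2D; [|exact: int2Z..]; apply: eq_Rintegral => z _; rewrite ImM.
Qed.

Lemma cintegral0 : cintegral (fun _ : R * R => 0) = 0.
Proof. by apply: complexP => /=; exact: I2_0. Qed.

Lemma cintegral_sum (I : Type) (s : seq I) (f : I -> R * R -> R[i]) :
  (forall i, cintegrable (f i)) ->
  cintegral (fun z => \sum_(i <- s) f i z) = \sum_(i <- s) cintegral (f i).
Proof.
move=> hf; elim: s => [|i s IH].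
  by rewrite big_nil -[RHS]cintegral0; congr cintegral; apply/funext => z; rewrite big_nil.
rewrite big_cons -IH -cintegralD//; last exact: cintegrable_sum.
by congr cintegral; apply/funext => z; rewrite big_cons.
Qed.

(** The factor 2 is the price of estimating the real and imaginary parts separately. *)
Lemma cabs_cintegral f (B : R * R -> R) : cintegrable f -> int2 B ->
  (forall z, cabs (f z) <= B z) -> cabs (cintegral f) <= 2 * \int[leb2]_z B z.
Proof.
move=> [f1 f2] iB fB; rewrite (le_trans (cabs_le_ReIm _))// mulrDl mul1r lerD//=.
  by apply: I2_norm_le => // z; rewrite (le_trans (Re_le_cabs _)).
by apply: I2_norm_le => // z; rewrite (le_trans (Im_le_cabs _)).
Qed.

Lemma int2_cabs f : cintegrable f -> int2 (fun z => cabs (f z)).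
Proof.
move=> [f1 f2]; apply: (@int2_le _ _ (fun z => `|complex.Re (f z)| + `|complex.Im (f z)|)).
- rewrite (_ : (fun z => cabs (f z)) = (fun z => Num.sqrt (complex.Re (f z) ^+ 2 + complex.Im (f z) ^+ 2))); last first.
    by apply/funext => z; case: (f z).
  apply: (measurableT_comp (continuous_measurable_fun (@sqrt_continuous R))).
  by apply: measurable_funD; apply: measurable_funX; exact: int2_measurable.
- by move=> z; rewrite ger0_norm ?cabs_ge0// cabs_le_ReIm.
- by apply: int2D; exact: int2_abs.
Qed.

Lemma ccontinuous_cmeasurable f : ccontinuous f -> cmeasurable f.
Proof. by move=> [c1 c2]; split; exact: continuous_measurable2. Qed.

Lemma ccontinuousD f g : ccontinuous f -> ccontinuous g -> ccontinuous (fun z => f z + g z).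
Proof.
move=> [f1 f2] [g1 g2]; split.
  by under eq_fun do rewrite ReD; move=> z; apply: cvgD; [exact: f1|exact: g1].
by under eq_fun do rewrite ImD; move=> z; apply: cvgD; [exact: f2|exact: g2].
Qed.

Lemma ccontinuousM f g : ccontinuous f -> ccontinuous g -> ccontinuous (fun z => f z * g z).
Proof.
move=> [f1 f2] [g1 g2]; split.
  under eq_fun do rewrite ReM; move=> z.
  by apply: cvgB; apply: cvgM; (exact: f1 || exact: g1 || exact: f2 || exact: g2).
under eq_fun do rewrite ImM; move=> z.
by apply: cvgD; apply: cvgM; (exact: f1 || exact: g1 || exact: f2 || exact: g2).
Qed.

Lemma ccontinuous_cst (a : R[i]) : ccontinuous (fun _ : R * R => a).
Proof. by split => z; exact: cvg_cst. Qed.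

Lemma ccontinuous_sum (I : Type) (s : seq I) (f : I -> R * R -> R[i]) :
  (forall i, ccontinuous (f i)) -> ccontinuous (fun z => \sum_(i <- s) f i z).
Proof.
move=> hf; elim: s => [|i s IH].
  by under eq_fun do rewrite big_nil; exact: ccontinuous_cst.
by under eq_fun do rewrite big_cons; exact: ccontinuousD.
Qed.

Lemma ccontinuous_cis xi : ccontinuous (fun z : R * R => cis (dot2 xi z)).
Proof.
split=> z /=.
  by apply: continuous_comp; [exact: continuous_dot2|exact: continuous_cos].
by apply: continuous_comp; [exact: continuous_dot2|exact: continuous_sin].
Qed.
End CIntegral.

(** * Dominated series of complex numbers and functions *)

Section ComplexSeries.
Context {R : realType}.
Implicit Types (u : nat -> R[i]) (al : nat -> R).

(** The value is meaningful only for convergent series; the lemmas below secure this by a summable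
    majorant [al], and [tail al] measures the remainder. *)
Definition csum u : R[i] :=
  limn (series (fun n => complex.Re (u n))) +i* limn (series (fun n => complex.Im (u n))).

Definition tail al (n : nat) : R := limn (series al) - series al n.

Lemma cvg_tail al : cvgn (series al) -> tail al @ \oo --> 0.
Proof.
by move=> ca; rewrite -(subrr (limn (series al))); apply: cvgB => //; exact: cvg_cst.
Qed.

Lemma dominated_series_cvg (v al : nat -> R) : (forall n, `|v n| <= al n) ->
  cvgn (series al) -> cvgn (series v).
Proof.
move=> va ca; apply: normed_cvg; apply: series_le_cvg ca => // n; first exact: normr_ge0.
exact: le_trans (normr_ge0 _) (va n).
Qed.

Lemma series_tail_le (v al : nat -> R) n : (forall n, `|v n| <= al n) ->
  cvgn (series al) -> `|limn (series v) - series v n| <= tail al n.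
Proof.
move=> va ca; have cv := dominated_series_cvg va ca.
have h : (fun N => `|series v N - series v n|) @ \oo --> `|limn (series v) - series v n|.
  by apply: cvg_norm; apply: cvgB => //; exact: cvg_cst.
have h2 : (fun N => series al N - series al n) @ \oo --> tail al n.
  by apply: cvgB => //; exact: cvg_cst.
rewrite -(cvg_lim _ h)// -(cvg_lim _ h2)//; apply: ler_lim.
- exact: cvgP h.
- exact: cvgP h2.
near=> N; have nN : (n <= N)%N by near: N; exact: nbhs_infty_ge.
rewrite !sub_series_geq// (le_trans (ler_norm_sum _ _ _))// ler_sum//.
Unshelve. all: by end_near. Qed.

Lemma csum_tail u al n : (forall n, cabs (u n) <= al n) -> cvgn (series al) ->
  cabs (csum u - \sum_(0 <= m < n) u m) <= 2 * tail al n.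
Proof.
move=> ua ca; rewrite (le_trans (cabs_le_ReIm _))// mulrDl mul1r.
rewrite ReD ReN ImD ImN Re_sum Im_sum; apply: lerD.
  by apply: series_tail_le => // m; rewrite (le_trans (Re_le_cabs _)).
by apply: series_tail_le => // m; rewrite (le_trans (Im_le_cabs _)).
Qed.

Lemma csum_le u al : (forall n, cabs (u n) <= al n) -> cvgn (series al) ->
  cabs (csum u) <= 2 * limn (series al).
Proof.
move=> ua ca; have := csum_tail 0 ua ca.
by rewrite /tail /series /= !big_geq// !subr0.
Qed.

Lemma csum_unique u l (e : nat -> R) : e @ \oo --> 0 ->
  (forall n, cabs (l - \sum_(0 <= m < n) u m) <= e n) -> csum u = l.
Proof.
move=> e0 ule.
have h (p : R[i] -> R) : (forall x, `|p x| <= cabs x) -> (forall x y, p (x - y) = p x - p y) ->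
    (forall n, p (\sum_(0 <= m < n) u m) = series (fun n => p (u n)) n) ->
    limn (series (fun n => p (u n))) = p l.
  move=> pc pB ps; apply: cvg_lim => //; apply/subr_cvg0; apply: norm_cvg0.
  apply: (@squeeze_cvgr _ _ _ _ (fun=> 0) _ _ _ _ _ e0); last exact: cvg_cst.
  apply: nearW => n; rewrite normr_ge0/= distrC -ps -pB.
  by rewrite (le_trans (pc _)).
apply: complexP => /=; apply: h.
- exact: Re_le_cabs.
- by move=> x y; rewrite ReD ReN.
- by move=> n; rewrite Re_sum.
- exact: Im_le_cabs.
- by move=> x y; rewrite ImD ImN.
- by move=> n; rewrite Im_sum.
Qed.

Lemma eq_csum u v : u =1 v -> csum u = csum v.
Proof. by move=> /funext ->. Qed.

Lemma ccontinuous_csum (u : nat -> R * R -> R[i]) al :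
  (forall n, ccontinuous (u n)) -> (forall n z, cabs (u n z) <= al n) ->
  cvgn (series al) -> ccontinuous (fun z => csum (u ^~ z)).
Proof.
move=> cu ua ca.
have h (v : nat -> R * R -> R) : (forall n, continuous (v n)) ->
    (forall n z, `|v n z| <= al n) -> continuous (fun z => limn (series (v ^~ z))).
  move=> cv va z; apply/cvgrPdist_le => /= e e0.
  have e3 : 0 < e / 3 by rewrite divr_gt0.
  have /cvgrPdist_le/(_ _ e3) [N _ hN] := cvg_tail ca.
  have {hN} := hN N (leqnn N); rewrite /= sub0r normrN => hN.
  have tl s : `|limn (series (v ^~ s)) - series (v ^~ s) N| <= e / 3.
    apply: le_trans (series_tail_le _ (fun n => va n s) ca) _.
    exact: le_trans (ler_norm _) hN.
  have cs : continuous (fun s => series (v ^~ s) N).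
    move=> s; rewrite /series /=; elim: N {hN tl} => [|N IH].
      by under eq_fun do rewrite big_geq//; exact: cvg_cst.
    under eq_fun do rewrite big_nat_recr//=.
    by apply: cvgD => //; exact: cv.
  have /cvgrPdist_le/(_ _ e3) := cs z; apply: filterS => s /= hs.
  have := tl z; have := tl s.
  move: hs; rewrite !ler_norml => /andP[? ?] /andP[? ?] /andP[? ?].
  apply/andP; split; lra.
split=> /=; apply: h.
- by move=> n; have [] := cu n.
- by move=> n z; rewrite (le_trans (Re_le_cabs _)).
- by move=> n; have [] := cu n.
- by move=> n z; rewrite (le_trans (Im_le_cabs _)).
Qed.

(** Convergence is uniform, so the remainder of the series against [psi] is at most 2 (from
    [cabs_cintegral]) times 2 (from [csum_tail]) times [tail al n] times the integral of
    [cabs psi]. *)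
Lemma cintegral_csum (u : nat -> R * R -> R[i]) al (psi : R * R -> R[i]) :
  (forall n, ccontinuous (u n)) -> (forall n z, cabs (u n z) <= al n) ->
  cvgn (series al) -> cintegrable psi ->
  cintegral (fun z => csum (u ^~ z) * psi z) =
  csum (fun n => cintegral (fun z => u n z * psi z)).
Proof.
move=> cu ua ca ipsi; apply/esym.
have al0 n : 0 <= al n by exact: le_trans (cabs_ge0 _) (ua n 0).
have cS := ccontinuous_csum cu ua ca.
have ifu n : cintegrable (fun z => u n z * psi z).
  exact: (cintegrableM ipsi (ccontinuous_cmeasurable (cu n)) (ua n)).
have ifS : cintegrable (fun z => csum (u ^~ z) * psi z).
  apply: (cintegrableM ipsi (ccontinuous_cmeasurable cS) (M := 2 * limn (series al))) => z.
  exact: csum_le.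
pose B := \int[leb2]_z cabs (psi z).
apply: (@csum_unique _ _ (fun n => 4 * B * tail al n)).
  by rewrite -[X in _ --> X](mulr0 (4 * B)); apply: cvgM; [exact: cvg_cst|exact: cvg_tail].
move=> n; rewrite -cintegral_sum// -[X in _ - X]mul1r -mulNr -cintegralZ; last exact: cintegrable_sum.
rewrite -cintegralD//; last by apply: cintegrableZ; exact: cintegrable_sum.
have -> : 4 * B * tail al n = 2 * \int[leb2]_z (2 * tail al n * cabs (psi z)).
  by rewrite I2Z; [rewrite -/B; ring|exact: int2_cabs].
apply: cabs_cintegral.
- by apply: cintegrableD => //; apply: cintegrableZ; exact: cintegrable_sum.
- exact/int2Z/int2_cabs.
- move=> z; rewrite -mulr_suml mulNr mul1r -mulrBl cabsM ler_wpM2r ?cabs_ge0//.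
  exact: csum_tail.
Qed.
End ComplexSeries.

(** * Trigonometric polynomials and absolutely convergent series of them *)

Section TrigSeries.
Context {R : realType}.
Implicit Types (mu : R * R -> R) (l : seq (R[i] * (R * R))) (s : nat -> seq (R[i] * (R * R))).

(** The list of coefficients and frequencies stands for a finite combination of point masses on the
    Fourier side. The function [mu] is a Fourier multiplier, which acts by its values at the
    frequencies; [fun=> 1] gives the polynomial itself. *)
Definition trigpoly mu l (z : R * R) : R[i] :=
  \sum_(t <- l) ((mu t.2)%:C * t.1) * cis (dot2 t.2 z).

Definition wiener_norm l : R := \sum_(t <- l) cabs t.1.

Definition trigseries mu s (z : R * R) : R[i] := csum (fun m => trigpoly mu (s m) z).

Lemma trigpoly_le mu l z (C : R) : (forall t, t \in l -> `|mu t.2| <= C) ->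
  cabs (trigpoly mu l z) <= C * wiener_norm l.
Proof.
move=> muC; rewrite (le_trans (cabs_sum _ _ _))// /wiener_norm mulr_sumr.
rewrite big_seq [leRHS]big_seq; apply: ler_sum => t tl.
by rewrite !cabsM cabs_cis mulr1 cabs_real ler_wpM2r ?cabs_ge0// muC.
Qed.

Lemma wiener_norm_ge0 l : 0 <= wiener_norm l.
Proof. by apply: sumr_ge0 => t _; exact: cabs_ge0. Qed.

Lemma ccontinuous_trigpoly mu l : ccontinuous (trigpoly mu l).
Proof.
apply: (ccontinuous_sum l (f := fun t z => ((mu t.2)%:C * t.1) * cis (dot2 t.2 z))) => t.
by apply: ccontinuousM; [exact: ccontinuous_cst|exact: ccontinuous_cis].
Qed.

Lemma cvg_series_scale (a : nat -> R) (C : R) : cvgn (series a) ->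
  cvgn (series (fun n => C * a n)) /\ limn (series (fun n => C * a n)) = C * limn (series a).
Proof.
move=> ca; have h : series (fun n => C * a n) @ \oo --> C * limn (series a).
  rewrite (_ : series (fun n => C * a n) = (fun n => C * series a n)); last first.
    by apply/funext => n; rewrite /series /= mulr_sumr.
  by apply: cvgM => //; exact: cvg_cst.
by split; [exact: cvgP h|exact: cvg_lim].
Qed.

Lemma trigseries_le mu s z (C : R) : (forall m t, t \in s m -> `|mu t.2| <= C) ->
  cvgn (series (fun m => wiener_norm (s m))) ->
  cabs (trigseries mu s z) <= 2 * (C * limn (series (fun m => wiener_norm (s m)))).
Proof.
move=> muC cs; have [c1 <-] := cvg_series_scale C cs.
by apply: csum_le => // m; apply: trigpoly_le; exact: muC.
Qed.

Lemma ccontinuous_trigseries mu s (C : R) : (forall m t, t \in s m -> `|mu t.2| <= C) ->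
  cvgn (series (fun m => wiener_norm (s m))) -> ccontinuous (trigseries mu s).
Proof.
move=> muC cs; have [c1 _] := cvg_series_scale C cs.
apply: (ccontinuous_csum (u := fun m => trigpoly mu (s m)) _ _ c1).
  by move=> m; exact: ccontinuous_trigpoly.
by move=> m z; apply: trigpoly_le; exact: muC.
Qed.

Lemma cintegral_trigpoly mu l (psi : R * R -> R[i]) : cintegrable psi ->
  cintegral (fun z => trigpoly mu l z * psi z) =
  \sum_(t <- l) ((mu t.2)%:C * t.1) * cintegral (fun z => cis (dot2 t.2 z) * psi z).
Proof.
move=> ipsi.
have ic t : cintegrable (fun z => cis (dot2 t z) * psi z).
  apply: (cintegrableM ipsi (ccontinuous_cmeasurable (ccontinuous_cis t)) (M := 1)) => z.
  by rewrite cabs_cis.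
under [RHS]eq_bigr do rewrite -cintegralZ//.
rewrite -cintegral_sum => [|t]; last exact: cintegrableZ.
congr cintegral; apply/funext => z; rewrite mulr_suml.
by apply: eq_bigr => t _; rewrite mulrA.
Qed.

Lemma cintegral_trigseries mu s (C : R) (psi : R * R -> R[i]) :
  (forall m t, t \in s m -> `|mu t.2| <= C) ->
  cvgn (series (fun m => wiener_norm (s m))) -> cintegrable psi ->
  cintegral (fun z => trigseries mu s z * psi z) =
  csum (fun m => \sum_(t <- s m) ((mu t.2)%:C * t.1) *
                   cintegral (fun z => cis (dot2 t.2 z) * psi z)).
Proof.
move=> muC cs ipsi; have [c1 _] := cvg_series_scale C cs.
rewrite (cintegral_csum (u := fun m => trigpoly mu (s m)) (al := fun m => C * wiener_norm (s m)))//.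
- by apply: eq_csum => m; exact: cintegral_trigpoly.
- by move=> m; exact: ccontinuous_trigpoly.
- by move=> m z; apply: trigpoly_le; exact: muC.
Qed.

(** In terms of distributions, the transform of an exponential is the point mass at its frequency.
    This is how Fourier inversion enters the computation of the Littlewood-Paley blocks. *)
Lemma cintegral_cis_fourier (phi : R * R -> R[i]) xi :
  rapid (fun z => complex.Re (phi z)) -> rapid (fun z => complex.Im (phi z)) ->
  cintegral (fun z => cis (dot2 xi z) * fourier phi z) = phi xi.
Proof.
move=> /rapid_fourier_nice[nR _] /rapid_fourier_nice[nI _].
rewrite -[RHS](fourier_inversion xi nR nI) /inv_fourier.
by congr cintegral; apply/funext => z; rewrite mulrC.
Qed.

Lemma rapid_cintegrable_fourier (phi : R * R -> R[i]) :
  rapid (fun z => complex.Re (phi z)) -> rapid (fun z => complex.Im (phi z)) ->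
  cintegrable (fourier phi).
Proof.
by move=> /rapid_fourier_nice[nR _] /rapid_fourier_nice[nI _]; exact: cintegrable_fourier.
Qed.

Lemma rapid_cintegrable (phi : R * R -> R[i]) :
  rapid (fun z => complex.Re (phi z)) -> rapid (fun z => complex.Im (phi z)) ->
  cintegrable phi.
Proof. by move=> [h1 _] [h2 _]; split; [exact: int2_decay h1|exact: int2_decay h2]. Qed.
End TrigSeries.

(** * The dyadic partition of unity generated by the window *)

Section Window.
Context {R : realType}.
Variables (w : R -> R).
Hypothesis hw : besov_window w.

Lemma window_half t : 2^-1 <= t <= 1 -> w (2 * t) + w t = 1.
Proof.
move=> /andP[t1 t2]; have [_ _ _ ww] := hw.
rewrite ww; last by apply/andP; split; lra.
by rewrite (_ : 2 * t / 2 = t) ?subrK//; field.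
Qed.

Lemma window_ge0 t : 0 <= w t. Proof. by have [_ + _ _] := hw; exact. Qed.

Lemma window_le1 t : w t <= 1.
Proof.
have [->//|/(annular_support (annular_window 0 hw))/andP[t1 t2]] := eqVneq (w t) 0.
have [t3|t3] := leP t 1.
  have := window_half; move/(_ t); rewrite t1 t3 => /(_ isT) <-.
  by rewrite lerDr window_ge0.
have := window_half; move/(_ (t / 2)).
rewrite (_ : 2 * (t / 2) = t); last by field.
have -> : 2^-1 <= t / 2 <= 1 by apply/andP; split; lra.
by move=> /(_ isT) <-; rewrite lerDl window_ge0.
Qed.

(** Only the endpoints are new. Continuity gives w(1/2) = 0; then [window_half] at 1/2 gives w(1) =
    1, and at 1 it gives w(2) = 0. *)
Lemma window_out t : ~~ (2^-1 < t < 2) -> w t = 0.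
Proof.
have aw := annular_window 0 hw; have cw := annular_continuous aw.
have w1 : w 2^-1 = 0.
  have h : w x @[x --> 2^-1^'-] --> w 2^-1 by apply: cvg_at_left_filter; exact: cw.
  have h0 : w x @[x --> 2^-1^'-] --> 0.
    apply: cvg_near_cst; near=> x; apply: (annular_lt aw).
    by near: x; exact: nbhs_left_lt.
  exact: cvg_unique h h0.
rewrite negb_and -!leNgt => /orP[|].
  by rewrite le_eqVlt => /orP[/eqP ->//|]; exact: annular_lt aw.
rewrite le_eqVlt => /orP[/eqP <-|]; last exact: annular_gt aw.
have := window_half; move/(_ 1).
rewrite mulr1 lexx andbT (_ : 2^-1 <= 1); last by lra.
have := window_half; move/(_ 2^-1).
rewrite lexx (_ : 2^-1 <= 1); last by lra.
by rewrite divff// w1 => /(_ isT) h1 /(_ isT) h2; lra.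
Unshelve. all: by end_near. Qed.

(** At most two consecutive dilates are nonzero at a point, and they add up to 1. The induction on
    [N] replaces [t] by [t / 2] as long as [t >= 2]. *)
Lemma window_sum N t : 1 <= t ->
  0 <= \sum_(0 <= n < N) w (t / 2 ^+ n) <= 1 /\
  (t * 2 < 2 ^+ N -> \sum_(0 <= n < N) w (t / 2 ^+ n) = 1).
Proof.
have small M u : 2^-1 <= u -> u <= 1 -> \sum_(0 <= n < M.+1) w (u / 2 ^+ n) = w u.
  move=> u1 u2; rewrite big_nat_recl// expr0 divr1 big1 ?addr0// => n _.
  apply: window_out; rewrite negb_and -leNgt; apply/orP; left.
  rewrite exprS invfM mulrA ler_pdivrMr ?exprn_gt0//.
  have : (1 : R) <= 2 ^+ n by rewrite exprn_ege1//; lra.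
  lra.
elim: N t => [|N IH] t t1.
  by rewrite big_geq// expr0 lexx ler01; split=> // h; lra.
rewrite big_nat_recl// expr0 divr1.
under eq_bigr do rewrite exprS invfM mulrA.
have [t2|t2] := leP 2 t.
  rewrite (window_out (t := t)); last by rewrite negb_and -!leNgt t2 orbT.
  rewrite add0r; have [|h1 h2] := IH (t / 2); first by lra.
  by split=> // h; apply: h2; rewrite exprS in h; lra.
case: N {IH} => [|N].
  rewrite big_geq// addr0 window_ge0 window_le1; split=> // h.
  by rewrite expr1 in h; lra.
rewrite small; [|lra..].
have := window_half; move/(_ (t / 2)); rewrite (_ : 2 * (t / 2) = t); last by field.
have -> : 2^-1 <= t / 2 <= 1 by apply/andP; split; lra.
by move=> /(_ isT) ->; rewrite ler01 lexx.
Qed.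
End Window.

(** * Besov norms of series of exponentials *)

Lemma Linfty_norm_le {R : realType} (g : R * R -> R[i]) (M : R) :
  0 <= M -> (forall z, cabs (g z) <= M) -> (Linfty_norm g <= M%:E)%E.
Proof.
(* The norm at [+oo] is an essential supremum, with the value 0 by convention on a null space. *)
move=> M0 gM; rewrite /Linfty_norm unlock; case: ifP => _; last by rewrite lee_fin.
apply/ess_supP; apply: nearW => z /=.
by rewrite lee_fin ger0_norm ?cabs_ge0.
Qed.

Lemma nneseries_EFin {R : realType} (a : nat -> R) :
  cvgn (series a) -> (\sum_(n <oo) (a n)%:E = (limn (series a))%:E)%E.
Proof.
move=> ca; apply: cvg_lim => //.
rewrite (_ : (fun n => _) = EFin \o series a); last first.
  by apply/funext => n; rewrite /series /= sumEFin.
by apply: cvg_EFin => //; exact: nearW.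
Qed.

Lemma esum_swap {R : realType} (T1 T2 : choiceType) (a : T1 -> T2 -> \bar R) :
  (forall i j, 0 <= a i j)%E ->
  (\esum_(i in [set: T1]) \esum_(j in [set: T2]) a i j =
   \esum_(j in [set: T2]) \esum_(i in [set: T1]) a i j)%E.
Proof.
move=> a0; rewrite !esum_esum//.
rewrite (reindex_esum ([set: T2] `*`` (fun=> [set: T1])) _ (fun x => (x.2, x.1)))//.
by split=> //= [[i j] [i' j'] _ _ [-> ->]|[i j] _]//; exists (j, i).
Qed.

Lemma esum_near_point {R : realType} (q : int) (c : R) : 0 <= c ->
  (\esum_(n in [set: int]) (if (`|n - q| <= 1)%R then c else 0)%:E <= (3 * c)%:E)%E.
Proof.
move=> c0; pose d (i : int) (n : int) : \bar R := (if n == i then c else 0)%:E.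
have d0 i n : (0 <= d i n)%E by rewrite /d lee_fin; case: ifP.
have ed i : (\esum_(n in [set: int]) d i n = c%:E)%E.
  rewrite -[RHS](@esum_set1 R _ i (fun=> c%:E)) ?lee_fin// [RHS]esum_mkcond.
  apply: eq_esum => n _; rewrite /d; case: eqVneq => [->|ni].
    by rewrite mem_set.
  by rewrite memNset// => /eqP; rewrite (negPf ni).
apply: (@le_trans _ _ (\esum_(n in [set: int]) (d (q - 1)%R n + d q n + d (q + 1)%R n))%E).
  apply: le_esum => n _; rewrite /d -!EFinD lee_fin.
  case: ifP => [h|_]; last by rewrite !addr_ge0//; case: ifP.
  have : [|| n == q - 1, n == q | n == q + 1].
    by move: h; rewrite ler_norml; lia.
  move=> /or3P[] ->; rewrite ?lerDr ?lerDl; by do ?[case: ifP => _]; rewrite ?addr_ge0; lra.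
rewrite !esumD//; last by move=> n _; exact: adde_ge0.
by rewrite !ed -!EFinD lee_fin; lra.
Qed.

Lemma csumD {R : realType} (u v : nat -> R[i]) (al be : nat -> R) :
  (forall n, cabs (u n) <= al n) -> (forall n, cabs (v n) <= be n) ->
  cvgn (series al) -> cvgn (series be) ->
  csum (fun n => u n + v n) = csum u + csum v.
Proof.
move=> ua vb ca cb; apply: (@csum_unique _ _ _ (fun n => 2 * tail al n + 2 * tail be n)).
  rewrite -[X in _ --> X](_ : 2 * 0 + 2 * 0 = 0); last by rewrite !mulr0 addr0.
  by apply: cvgD; apply: cvgM; (exact: cvg_cst || exact: cvg_tail).
move=> n; rewrite big_split/= opprD addrACA.
by apply: le_trans (cabsD _ _) _; apply: lerD; exact: csum_tail.
Qed.

Lemma trigseriesD {R : realType} (mu1 mu2 : R * R -> R) (s : nat -> seq (R[i] * (R * R)))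
    (C1 C2 : R) z :
  (forall m t, t \in s m -> `|mu1 t.2| <= C1) ->
  (forall m t, t \in s m -> `|mu2 t.2| <= C2) ->
  cvgn (series (fun m => wiener_norm (s m))) ->
  trigseries (fun xi => mu1 xi + mu2 xi) s z = trigseries mu1 s z + trigseries mu2 s z.
Proof.
move=> h1 h2 cs; have [c1 _] := cvg_series_scale C1 cs.
have [c2 _] := cvg_series_scale C2 cs.
rewrite /trigseries -(csumD _ _ c1 c2).
- apply: eq_csum => m; rewrite -big_split/=; apply: eq_bigr => t _.
  by rewrite -!mulrDl -rmorphD.
- by move=> m; apply: trigpoly_le; exact: h1.
- by move=> m; apply: trigpoly_le; exact: h2.
Qed.

Lemma trigseries_0 {R : realType} (mu : R * R -> R) (s : nat -> seq (R[i] * (R * R))) z :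
  (forall m t, t \in s m -> mu t.2 = 0) -> trigseries mu s z = 0.
Proof.
move=> h; apply: (@csum_unique _ _ _ (fun=> 0)); first exact: cvg_cst.
move=> n; rewrite big1 ?subrr ?cabs0// => m _.
by rewrite /trigpoly big_seq big1// => t ts; rewrite (h m)// !mul0r.
Qed.

Lemma schwartz_pderiv {R : realType} j (phi : R * R -> R[i]) :
  schwartz phi -> schwartz (pderiv j phi).
Proof.
have E s : pderivs s (pderiv j phi) = pderivs (rcons s j) phi by rewrite /pderivs foldr_rcons.
move=> [h1 h2]; split=> s; first by rewrite E; exact: h1.
by rewrite E; exact: h2.
Qed.

(** * A criterion for a trigonometric series to lie in the Besov class *)

Section BesovTrigSeries.
Context {R : realType}.
Variables (w : R -> R) (s : nat -> seq (R[i] * (R * R))) (c : nat -> R) (q : nat -> int).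
Hypothesis hw : besov_window w.
Hypothesis cvg_wiener : cvgn (series (fun m => wiener_norm (s m))).
Hypothesis freq_ge2 : forall m t, t \in s m -> 2 <= norm2 t.2.
Hypothesis cvg_c : cvgn (series c).
Hypothesis blocks : forall m n z,
  2 ^ n * cabs (trigpoly (fun xi => w (norm2 xi / 2 ^ n)) (s m) z) <=
  if `|n - q m| <= 1 then c m else 0.

Let f := trigseries (fun=> 1) s.
Let block (n : int) := trigseries (fun xi => w (norm2 xi / 2 ^ n)) s.

Let one_le1 m t : t \in s m -> `|(1 : R)| <= 1.
Proof. by rewrite normr1. Qed.

Let window_norm_le1 n m t : t \in s m -> `|w (norm2 t.2 / 2 ^ n)| <= 1.
Proof. by move=> _; rewrite ger0_norm ?window_ge0 ?window_le1. Qed.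

Let c_ge0 m : 0 <= c m.
Proof.
have := blocks m (q m) 0; rewrite subrr normr0 ler01; apply: le_trans.
by rewrite mulr_ge0 ?cabs_ge0// exprz_ge0.
Qed.

Let ccontinuous_f : ccontinuous f.
Proof. exact: (ccontinuous_trigseries one_le1). Qed.

Let f_bound : exists M, forall z, cabs (f z) <= M.
Proof.
eexists => z; exact: (trigseries_le z one_le1).
Qed.

Let cintegrable_f psi : cintegrable psi -> cintegrable (fun z => f z * psi z).
Proof.
move=> ipsi; have [M fM] := f_bound.
exact: (cintegrableM ipsi (ccontinuous_cmeasurable ccontinuous_f) fM).
Qed.

Let schwartz_cintegrable (phi : R * R -> R[i]) : schwartz phi -> cintegrable phi.
Proof. by move=> /rapid_schwartz[]; exact: rapid_cintegrable. Qed.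

Let window_scaled_schwartz n (phi : R * R -> R[i]) : schwartz phi ->
  rapid (fun z => complex.Re ((w (norm2 z / 2 ^ n))%:C * phi z)) /\
  rapid (fun z => complex.Im ((w (norm2 z / 2 ^ n))%:C * phi z)).
Proof.
move=> sphi; have p0 : 0 < ((2 : R) ^ n)^-1 by rewrite invr_gt0 exprz_gt0.
have [hR2 hI2] := rapid_window_schwartz p0 hw sphi.
split.
  move: hR2; congr rapid; apply/funext => z.
  by congr (complex.Re ((w _)%:C * _)); exact: mulrC.
move: hI2; congr rapid; apply/funext => z.
by congr (complex.Im ((w _)%:C * _)); exact: mulrC.
Qed.

(** By [cintegral_cis_fourier], both integrals become the sum of the coefficients times the values
    of [psi] at the frequencies. *)
Let block_identity n (phi psi : R * R -> R[i]) :
  (forall z, psi z = (w (norm2 z / 2 ^ n))%:C * phi z) ->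
  rapid (fun z => complex.Re (phi z)) -> rapid (fun z => complex.Im (phi z)) ->
  rapid (fun z => complex.Re (psi z)) -> rapid (fun z => complex.Im (psi z)) ->
  cintegral (fun z => block n z * fourier phi z) = cintegral (fun z => f z * fourier psi z).
Proof.
move=> psiE hR hI hR3 hI3.
rewrite (cintegral_trigseries (window_norm_le1 n) cvg_wiener (rapid_cintegrable_fourier hR hI)).
rewrite (cintegral_trigseries one_le1 cvg_wiener (rapid_cintegrable_fourier hR3 hI3)).
apply: eq_csum => m; apply: eq_bigr => t _.
by rewrite !cintegral_cis_fourier// psiE (_ : (1 : R)%:C = 1)// mul1r mulrAC mulrC mulrA.
Qed.

Let is_block_block n : is_block w (regular f) n (block n).
Proof.
split; first exact/ccontinuous_cmeasurable/(ccontinuous_trigseries (window_norm_le1 n)).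
move=> phi sphi; have [hR hI] := rapid_schwartz sphi.
have [hR3 hI3] := window_scaled_schwartz n sphi.
exact: (@block_identity n phi _ (fun=> erefl) hR hI hR3 hI3).
Qed.

Let block_norm n :
  ((2 ^ n)%:E * Linfty_norm (block n) <=
   \esum_(m in [set: nat]) (if (`|n - q m| <= 1)%R then 2 * c m else 0)%:E)%E.
Proof.
pose b m := if `|n - q m| <= 1 then c m else 0.
have p0 : 0 < (2 : R) ^ n by rewrite exprz_gt0.
have b0 m : 0 <= b m by rewrite /b; case: ifP.
have cb : cvgn (series b).
  apply: (series_le_cvg b0 c_ge0 _ cvg_c) => m.
  by rewrite /b; case: ifP.
have [cb2 l2] := cvg_series_scale 2 cb.
have [cb3 l3] := cvg_series_scale (2 ^ n)^-1 cb.
rewrite (eq_esum (b := fun m => (2 * b m)%:E)); last first.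
  by move=> m _; rewrite /b; case: ifP; rewrite ?mulr0.
rewrite -nneseries_esumT; last by move=> m; rewrite lee_fin mulr_ge0.
rewrite nneseries_EFin// l2.
apply: (@le_trans _ _ ((2 ^ n)%:E * (2 * ((2 ^ n)^-1 * limn (series b)))%:E)%E).
  rewrite lee_pmul2l ?lte_fin//.
  apply: Linfty_norm_le.
    rewrite !mulr_ge0 ?invr_ge0 ?(ltW p0)//.
    by apply: limr_ge => //; apply: nearW => m; exact: sumr_ge0.
  move=> z; rewrite -l3; apply: csum_le => // m.
  by rewrite ler_pdivlMl.
by rewrite -EFinM lee_fin mulrCA [leLHS]mulrA -mulrA mulVKf ?gt_eqF// mulrC.
Qed.

Let esum_blocks :
  (\esum_(n in [set: int]) ((2 ^ n)%:E * Linfty_norm (block n)) < +oo)%E.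
Proof.
apply: (@le_lt_trans _ _ (\esum_(n in [set: int]) \esum_(m in [set: nat])
    (if (`|n - q m| <= 1)%R then 2 * c m else 0)%:E)%E).
  by apply: le_esum => n _; exact: block_norm.
rewrite esum_swap; last by move=> n m; rewrite lee_fin; case: ifP; rewrite ?mulr_ge0.
(* Each [m] meets at most three values of [n], and [csum_le] costs a factor 2: hence 6. *)
apply: (@le_lt_trans _ _ (\esum_(m in [set: nat]) (6 * c m)%:E)%E).
  apply: le_esum => m _; apply: le_trans (esum_near_point _ _) _; first by rewrite mulr_ge0.
  by rewrite lee_fin; lra.
rewrite -nneseries_esumT; last by move=> m; rewrite lee_fin mulr_ge0.
by have [c6 _] := cvg_series_scale 6 cvg_c; rewrite nneseries_EFin// ltry.
Qed.

Let tempered_f : tempered (regular f).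
Proof.
split.
  move=> a phi psi sphi spsi; have iphi := schwartz_cintegrable sphi.
  have ipsi := schwartz_cintegrable spsi.
  rewrite /regular -cintegralZ; last exact: cintegrable_f.
  rewrite -cintegralD; [|exact/cintegrableZ/cintegrable_f|exact: cintegrable_f].
  by congr cintegral; apply/funext => z; ring.
have [M fM] := f_bound.
have M0 : 0 <= M by exact: le_trans (cabs_ge0 _) (fM 0).
(* The weight of order 4 dominates the inverse of [poisson2 1 0], whose mass is [pi ^+ 2]; the 2
   comes from [cabs_cintegral]. *)
exists 4%N, (2 * (M * pi ^+ 2)) => phi b sphi hb.
have hphi z : cabs (phi z) <= b * poisson2 1 0 z.
  have := hb [::] z isT; rewrite /= => hz; move: (hz).
  rewrite /poisson2 /poisson !subr0 expr1n !div1r -invfM => hz'.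
  rewrite ler_pdivlMr ?mulr_gt0 ?ltr_wpDr ?sqr_ge0//; apply: le_trans hz'.
  rewrite mulrC ler_wpM2r ?cabs_ge0//.
  have n0 := norm2_ge0 z; have ns := norm2_sqr z.
  apply: (@le_trans _ _ ((1 + norm2 z ^+ 2) ^+ 2)).
    by rewrite ns; have := sqr_ge0 z.1; have := sqr_ge0 z.2; nra.
  by rewrite (exprM _ 2 2) lerXn2r ?nnegrE ?addr_ge0 ?sqr_ge0//; nra.
have b0 : 0 <= b.
  move: (le_trans (cabs_ge0 _) (hphi 0)); rewrite pmulr_lge0//; exact: poisson2_gt0.
apply: le_trans (@cabs_cintegral _ _ (fun z => M * b * poisson2 1 0 z) _ _ _) _.
- exact/cintegrable_f/schwartz_cintegrable.
- exact/int2Z/int2_poisson2.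
- by move=> z; rewrite cabsM -mulrA ler_pM ?cabs_ge0.
by rewrite I2Z ?I2_poisson2 ?int2_poisson2// le_eqVlt; apply/orP; left; apply/eqP; ring.
Qed.
Let partial_window (N : nat) xi := \sum_(0 <= n < N) w (norm2 xi / 2 ^+ n).

Let partial_window_bounds N m t : t \in s m -> 0 <= partial_window N t.2 <= 1.
Proof.
move=> /freq_ge2 h; have h1 : 1 <= norm2 t.2 by apply: le_trans h; rewrite ler1n.
by have [] := window_sum hw N h1.
Qed.

Let partial_window_le1 N m t : t \in s m -> `|partial_window N t.2| <= 1.
Proof. by move=> /(partial_window_bounds N)/andP[h1 h2]; rewrite ger0_norm. Qed.

Let remainder_le1 N m t : t \in s m -> `|1 - partial_window N t.2| <= 1.
Proof.
move=> /(partial_window_bounds N)/andP[h1 h2]; rewrite ger0_norm ?subr_ge0//.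
by rewrite gerBl.
Qed.

Let sum_blocks N z :
  \sum_(0 <= n < N) block n%:Z z = trigseries (partial_window N) s z.
Proof.
elim: N => [|N IH].
  rewrite big_geq//; apply/esym/trigseries_0 => m t _.
  by rewrite /partial_window big_geq.
rewrite big_nat_recr//= IH.
rewrite (_ : partial_window N.+1 = fun xi => partial_window N xi + w (norm2 xi / 2 ^ N%:Z)).
  rewrite (@trigseriesD _ _ _ _ 1 1)//.
    exact: partial_window_le1.
  exact: window_norm_le1.
by apply/funext => xi; rewrite /partial_window big_nat_recr.
Qed.

Let f_split N z : f z = \sum_(0 <= n < N) block n%:Z z +
  trigseries (fun xi => 1 - partial_window N xi) s z.
Proof.
rewrite sum_blocks -(@trigseriesD _ _ _ _ 1 1)//.
- have E : (fun xi => partial_window N xi + (1 - partial_window N xi)) = fun=> 1.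
    by apply/funext => xi; rewrite addrC subrK.
  by rewrite E.
- exact: partial_window_le1.
- exact: remainder_le1.
Qed.

Let bounded_freqs M : exists N0 : nat, forall N, (N0 <= N)%N ->
  forall m t, (m < M)%N -> t \in s m -> partial_window N t.2 = 1.
Proof.
suff [N0 h] : exists N0 : nat, forall N, (N0 <= N)%N ->
    forall m t, (m < M)%N -> t \in s m -> norm2 t.2 * 2 < 2 ^+ N.
  exists N0 => N nN m t mM ts; have h1 : 1 <= norm2 t.2 by apply: le_trans (freq_ge2 ts); rewrite ler1n.
  by have [_] := window_sum hw N h1; apply; exact: h ts.
have grow (x : R) : exists N0 : nat, forall N, (N0 <= N)%N -> x < 2 ^+ N.
  exists (Num.truncn x).+1 => N xN; apply: (lt_le_trans (truncnS_gt x)).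
  apply: (@le_trans _ _ (N%:R)); first by rewrite ler_nat.
  by rewrite -natrX ler_nat ltnW// ltn_expl.
have grow_seq (l : seq (R[i] * (R * R))) : exists N0 : nat, forall N, (N0 <= N)%N ->
    forall t, t \in l -> norm2 t.2 * 2 < 2 ^+ N.
  elim: l => [|a l [N1 h1]]; first by exists 0%N.
  have [N2 h2] := grow (norm2 a.2 * 2); exists (maxn N1 N2) => N.
  rewrite geq_max => /andP[n1 n2] t; rewrite inE => /orP[/eqP ->|]; first exact: h2.
  exact: h1.
elim: M => [|M [N1 h1]]; first by exists 0%N.
have [N2 h2] := grow_seq (s M); exists (maxn N1 N2) => N.
rewrite geq_max => /andP[n1 n2] m t; rewrite ltnS leq_eqVlt => /orP[/eqP ->|].
  exact: h2.
exact: h1.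
Qed.

(** The first [M] terms have finitely many frequencies, at all of which the partial window is
    eventually 1, so they leave no remainder. In the other terms the multiplier
    [1 - partial_window N] lies in [0, 1], and the Wiener tail bounds them uniformly in [z]. *)
Let remainder_small M : exists N0 : nat, forall N, (N0 <= N)%N -> forall z,
  cabs (f z - \sum_(0 <= n < N) block n%:Z z) <= 2 * tail (fun m => wiener_norm (s m)) M.
Proof.
have [N0 h] := bounded_freqs M; exists N0 => N nN z.
rewrite (f_split N) addrAC subrr add0r.
have := @csum_tail _ (fun m => trigpoly (fun xi => 1 - partial_window N xi) (s m) z)
  (fun m => wiener_norm (s m)) M _ cvg_wiener.
rewrite [X in _ - X]big_nat big1 ?subr0 => [|m /= mM].
  apply => m; rewrite -[leRHS]mul1r; apply: trigpoly_le => t; exact: remainder_le1.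
rewrite /trigpoly big_seq big1// => t ts.
by rewrite (h N nN m t mM ts) subrr mul0r mul0r.
Qed.

Let low_block (k : nat) z : block (- (k.+1)%:Z) z = 0.
Proof.
apply: trigseries_0 => m t /freq_ge2 h; apply: (window_out hw).
rewrite negb_and -!leNgt; apply/orP; right.
rewrite -exprnN invrK exprS mulrCA.
apply: le_trans (_ : 2 * 1 <= _); first by rewrite mulr1.
rewrite ler_pM//.
by apply: mulr_ege1; [apply: le_trans h; rewrite ler1n|rewrite exprn_ege1// ler1n].
Qed.

Let series_blocks (psi : R * R -> R[i]) : cintegrable psi ->
  czseries_cvg (fun n => - cintegral (fun z => block n z * psi z))
    (- cintegral (fun z => f z * psi z)).
Proof.
move=> ipsi; pose B := \int[leb2]_z cabs (psi z).
have iblock n : cintegrable (fun z => block n z * psi z).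
  apply: (cintegrableM ipsi (ccontinuous_cmeasurable _)).
    exact: (ccontinuous_trigseries (window_norm_le1 n)).
  by move=> z; exact: (trigseries_le z (window_norm_le1 n)).
have est M : exists N0 : nat, forall N, (N0 <= N)%N ->
    cabs (- cintegral (fun z => f z * psi z) -
      \sum_(0 <= n < N) - cintegral (fun z => block n%:Z z * psi z)) <=
    4 * B * tail (fun m => wiener_norm (s m)) M.
  have [N0 h] := remainder_small M; exists N0 => N /h {}h.
  rewrite sumrN -opprD cabsN -cintegral_sum//.
  rewrite -[X in _ - X]mul1r -mulNr -cintegralZ; last exact: cintegrable_sum.
  rewrite -cintegralD; [|exact: cintegrable_f|]; last by apply: cintegrableZ; exact: cintegrable_sum.
  have -> : 4 * B * tail (fun m => wiener_norm (s m)) M =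
      2 * \int[leb2]_z (2 * tail (fun m => wiener_norm (s m)) M * cabs (psi z)).
    by rewrite I2Z; [rewrite -/B; ring|exact: int2_cabs].
  apply: cabs_cintegral.
  - apply: cintegrableD; first exact: cintegrable_f.
    by apply: cintegrableZ; exact: cintegrable_sum.
  - exact/int2Z/int2_cabs.
  - move=> z; rewrite -mulr_suml mulNr mul1r -mulrBl cabsM ler_wpM2r ?cabs_ge0//.
have lim0 : (fun M => 4 * B * tail (fun m => wiener_norm (s m)) M) @ \oo --> 0.
  by rewrite -[X in _ --> X](mulr0 (4 * B)); apply: cvgM; [exact: cvg_cst|exact: cvg_tail].
have h (p : R[i] -> R) : (forall x, `|p x| <= cabs x) -> (forall x y, p (x - y) = p x - p y) ->
    (forall n (u : nat -> R[i]), p (\sum_(0 <= m < n) u m) = \sum_(0 <= m < n) p (u m)) ->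
    p 0 = 0 ->
    zseries_cvg (fun n => p (- cintegral (fun z => block n z * psi z)))
      (p (- cintegral (fun z => f z * psi z))).
  (* The negative half of the two-sided series contributes 0: all frequencies have norm at least 2,
     so [low_block] applies. *)
  move=> pc pB ps p0; exists (p (- cintegral (fun z => f z * psi z))), 0; split; last by rewrite addr0.
    apply/cvgrPdist_le => /= e e0; have /cvgrPdist_le/(_ _ e0) [M _ hM] := lim0.
    have [N0 hN] := est M; exists N0 => //= N /hN {}hN.
    rewrite /series /= -ps -pB; apply: le_trans (pc _) _; apply: le_trans hN _.
    have := hM M (leqnn M); rewrite /= sub0r normrN; apply: le_trans; exact: ler_norm.
  apply: cvg_near_cst; apply: nearW => N; rewrite /series /= big1// => k _.
  rewrite (_ : (fun z => _) = fun=> 0) ?cintegral0 ?oppr0//.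
  by apply/funext => z; rewrite low_block mul0r.
split; apply: h.
- exact: Re_le_cabs.
- by move=> x y; rewrite ReD ReN.
- by move=> n u; rewrite Re_sum.
- by [].
- exact: Im_le_cabs.
- by move=> x y; rewrite ImD ImN.
- by move=> n u; rewrite Im_sum.
- by [].
Qed.

Theorem besov_trigseries : besov w (trigseries (fun=> 1) s).
Proof.
split; [exact: ccontinuous_f|by move=> phi /schwartz_cintegrable/cintegrable_f|].
split; first exact: tempered_f.
exists block; split; [exact: is_block_block|exact: esum_blocks|].
(* [dpderiv] moves the derivative to the test function, so convergence of the differentiated series
   is convergence of the blocks against the Schwartz function [pderiv j phi]. *)
move=> j phi sphi; apply: series_blocks; apply: schwartz_cintegrable.
exact: schwartz_pderiv.
Qed.
End BesovTrigSeries.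

(** * Block Hilbert spaces and functions of two operators *)

(* The choice [t = b / a] gives [(a + b) ^ 2]; this replaces the Cauchy-Schwarz inequality. *)
Lemma triangle_of_scaled {R : realType} (a b c : R) : 0 <= a -> 0 <= b ->
  (forall t, 0 < t -> c ^+ 2 <= (1 + t) * a ^+ 2 + (1 + t^-1) * b ^+ 2) -> c <= a + b.
Proof.
move=> a0 b0 h; apply/ler_addgt0Pr => e e0.
have e2 : 0 < e / 2 by rewrite divr_gt0.
have A0 : 0 < a + e / 2 by rewrite ltr_wpDl.
have B0 : 0 < b + e / 2 by rewrite ltr_wpDl.
have t0 : 0 < (b + e / 2) / (a + e / 2) by rewrite divr_gt0.
rewrite (le_trans (ler_norm c))// -(@ler_pXn2r _ 2) ?nnegrE ?addr_ge0 ?(ltW e0)//.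
rewrite real_normK ?num_real//; apply: le_trans (h _ t0) _.
have alg (A B : R) : 0 < A -> 0 < B ->
    (A + B) ^+ 2 = (1 + B / A) * A ^+ 2 + (1 + (B / A)^-1) * B ^+ 2.
  by move=> A1 B1; field; rewrite !gt_eqF.
have -> : (a + b + e) ^+ 2 = (1 + (b + e / 2) / (a + e / 2)) * (a + e / 2) ^+ 2 +
    (1 + ((b + e / 2) / (a + e / 2))^-1) * (b + e / 2) ^+ 2.
  by rewrite -alg//; congr (_ ^+ 2); lra.
by rewrite lerD// ler_pM2l ?ltr_pwDl ?invr_ge0 ?(ltW t0)// lerXn2r ?nnegrE ?(ltW A0) ?(ltW B0)//; lra.
Qed.

(** * Matrices with the Hilbert-Schmidt norm *)

Section MatrixNorm.
Context {R : realType}.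
Local Notation C := R[i].

Definition sqn n r (x : 'M[C]_(n, r)) : R := \sum_i \sum_j cabs (x i j) ^+ 2.

Definition dotm n r (x y : 'M[C]_(n, r)) : C := \sum_i \sum_j x i j * conjc (y i j).

Definition adjm n r (a : 'M[C]_(n, r)) : 'M[C]_(r, n) := (map_mx conjc a)^T.

Lemma cabs_conjc (a : C) : cabs (conjc a) = cabs a.
Proof. by case: a => a b; rewrite /cabs !normc_def /= sqrrN. Qed.

Lemma mul_conjc (a : C) : a * conjc a = (cabs a ^+ 2)%:C.
Proof.
rewrite cabs_sqr; case: a => a b; apply: complexP => /=; last by ring.
by ring.
Qed.

Lemma cabsD_sqr (a b : C) (t : R) : 0 < t ->
  cabs (a + b) ^+ 2 <= (1 + t) * cabs a ^+ 2 + (1 + t^-1) * cabs b ^+ 2.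
Proof.
move=> t0; apply: (@le_trans _ _ ((cabs a + cabs b) ^+ 2)).
  by rewrite lerXn2r ?nnegrE ?addr_ge0 ?cabs_ge0 ?cabsD.
rewrite -subr_ge0 (_ : _ - _ = (t * cabs a - cabs b) ^+ 2 / t).
  by rewrite divr_ge0 ?sqr_ge0// ltW.
by field; rewrite gt_eqF.
Qed.

Variables (n r : nat).
Implicit Types (x y z : 'M[C]_(n, r)).

Lemma sqn_ge0 x : 0 <= sqn x.
Proof. by apply: sumr_ge0 => i _; apply: sumr_ge0 => j _; exact: sqr_ge0. Qed.

Lemma sqn0 : sqn (0 : 'M[C]_(n, r)) = 0.
Proof.
by rewrite /sqn big1// => i _; rewrite big1// => j _; rewrite mxE cabs0 expr0n.
Qed.

Lemma sqn_entry x i j : cabs (x i j) ^+ 2 <= sqn x.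
Proof.
rewrite /sqn (bigD1 i)//= (bigD1 j)//= -addrA lerDl addr_ge0 ?sumr_ge0// => k _.
  exact: sqr_ge0.
by apply: sumr_ge0 => l _; exact: sqr_ge0.
Qed.

Lemma sqn_eq0 x : sqn x = 0 -> x = 0.
Proof.
move=> x0; apply/matrixP => i j; rewrite mxE; apply/eqP.
have := sqn_entry x i j; rewrite x0 => h.
have : cabs (x i j) ^+ 2 == 0 by rewrite eq_le h sqr_ge0.
rewrite sqrf_eq0 => /eqP h2; have := Re_le_cabs (x i j); have := Im_le_cabs (x i j).
rewrite h2 !normr_le0 => /eqP h3 /eqP h4.
by apply/eqP; apply: complexP; rewrite ?h3 ?h4.
Qed.

Lemma sqnZ (a : C) x : sqn (a *: x) = cabs a ^+ 2 * sqn x.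
Proof.
rewrite /sqn mulr_sumr; apply: eq_bigr => i _; rewrite mulr_sumr.
by apply: eq_bigr => j _; rewrite mxE cabsM exprMn.
Qed.

Lemma sqnN x : sqn (- x) = sqn x.
Proof. by rewrite -scaleN1r sqnZ cabsN cabs1 expr1n mul1r. Qed.

Lemma sqnD x y (t : R) : 0 < t -> sqn (x + y) <= (1 + t) * sqn x + (1 + t^-1) * sqn y.
Proof.
move=> t0; rewrite /sqn !mulr_sumr -big_split/=; apply: ler_sum => i _.
rewrite !mulr_sumr -big_split/=; apply: ler_sum => j _.
by rewrite mxE; exact: cabsD_sqr.
Qed.

Lemma sqnD_le2 x y : sqn (x + y) <= 2 * sqn x + 2 * sqn y.
Proof. by apply: le_trans (sqnD x y ltr01) _; rewrite invr1. Qed.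

Lemma sqrt_sqnD x y : Num.sqrt (sqn (x + y)) <= Num.sqrt (sqn x) + Num.sqrt (sqn y).
Proof.
apply: triangle_of_scaled => [||t t0]; try exact: sqrtr_ge0.
by rewrite !sqr_sqrtr ?sqn_ge0//; exact: sqnD.
Qed.

Lemma sqrt_sqn_sum (I : Type) (s : seq I) (F : I -> 'M[C]_(n, r)) :
  Num.sqrt (sqn (\sum_(i <- s) F i)) <= \sum_(i <- s) Num.sqrt (sqn (F i)).
Proof.
elim: s => [|i s IH]; first by rewrite !big_nil sqn0 sqrtr0.
by rewrite !big_cons (le_trans (sqrt_sqnD _ _))// lerD2l.
Qed.

Lemma dotmDl x y z : dotm (x + y) z = dotm x z + dotm y z.
Proof.
rewrite /dotm -big_split/=; apply: eq_bigr => i _; rewrite -big_split/=.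
by apply: eq_bigr => j _; rewrite mxE mulrDl.
Qed.

Lemma dotmZl a x y : dotm (a *: x) y = a * dotm x y.
Proof.
rewrite /dotm mulr_sumr; apply: eq_bigr => i _; rewrite mulr_sumr.
by apply: eq_bigr => j _; rewrite mxE mulrA.
Qed.

Lemma dotm_conj x y : dotm y x = conjc (dotm x y).
Proof.
rewrite /dotm rmorph_sum/=; apply: eq_bigr => i _; rewrite rmorph_sum/=.
by apply: eq_bigr => j _; rewrite rmorphM/= conjcK mulrC.
Qed.

Lemma dotm_self x : dotm x x = (sqn x)%:C.
Proof.
rewrite /dotm /sqn rmorph_sum/=; apply: eq_bigr => i _; rewrite rmorph_sum/=.
by apply: eq_bigr => j _; rewrite mul_conjc.
Qed.

(** Cruder than Cauchy-Schwarz, but the bound is additive over blocks and so directly a summable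
    majorant for the inner product. *)
Lemma dotm_le x y : cabs (dotm x y) <= sqn x + sqn y.
Proof.
rewrite (le_trans (cabs_sum _ _ _))// /sqn -big_split/=; apply: ler_sum => i _.
rewrite (le_trans (cabs_sum _ _ _))// -big_split/=; apply: ler_sum => j _.
rewrite cabsM cabs_conjc; have := cabs_ge0 (x i j); have := cabs_ge0 (y i j).
move: (cabs (x i j)) (cabs (y i j)) => a b a0 b0; have := sqr_ge0 (a - b); nra.
Qed.
End MatrixNorm.

Section Adjoint.
Context {R : realType}.
Local Notation C := R[i].

Lemma adjmK n r (a : 'M[C]_(n, r)) : adjm (adjm a) = a.
Proof. by apply/matrixP => i j; rewrite !mxE conjcK. Qed.

Lemma adjmM n m r (a : 'M[C]_(n, m)) (b : 'M[C]_(m, r)) :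
  adjm (a *m b) = adjm b *m adjm a.
Proof. by rewrite /adjm map_mxM trmx_mul. Qed.

Lemma dotm_adj n r (a : 'M[C]_n) (x y : 'M[C]_(n, r)) :
  dotm (a *m x) y = dotm x (adjm a *m y).
Proof.
rewrite /dotm exchange_big [RHS]exchange_big/=; apply: eq_bigr => j _.
under eq_bigr do rewrite mxE mulr_suml.
rewrite exchange_big/=; apply: eq_bigr => k _.
rewrite mxE rmorph_sum/= mulr_sumr; apply: eq_bigr => i _.
by rewrite !mxE rmorphM/= conjcK; ring.
Qed.

Lemma sqn_isometry n r (U : 'M[C]_n) (x : 'M[C]_(n, r)) :
  adjm U *m U = 1%:M -> sqn (U *m x) = sqn x.
Proof.
move=> hU; suff : (sqn (U *m x))%:C = (sqn x)%:C by move=> [].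
by rewrite -!dotm_self dotm_adj mulmxA hU mul1mx.
Qed.

(** For unitary [U] this is the normal matrix with the columns of [U] as eigenvectors and the
    entries of [d] as eigenvalues. *)
Definition spm n (U : 'M[C]_n) (d : 'rV[C]_n) : 'M[C]_n := U *m diag_mx d *m adjm U.

Lemma sqn_diag n r (d : 'rV[C]_n) (x : 'M[C]_(n, r)) (K : R) :
  (forall i, cabs (d 0 i) <= K) -> sqn (diag_mx d *m x) <= K ^+ 2 * sqn x.
Proof.
move=> dK; rewrite /sqn mulr_sumr; apply: ler_sum => i _; rewrite mulr_sumr.
apply: ler_sum => j _; rewrite mul_diag_mx mxE cabsM exprMn ler_wpM2r ?sqr_ge0//.
by rewrite lerXn2r ?nnegrE ?cabs_ge0 ?dK// (le_trans (cabs_ge0 _) (dK i)).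
Qed.

Lemma unitary_adj n (U : 'M[C]_n) : adjm U *m U = 1%:M -> adjm (adjm U) *m adjm U = 1%:M.
Proof. by rewrite adjmK; exact: mulmx1C. Qed.

Lemma sqn_spm n r (U : 'M[C]_n) (d : 'rV[C]_n) (x : 'M[C]_(n, r)) (K : R) :
  adjm U *m U = 1%:M -> (forall i, cabs (d 0 i) <= K) ->
  sqn (spm U d *m x) <= K ^+ 2 * sqn x.
Proof.
move=> hU dK; rewrite /spm -!mulmxA sqn_isometry//.
by rewrite (le_trans (sqn_diag _ dK))// sqn_isometry//; exact: unitary_adj.
Qed.

Lemma spmM n (U : 'M[C]_n) (d e : 'rV[C]_n) : adjm U *m U = 1%:M ->
  spm U d *m spm U e = spm U (\row_i (d 0 i * e 0 i)).
Proof.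
move=> hU; rewrite /spm -!mulmxA (mulmxA (adjm U) U) hU mul1mx.
congr (U *m _); rewrite mulmxA; congr (_ *m _); apply/matrixP => i j.
rewrite mul_diag_mx !mxE; case: eqVneq => [->|_]; first by rewrite !mulr1n.
by rewrite !mulr0n mulr0.
Qed.

Lemma spm1 n (U : 'M[C]_n) : adjm U *m U = 1%:M -> spm U (\row_i 1) = 1%:M.
Proof.
move=> hU; rewrite /spm (_ : diag_mx _ = 1%:M) ?mulmx1; last first.
  by apply/matrixP => i j; rewrite !mxE.
exact: mulmx1C.
Qed.

Lemma spmD n (U : 'M[C]_n) (d e : 'rV[C]_n) : spm U (d + e) = spm U d + spm U e.
Proof. by rewrite /spm raddfD/= mulmxDr mulmxDl. Qed.

Lemma spmZ n (U : 'M[C]_n) (a : C) (d : 'rV[C]_n) : spm U (a *: d) = a *: spm U d.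
Proof. by rewrite /spm linearZ/= -scalemxAr -scalemxAl. Qed.

Lemma adjm_spm n (U : 'M[C]_n) (d : 'rV[C]_n) :
  adjm (spm U d) = spm U (map_mx conjc d).
Proof.
rewrite /spm !adjmM adjmK mulmxA; congr (_ *m _ *m _).
by apply/matrixP => i j; rewrite !mxE; case: eqVneq => [->|]; rewrite ?mulr1n ?mulr0n ?conjc0.
Qed.
End Adjoint.

(** * The Hilbert sum of the blocks as a normed space *)

Section BlockSpace.
Context {R : realType}.
Variables (N r : nat -> nat).
Local Notation C := R[i].

(* [r b] is a multiplicity: matrices of size [N b] act on the block from the left. *)
Record blockvec := BlockVec {
  bv :> forall b, 'M[C]_(N b, r b);
  bv_summable : cvgn (series (fun b => sqn (bv b))) }.
Arguments bv_summable : clear implicits.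

Lemma blockvec_eq (x y : blockvec) : (forall b, x b = y b) -> x = y.
Proof.
case: x y => [x hx] [y hy] /= xy.
have E : x = y by exact: functional_extensionality_dep.
by subst y; congr BlockVec; exact: Prop_irrelevance.
Qed.

Lemma summable_le (u v : nat -> R) : (forall n, 0 <= u n <= v n) ->
  cvgn (series v) -> cvgn (series u).
Proof.
move=> h cv; apply: series_le_cvg cv => n.
- by have /andP[] := h n.
- by have /andP[h1 h2] := h n; exact: le_trans h1 h2.
- by have /andP[] := h n.
Qed.

Lemma bv0_summable : cvgn (series (fun b => sqn (0 : 'M[C]_(N b, r b)))).
Proof.
rewrite (_ : (fun b => _) = fun=> 0); last by apply/funext => b; exact: sqn0.
rewrite (_ : series _ = fun=> 0); first exact: is_cvg_cst.
by apply/funext => n; rewrite /series/= big1.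
Qed.

Lemma bvN_summable (x : blockvec) : cvgn (series (fun b => sqn (- x b))).
Proof.
rewrite (_ : (fun b => _) = fun b => sqn (x b)); first exact: bv_summable.
by apply/funext => b; exact: sqnN.
Qed.
Arguments bvN_summable : clear implicits.

Lemma bvD_summable (x y : blockvec) : cvgn (series (fun b => sqn (x b + y b))).
Proof.
apply: (@summable_le _ (fun b => 2 * sqn (x b) + 2 * sqn (y b))) => [b|].
  by rewrite sqn_ge0 sqnD_le2.
rewrite (_ : series _ = (fun n => series (fun b => 2 * sqn (x b)) n +
    series (fun b => 2 * sqn (y b)) n)).
  by apply: is_cvgD; exact: (cvg_series_scale _ (bv_summable _)).1.
by apply/funext => n; rewrite /series /= big_split.
Qed.
Arguments bvD_summable : clear implicits.

Lemma bvZ_summable (a : C) (x : blockvec) : cvgn (series (fun b => sqn (a *: x b))).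
Proof.
under eq_fun do rewrite sqnZ.
exact: (cvg_series_scale _ (bv_summable x)).1.
Qed.
Arguments bvZ_summable : clear implicits.

Definition bv0 := BlockVec bv0_summable.
Definition bvN x := BlockVec (bvN_summable x).
Definition bvD x y := BlockVec (bvD_summable x y).
Definition bvZ a x := BlockVec (bvZ_summable a x).

HB.instance Definition _ := gen_eqMixin blockvec.
HB.instance Definition _ := gen_choiceMixin blockvec.

Let bvDA : associative bvD.
Proof. by move=> x y z; apply: blockvec_eq => b /=; rewrite addrA. Qed.
Let bvDC : commutative bvD.
Proof. by move=> x y; apply: blockvec_eq => b /=; rewrite addrC. Qed.
Let bvD0 : left_id bv0 bvD.
Proof. by move=> x; apply: blockvec_eq => b /=; rewrite add0r. Qed.
Let bvDN : left_inverse bv0 bvN bvD.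
Proof. by move=> x; apply: blockvec_eq => b /=; rewrite addNr. Qed.

HB.instance Definition _ := GRing.isZmodule.Build blockvec bvDA bvDC bvD0 bvDN.

Let bvZA a b x : bvZ a (bvZ b x) = bvZ (a * b) x.
Proof. by apply: blockvec_eq => i /=; rewrite scalerA. Qed.
Let bvZ1 : left_id 1 bvZ.
Proof. by move=> x; apply: blockvec_eq => i /=; rewrite scale1r. Qed.
Let bvZD : right_distributive bvZ +%R.
Proof. by move=> a x y; apply: blockvec_eq => i /=; rewrite scalerDr. Qed.
Let bvZDl x : {morph bvZ^~ x : a b / a + b}.
Proof. by move=> a b; apply: blockvec_eq => i /=; rewrite scalerDl. Qed.

HB.instance Definition _ := GRing.Zmodule_isLmodule.Build C blockvec bvZA bvZ1 bvZD bvZDl.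

Implicit Types (x y z : blockvec).

Lemma bv_add x y b : (x + y) b = x b + y b. Proof. by []. Qed.
Lemma bv_opp x b : (- x) b = - x b. Proof. by []. Qed.
Lemma bv_scale (a : C) x b : (a *: x) b = a *: x b. Proof. by []. Qed.
Lemma bv_zero b : (0 : blockvec) b = 0. Proof. by []. Qed.

Definition sqnorm x : R := limn (series (fun b => sqn (x b))).
Definition bnorm x : R := Num.sqrt (sqnorm x).

Lemma series_le_lim (u : nat -> R) n : (forall n, 0 <= u n) -> cvgn (series u) ->
  series u n <= limn (series u).
Proof.
move=> u0 cu; apply: nondecreasing_cvgn_le => // m k mk.
by rewrite -subr_ge0 sub_series_geq// sumr_ge0.
Qed.

Lemma partial_le_sqnorm x n : \sum_(0 <= b < n) sqn (x b) <= sqnorm x.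
Proof. by apply: (@series_le_lim (fun b => sqn (x b))) => [b|]; [exact: sqn_ge0|exact: bv_summable]. Qed.

Lemma sqnorm_le x (K : R) : (forall n, \sum_(0 <= b < n) sqn (x b) <= K) -> sqnorm x <= K.
Proof. by move=> h; apply: limr_le; [exact: bv_summable|apply: nearW => n; exact: h]. Qed.

Lemma sqn_le_sqnorm x b : sqn (x b) <= sqnorm x.
Proof.
apply: le_trans (partial_le_sqnorm x b.+1).
by rewrite big_nat_recr//= lerDr sumr_ge0// => i _; exact: sqn_ge0.
Qed.

Lemma sqnorm_ge0 x : 0 <= sqnorm x.
Proof. by apply: le_trans (sqn_le_sqnorm x 0); exact: sqn_ge0. Qed.

Lemma bnorm_ge0 x : 0 <= bnorm x. Proof. exact: sqrtr_ge0. Qed.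
Lemma bnorm_sqr x : bnorm x ^+ 2 = sqnorm x.
Proof. by rewrite sqr_sqrtr ?sqnorm_ge0. Qed.

Lemma bnormD x y : bnorm (x + y) <= bnorm x + bnorm y.
Proof.
apply: triangle_of_scaled => [||t t0]; try exact: bnorm_ge0.
rewrite !bnorm_sqr; apply: sqnorm_le => n.
apply: (@le_trans _ _ (\sum_(0 <= b < n) ((1 + t) * sqn (x b) + (1 + t^-1) * sqn (y b)))).
  by apply: ler_sum => b _; exact: sqnD.
rewrite big_split/= -!mulr_sumr lerD// ler_wpM2l ?partial_le_sqnorm ?addr_ge0 ?invr_ge0 ?(ltW t0)//.
Qed.

Lemma sqnormZ (a : C) x : sqnorm (a *: x) = cabs a ^+ 2 * sqnorm x.
Proof.
rewrite /sqnorm; under eq_fun do rewrite sqnZ.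
exact: (cvg_series_scale _ (bv_summable x)).2.
Qed.

Lemma bnormZ (a : C) x : bnorm (a *: x) = cabs a * bnorm x.
Proof. by rewrite /bnorm sqnormZ sqrtrM ?sqr_ge0// sqrtr_sqr ger0_norm ?cabs_ge0. Qed.

Lemma bnorm_eq0 x : bnorm x = 0 -> x = 0.
Proof.
move=> /eqP; rewrite sqrtr_eq0 => h; apply: blockvec_eq => b; rewrite bv_zero.
apply: sqn_eq0; apply/eqP; rewrite eq_le sqn_ge0 andbT.
exact: le_trans (sqn_le_sqnorm x b) h.
Qed.

Let cnorm x : C := (bnorm x)%:C.
Let cnormD x y : cnorm (x + y) <= cnorm x + cnorm y.
Proof. by rewrite /cnorm -rmorphD lecR bnormD. Qed.
Let cnormZ (a : C) x : cnorm (a *: x) = `|a| * cnorm x.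
Proof. by rewrite /cnorm bnormZ cabsE -rmorphM. Qed.
Let cnorm0 x : cnorm x = 0 -> x = 0.
Proof. by move=> [] /bnorm_eq0. Qed.

HB.instance Definition _ := Lmodule_isNormed.Build C blockvec cnormD cnormZ cnorm0.

Lemma bv_normE x : `|x| = (bnorm x)%:C. Proof. by []. Qed.

Lemma bv_ballE x (e : R) y : ball x e%:C y <-> bnorm (x - y) < e.
Proof. by rewrite -ball_normE /ball_ /= bv_normE ltcR. Qed.
End BlockSpace.

(** * Inner product and completeness of the Hilbert sum *)

Section BlockHilbert.
Context {R : realType}.
Variables (N r : nat -> nat).
Local Notation C := R[i].
Local Notation H := (@blockvec R N r).
Implicit Types (x y z : H).

Definition bdot x y : C := csum (fun b => dotm (x b) (y b)).

Lemma cvg_sqn2 x y : cvgn (series (fun b => sqn (x b) + sqn (y b))).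
Proof.
rewrite (_ : series _ = (fun n => series (fun b => sqn (x b)) n +
    series (fun b => sqn (y b)) n)).
  by apply: is_cvgD; exact: bv_summable.
by apply/funext => n; rewrite /series /= big_split.
Qed.

Arguments cvg_sqn2 : clear implicits.

Lemma bdotDl x y z : bdot (x + y) z = bdot x z + bdot y z.
Proof.
rewrite /bdot -(csumD (fun b => dotm_le (x b) (z b)) (fun b => dotm_le (y b) (z b))
  (cvg_sqn2 x z) (cvg_sqn2 y z)).
by apply: eq_csum => b; rewrite dotmDl.
Qed.

Lemma csumZ (a : C) (u : nat -> C) (al : nat -> R) : (forall n, cabs (u n) <= al n) ->
  cvgn (series al) -> csum (fun n => a * u n) = a * csum u.
Proof.
move=> ua ca; apply: (@csum_unique _ _ _ (fun n => cabs a * (2 * tail al n))).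
  rewrite -[X in _ --> X](_ : cabs a * (2 * 0) = 0); last by rewrite !mulr0.
  by apply: cvgM; first exact: cvg_cst; apply: cvgM; [exact: cvg_cst|exact: cvg_tail].
by move=> n; rewrite -mulr_sumr -mulrBr cabsM ler_wpM2l ?cabs_ge0//; exact: csum_tail.
Qed.

Lemma csum_conj (u : nat -> C) (al : nat -> R) : (forall n, cabs (u n) <= al n) ->
  cvgn (series al) -> csum (fun n => conjc (u n)) = conjc (csum u).
Proof.
move=> ua ca; apply: (@csum_unique _ _ _ (fun n => 2 * tail al n)).
  rewrite -[X in _ --> X](mulr0 2).
  by apply: cvgM; [exact: cvg_cst|exact: cvg_tail].
by move=> n; rewrite -rmorph_sum -rmorphB cabs_conjc; exact: csum_tail.
Qed.

Lemma csum_real (u : nat -> R) : csum (fun n => (u n)%:C) = (limn (series u))%:C.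
Proof.
rewrite /csum /=; congr (_ +i* _).
rewrite (_ : series _ = fun=> 0) ?lim_cst//.
by apply/funext => n; rewrite /series /= big1.
Qed.

Lemma bdotZl a x y : bdot (a *: x) y = a * bdot x y.
Proof.
rewrite /bdot -(csumZ a (fun b => dotm_le (x b) (y b)) (cvg_sqn2 x y)).
by apply: eq_csum => b; rewrite dotmZl.
Qed.

Lemma bdot_conj x y : bdot y x = conjc (bdot x y).
Proof.
rewrite /bdot -(csum_conj (fun b => dotm_le (x b) (y b)) (cvg_sqn2 x y)).
by apply: eq_csum => b; rewrite -dotm_conj.
Qed.

Lemma bdot_self x : bdot x x = (sqnorm x)%:C.
Proof. by rewrite /bdot /sqnorm -csum_real; apply: eq_csum => b; rewrite dotm_self. Qed.

Lemma conjE (a : C) : Num.conj a = conjc a. Proof. by []. Qed.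

Let bdot_bilinear :
  bilinear_for (GRing.Scale.Law.clone _ _ ( *%R ) _)
    (GRing.Scale.Law.clone _ _ ((Num.conj : C -> C) \; *%R ) _) bdot.
Proof.
split => [y a x z|x a y z] /=; first by rewrite bdotDl bdotZl.
rewrite bdot_conj bdotDl bdotZl rmorphD rmorphM.
by rewrite [in RHS](bdot_conj y x) [in RHS](bdot_conj z x).
Qed.
HB.instance Definition _ := bilinear_isBilinear.Build C H H C _ _ bdot bdot_bilinear.

Let bdot_hermitian x y : bdot x y = (-1) ^+ false * Num.conj (bdot y x).
Proof. by rewrite expr0 mul1r conjE -bdot_conj. Qed.
HB.instance Definition _ :=
  isHermitianSesquilinear.Build C H false (Num.conj : C -> C) bdot bdot_hermitian.

Let bdot_pos x : x != 0 -> 0 < bdot x x.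
Proof.
move=> x0; rewrite bdot_self ltcR lt_neqAle sqnorm_ge0 andbT eq_sym.
apply: contra x0 => /eqP h; apply/eqP/bnorm_eq0.
by rewrite /bnorm h sqrtr0.
Qed.
HB.instance Definition _ := isDotProduct.Build C H bdot bdot_pos.

(** The map [p] stands for the real or the imaginary part, so both are treated at once. *)
Lemma cvg_entry (F : set_system H) : ProperFilter F -> cauchy F ->
  forall b i j (p : C -> R), (forall a, `|p a| <= cabs a) -> (forall a c, p (a - c) = p a - p c) ->
  cvg ((fun x : H => p (x b i j)) @ F).
Proof.
move=> FF cF b i j p pc pB; apply/cauchy_cvgP/cauchy_exP => e e0.
have [|x hx] := (cauchyP F).1 cF e%:C; first by rewrite ltcR.
exists (p (x b i j)); rewrite /nbhs/=; apply: filterS hx => y /bv_ballE h.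
rewrite -ball_normE /= -pB; apply: le_lt_trans h; apply: le_trans (pc _) _.
rewrite -[leLHS]ger0_norm ?cabs_ge0// -sqrtr_sqr ler_wsqrtr//.
apply: le_trans (sqn_le_sqnorm (x - y) b); rewrite bv_add bv_opp.
by apply: le_trans (sqn_entry _ i j); rewrite !mxE.
Qed.

Lemma cvg_sumr (T I : Type) (F : set_system T) (FF : Filter F) (s : seq I)
    (u : I -> T -> R) (a : I -> R) : (forall i, u i @ F --> a i) ->
  (fun t => \sum_(i <- s) u i t) @ F --> \sum_(i <- s) a i.
Proof.
move=> h; elim: s => [|i s IH].
  by rewrite big_nil; under eq_fun do rewrite big_nil; exact: cvg_cst.
by rewrite big_cons; under eq_fun do rewrite big_cons; exact: cvgD.
Qed.

Let blockvec_complete (F : set_system H) : ProperFilter F -> cauchy F -> cvg F.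
Proof.
move=> FF cF.
pose l b : 'M[C]_(N b, r b) := \matrix_(i, j)
  (lim ((fun x : H => complex.Re (x b i j)) @ F) +i* lim ((fun x : H => complex.Im (x b i j)) @ F)).
have cR b i j : (fun x : H => complex.Re (x b i j)) @ F --> complex.Re (l b i j).
  rewrite mxE /=; apply: (cvg_entry FF cF); first exact: Re_le_cabs.
  by move=> a c; rewrite ReD ReN.
have cI b i j : (fun x : H => complex.Im (x b i j)) @ F --> complex.Im (l b i j).
  rewrite mxE /=; apply: (cvg_entry FF cF); first exact: Im_le_cabs.
  by move=> a c; rewrite ImD ImN.
have csqn (z : H) n : (fun x : H => \sum_(0 <= b < n) sqn (x b - z b)) @ F -->
    \sum_(0 <= b < n) sqn (l b - z b).
  apply: cvg_sumr => b; rewrite /sqn; apply: cvg_sumr => i; apply: cvg_sumr => j.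
  under eq_fun do rewrite mxE [X in _ + X]mxE cabs_sqr ReD ReN ImD ImN.
  rewrite [X in cabs X]mxE [X in _ + X]mxE cabs_sqr ReD ReN ImD ImN.
  by apply: cvgD; rewrite expr2; under eq_fun do rewrite expr2; apply: cvgM; apply: cvgB => //; exact: cvg_cst.
(* A Fatou argument: each finite partial sum passes to the entrywise limit, so the Cauchy bound
   survives uniformly in [n]. This gives both the summability of [l] and the convergence in norm. *)
have near_l (e : R) : 0 < e -> exists z : H, F (ball z e%:C) /\
    forall n, \sum_(0 <= b < n) sqn (l b - z b) <= e ^+ 2.
  move=> e0; have [|z hz] := (cauchyP F).1 cF e%:C; first by rewrite ltcR.
  exists z; split=> // n; rewrite -(cvg_lim _ (csqn z n))//; apply: limr_le; first exact: cvgP (csqn z n).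
  apply: filterS hz => x /bv_ballE h.
  apply: (@le_trans _ _ (sqnorm (z - x))).
    apply: le_trans (partial_le_sqnorm (z - x) n); apply: ler_sum => b _.
    by rewrite bv_add bv_opp -sqnN opprB.
  by rewrite -bnorm_sqr lerXn2r ?nnegrE ?bnorm_ge0 ?(ltW e0) ?(ltW h).
have sl : cvgn (series (fun b => sqn (l b))).
  have [z [_ hz]] := near_l 1 ltr01.
  apply: nondecreasing_is_cvgn.
    by apply/nondecreasing_seqP => n; rewrite !seriesEnat /= big_nat_recr//= lerDl sqn_ge0.
  exists (2 * 1 ^+ 2 + 2 * sqnorm z) => _ [n _ <-]; rewrite /series /=.
  apply: (@le_trans _ _ (\sum_(0 <= b < n) (2 * sqn (l b - z b) + 2 * sqn (z b)))).
    by apply: ler_sum => b _; rewrite -[l b in leLHS](subrK (z b)); exact: sqnD_le2.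
  by rewrite big_split/= -!mulr_sumr lerD// ler_wpM2l// partial_le_sqnorm.
pose L : H := BlockVec sl.
apply: (cvgP L); apply/cvgrPdist_lt => e e0.
(* Radii of balls are elements of [R[i]]; a positive one is real. *)
have [e1 eE] : exists e1 : R, e = e1%:C.
  by exists (complex.Re e); rewrite RRe_real// ger0_real// ltW.
rewrite {}eE ltcR in e0 *.
have e3 : 0 < e1 / 3 by rewrite divr_gt0.
have [z [hz hl]] := near_l _ e3.
apply: filterS hz => x /bv_ballE h.
rewrite bv_normE ltcR -(subrK z L) -addrA; apply: le_lt_trans (bnormD _ _) _.
have h2 : bnorm (L - z) <= e1 / 3.
  rewrite -(@ler_pXn2r _ 2) ?nnegrE ?bnorm_ge0 ?(ltW e3)// bnorm_sqr.
  by apply: sqnorm_le => n; exact: hl.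
lra.
Qed.

HB.instance Definition _ := Uniform_isComplete.Build H blockvec_complete.

Let blockvec_normE x : `|x| ^+ 2 = bdot x x.
Proof. by rewrite bv_normE bdot_self -bnorm_sqr rmorphXn. Qed.

Definition block_hilbert : hilbert R := @Hilbert R H bdot blockvec_normE.

End BlockHilbert.

Arguments bv_summable {R N r} _.

Lemma hbounded_continuous {R : realType} (V : normedModType R[i]) (T : {linear V -> V}) (K : R) :
  0 < K -> (forall x, `|T x| <= K%:C * `|x|) -> continuous T.
Proof.
move=> K0 hK x; have K1 : 0 < K%:C by rewrite ltcR.
apply/cvgrPdist_lt => e e0.
apply/nbhs_ballP; exists (e / K%:C); first by rewrite /= divr_gt0.
move=> y; rewrite -ball_normE /= ltr_pdivlMr// => h.
by rewrite -raddfB; apply: le_lt_trans (hK _) _; rewrite mulrC.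
Qed.

(** * Block diagonal operators and their spectra *)

Section BlockOperators.
Context {R : realType}.
Variables (N r : nat -> nat).
Local Notation C := R[i].
Local Notation H := (@blockvec R N r).
Local Notation HH := (@block_hilbert R N r).

Record blockop := BlockOp {
  bmx :> forall b, 'M[C]_(N b);
  bbound : exists K : R, 0 < K /\
    forall b (v : 'M[C]_(N b, r b)), sqn (bmx b *m v) <= K ^+ 2 * sqn v }.

Implicit Types (a : blockop) (x y : H).

Lemma bop_summable a x : cvgn (series (fun b => sqn (a b *m x b))).
Proof.
have [K [K0 hK]] := bbound a.
apply: (@summable_le _ _ (fun b => K ^+ 2 * sqn (x b))) => [b|].
  by rewrite sqn_ge0 hK.
exact: (cvg_series_scale _ (bv_summable x)).1.
Qed.
Arguments bop_summable : clear implicits.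

Definition bop a x : H := BlockVec (bop_summable a x).

Lemma bopE a x b : bop a x b = a b *m x b. Proof. by []. Qed.

Let bop_linear a : linear (bop a).
Proof.
move=> c x y; apply: blockvec_eq => b.
by rewrite bopE !bv_add !bv_scale mulmxDr -scalemxAr.
Qed.
HB.instance Definition _ a := GRing.isLinear.Build C H H *:%R (bop a) (bop_linear a).

Lemma bnorm_le_blockwise x y (K : R) : 0 <= K ->
  (forall b, sqn (x b) <= K ^+ 2 * sqn (y b)) -> bnorm x <= K * bnorm y.
Proof.
move=> K0 hK; rewrite -(@ler_pXn2r _ 2) ?nnegrE ?mulr_ge0 ?bnorm_ge0//.
rewrite exprMn !bnorm_sqr; apply: sqnorm_le => n.
apply: (@le_trans _ _ (\sum_(0 <= b < n) K ^+ 2 * sqn (y b))).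
  by apply: ler_sum => b _; exact: hK.
by rewrite -mulr_sumr ler_wpM2l ?sqr_ge0// partial_le_sqnorm.
Qed.

Lemma bop_continuous a : continuous (bop a : {linear HH -> HH}).
Proof.
have [K [K0 hK]] := bbound a.
apply: (hbounded_continuous K0) => x; rewrite [`|_|]bv_normE [`|x|]bv_normE -rmorphM lecR.
by apply: bnorm_le_blockwise => [|b]; [exact: ltW|exact: hK].
Qed.

Lemma bop_selfadjoint a : (forall b, adjm (a b) = a b) -> selfadjoint (bop a : {linear HH -> HH}).
Proof.
move=> ha; split; first exact: bop_continuous.
move=> x y; change (bdot (bop a x) y = bdot x (bop a y)).
by apply: eq_csum => b; rewrite bopE dotm_adj ha.
Qed.

Lemma bop_contractive a :
  (forall b (v : 'M[C]_(N b, r b)), sqn (a b *m v) <= sqn v) ->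
  contractive (bop a : {linear HH -> HH}).
Proof.
move=> ha x; rewrite /hnorm -[leLHS]/(bnorm _) -[leRHS]/(bnorm _) -[leRHS]mul1r.
by apply: bnorm_le_blockwise => // b; rewrite expr1n mul1r; exact: ha.
Qed.

Section Spectral.
Variables (U : forall b, 'M[C]_(N b)).
Hypothesis hU : forall b, adjm (U b) *m U b = 1%:M.

Lemma spectral_bound (d : forall b, 'rV[C]_(N b)) :
  (exists K : R, forall b i, cabs (d b 0 i) <= K) -> exists K : R, 0 < K /\
    forall b (v : 'M[C]_(N b, r b)), sqn (spm (U b) (d b) *m v) <= K ^+ 2 * sqn v.
Proof.
move=> [K hK]; exists (`|K| + 1); split; first by rewrite ltr_pwDr.
move=> b v; apply: sqn_spm => // i; apply: le_trans (hK b i) _.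
by rewrite (le_trans (ler_norm K))// lerDl.
Qed.

Definition sop (d : forall b, 'rV[C]_(N b))
  (hd : exists K : R, forall b i, cabs (d b 0 i) <= K) : blockop :=
  BlockOp (spectral_bound hd).

(** The inverse is diagonal in the same basis. A distance [e] uniform over the infinitely many
    blocks bounds it by [e^-1]. *)
Lemma spectrum_sop (d : forall b, 'rV[C]_(N b)) hd (l : C) (e : R) : 0 < e ->
  (forall b i, e <= cabs (d b 0 i - l)) -> ~ spectrum (bop (@sop d hd) : {linear HH -> HH}) l.
Proof.
move=> e0 he; apply; pose d' b : 'rV[C]_(N b) := \row_i (d b 0 i - l)^-1.
have inv b i : d b 0 i - l != 0.
  by apply/eqP => h; have := he b i; rewrite h cabs0 leNgt e0.
have hd' : exists K : R, forall b i, cabs (d' b 0 i) <= K.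
  exists e^-1 => b i; rewrite mxE.
  have : cabs (d b 0 i - l)^-1 * cabs (d b 0 i - l) = 1.
    by rewrite -cabsM mulVf ?inv// cabs1.
  have c0 := cabs_ge0 (d b 0 i - l)^-1; have h := he b i.
  move=> h1; rewrite -[leRHS]mul1r ler_pdivlMr//; rewrite -h1.
  by rewrite ler_wpM2l.
exists (bop (sop hd') : {linear HH -> HH}).
have spml b (v : 'M[C]_(N b, r b)) : spm (U b) (d b) *m v - l *: v = spm (U b) (\row_i (d b 0 i - l)) *m v.
  rewrite (_ : (\row_i _) = d b + (- l) *: (\row_i 1)); last first.
    by apply/rowP => i; rewrite !mxE mulr1.
  by rewrite spmD spmZ spm1// mulmxDl -scalemxAl mul1mx scaleNr.
split; first exact: bop_continuous.
  move=> x; apply: blockvec_eq => b; rewrite bopE bv_add bv_opp bv_scale bopE spml.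
  rewrite mulmxA spmM// (_ : (\row_i _) = \row_i 1) ?spm1 ?mul1mx//.
  by apply/rowP => i; rewrite !mxE mulVf.
move=> x; apply: blockvec_eq => b; rewrite bv_add bv_opp bv_scale !bopE spml.
rewrite mulmxA spmM// (_ : (\row_i _) = \row_i 1) ?spm1 ?mul1mx//.
by apply/rowP => i; rewrite !mxE mulfV.
Qed.

Lemma iter_sop (d : forall b, 'rV[C]_(N b)) hd k (x : H) b :
  iter k (bop (@sop d hd)) x b = spm (U b) (\row_i (d b 0 i ^+ k)) *m x b.
Proof.
elim: k => [|k IH] /=.
  by under eq_mx do rewrite expr0; rewrite spm1// mul1mx.
have E : \row_i (d b 0 i * (\row_j (d b 0 j ^+ k)) 0 i) = \row_i (d b 0 i ^+ k.+1) :> 'rV[C]_(N b).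
  by apply/rowP => i; rewrite !mxE exprS.
rewrite IH mulmxA (spmM _ _ (hU b)) E.
reflexivity.
Qed.
End Spectral.
End BlockOperators.

(** * Exponentials of block diagonal operators *)

Section ExpSeries.
Context {R : realType}.

Lemma cis_csum (t : R) : csum (fun k => (0 +i* t) ^+ k / k`!%:R) = cis t.
Proof.
have pw k : (0 +i* t) ^+ k = (((~~ odd k)%:R * (-1) ^+ k./2 * t ^+ k) +i*
    ((odd k)%:R * (-1) ^+ k.-1./2 * t ^+ k)) :> R[i].
  elim: k => [|k IH]; first by apply: complexP; rewrite /= ?expr0; ring.
  rewrite exprS IH; apply: complexP => /=; rewrite exprS.
    case: k {IH} => [|k] /=; first by ring.
    by case: (odd k) => /=; rewrite ?exprS; ring.
  ring.
have fc k : (k`!%:R : R[i])^-1 = ((k`!%:R)^-1)%:C by rewrite -(rmorph_nat (real_complex R)) fmorphV.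
rewrite /csum /cis; congr (_ +i* _).
  rewrite unlock; congr (limn (series _)); apply/funext => k.
  by rewrite pw fc /cos_coeff /= mulr0 subr0.
rewrite unlock; congr (limn (series _)); apply/funext => k.
by rewrite pw fc /sin_coeff /= mulr0 add0r.
Qed.

Lemma cis_partial (t a : R) n : `|t| <= a ->
  cabs (cis t - \sum_(0 <= k < n) (0 +i* t) ^+ k / k`!%:R) <= 2 * tail (exp_coeff a) n.
Proof.
move=> ta; have a0 : 0 <= a by exact: le_trans ta.
rewrite -cis_csum; apply: csum_tail; last exact: is_cvg_series_exp_coeff.
move=> k; have cX (z : R[i]) m : cabs (z ^+ m) = cabs z ^+ m.
  by elim: m => [|m IH]; rewrite ?expr0 ?cabs1// !exprS cabsM IH.
rewrite cabsM cX (_ : cabs (0 +i* t) = `|t|); last first.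
  by rewrite /cabs normc_def /= expr0n add0r sqrtr_sqr.
rewrite -(rmorph_nat (real_complex R)) -fmorphV cabs_real [X in _ * X]ger0_norm ?invr_ge0//.
by rewrite /exp_coeff /= ler_wpM2r ?invr_ge0// lerXn2r// nnegrE.
Qed.
End ExpSeries.

Lemma limn_eq_of_dist {R : realType} (V : normedModType R[i]) (u : nat -> V) (y : V) (e : nat -> R) :
  e @ \oo --> 0 -> (forall n, `|y - u n| <= (e n)%:C) -> limn u = y.
Proof.
move=> e0 h; apply: cvg_lim; first exact: norm_hausdorff.
apply/cvgrPdist_le => d d0.
have [d1 dE] : exists d1 : R, d = d1%:C.
  by exists (complex.Re d); rewrite RRe_real// ger0_real// ltW.
rewrite {}dE ltcR in d0 *.
have /cvgrPdist_le/(_ _ d0) := e0; apply: filterS => n /=; rewrite sub0r normrN => hn.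
by apply: le_trans (h n) _; rewrite lecR (le_trans (ler_norm _) hn).
Qed.

Section Exponential.
Context {R : realType}.
Variables (N r : nat -> nat).
Local Notation C := R[i].
Local Notation H := (@blockvec R N r).
Local Notation HH := (@block_hilbert R N r).
Variables (U : forall b, 'M[C]_(N b)) (lam : forall b, 'I_(N b) -> R) (s : R).
Hypothesis hU : forall b, adjm (U b) *m U b = 1%:M.
Hypothesis lam1 : forall b (i : 'I_(N b)), `|lam i| <= 1.

Let coef k : C := (0 +i* s) ^+ k / k`!%:R.

Let coefE k (t : R) : coef k * t%:C ^+ k = (0 +i* (s * t)) ^+ k / k`!%:R.
Proof.
rewrite /coef mulrAC -exprMn; congr (_ ^+ k / _).
by apply: complexP => /=; ring.
Qed.

(** The eigenvalues lie in [-1, 1], so the scalar remainder estimate [cis_partial] with [a] equal to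
    |s| holds at all of them at once and bounds the operator remainder in every block. *)
Lemma opexp_sop hd he (x : H) :
  opexp (bop (@sop R N r U hU (fun b => \row_(i < N b) (lam i)%:C) hd) : {linear HH -> HH}) s x =
  bop (@sop R N r U hU (fun b => \row_(i < N b) cis (s * lam i)) he) x.
Proof.
apply: (@limn_eq_of_dist _ _ _ _ (fun n => 2 * tail (exp_coeff `|s|) n * bnorm x)).
  rewrite -[X in _ --> X](_ : 2 * 0 * bnorm x = 0); last by rewrite mulr0 mul0r.
  apply: cvgM; last exact: cvg_cst.
  by apply: cvgM; [exact: cvg_cst|apply: cvg_tail; exact: is_cvg_series_exp_coeff].
move=> n; rewrite [`|_|]bv_normE lecR.
set A := bop _.
pose u k : H := coef k *: (iter k (bop (@sop R N r U hU _ hd)) x : H).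
pose S : H := \sum_(0 <= k < n) u k.
change (bnorm (A x - S) <= 2 * tail (exp_coeff `|s|) n * bnorm x).
have SE b : S b = spm (U b) (\row_(i < N b) \sum_(0 <= k < n) (0 +i* (s * lam i)) ^+ k / k`!%:R) *m x b.
  rewrite /S; elim: (n) => [|m IH].
    rewrite big_geq// (_ : (\row_i _) = 0 *: \row_i 1); last first.
      by apply/rowP => i; rewrite !mxE big_geq// mul0r.
    by rewrite spmZ scale0r mul0mx.
  have -> : \sum_(0 <= k < m.+1) u k = \sum_(0 <= k < m) u k + u m :> H by exact: big_nat_recr.
  rewrite bv_add IH bv_scale iter_sop.
  rewrite scalemxAl -spmZ -mulmxDl -spmD; congr (spm _ _ *m _).
  by apply/rowP => i; rewrite !mxE big_nat_recr//= coefE.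
apply: bnorm_le_blockwise.
  rewrite mulr_ge0//; have := @csum_tail _ (fun=> 0) (exp_coeff `|s|) n _ (is_cvg_series_exp_coeff _).
  rewrite -(pmulr_rge0 _ (ltr0n _ 2)) => h; apply: le_trans (h _); first exact: cabs_ge0.
  by move=> k; rewrite cabs0 exp_coeff_ge0.
move=> b; rewrite bv_add bv_opp SE bopE /= -mulmxBl.
rewrite -[X in _ - X]scale1r -scaleNr -spmZ -spmD; apply: sqn_spm => // i.
rewrite !mxE mulN1r; apply: cis_partial.
by rewrite normrM ler_piMr.
Qed.
End Exponential.

Arguments cvg_sqn2 {R N r} _ _.

(** * Functions of two block diagonal operators *)

Section FunctionsOfTwoOperators.
Context {R : realType}.
Local Notation C := R[i].

(** The sum of G(i, l) E_i F_l, where E_i is the i-th coordinate projection and F_l the projection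
    onto the l-th column of [U]: the finite form of a double operator integral. *)
Definition gmx n (U : 'M[C]_n) (G : 'I_n -> 'I_n -> C) : 'M[C]_n :=
  \matrix_(i, k) \sum_l G i l * U i l * conjc (U k l).

Lemma gmx_mul n r (U : 'M[C]_n) (G : 'I_n -> 'I_n -> C) (v : 'M[C]_(n, r)) i j :
  (gmx U G *m v) i j = \sum_l G i l * (U i l * (adjm U *m v) l j).
Proof.
rewrite mxE; under eq_bigr do rewrite mxE mulr_suml.
rewrite exchange_big/=; apply: eq_bigr => l _.
rewrite [X in _ = _ * (_ * X)]mxE !mulr_sumr; apply: eq_bigr => k _.
by rewrite !mxE; ring.
Qed.

Lemma dotm_gmx n r (U : 'M[C]_n) (G : 'I_n -> 'I_n -> C) (v y : 'M[C]_(n, r)) :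
  dotm (gmx U G *m v) y = \sum_i \sum_j \sum_l
    G i l * (U i l * (adjm U *m v) l j * conjc (y i j)).
Proof.
apply: eq_bigr => i _; apply: eq_bigr => j _; rewrite gmx_mul mulr_suml.
by apply: eq_bigr => l _; ring.
Qed.

Lemma spm_mul_gmx n (U : 'M[C]_n) (d e : 'rV[C]_n) :
  spm 1%:M d *m spm U e = gmx U (fun i l => d 0 i * e 0 l).
Proof.
apply/matrixP => i k; rewrite /spm mul1mx /adjm map_mx1 trmx1 mulmx1 mul_diag_mx !mxE mulr_sumr.
apply: eq_bigr => l _; rewrite mul_mx_diag !mxE; ring.
Qed.

(* Take [y] proportional to [a *m v]. *)
Lemma sqn_bounded_of_dotm n r (a : 'M[C]_n) (B : R) : 0 < B ->
  (forall v y : 'M[C]_(n, r), cabs (dotm (a *m v) y) <= B * (sqn v + sqn y)) ->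
  forall v : 'M[C]_(n, r), sqn (a *m v) <= (2 * B) ^+ 2 * sqn v.
Proof.
move=> B0 hB v; have B2 : 0 < (2 * B)^-1 by rewrite invr_gt0 mulr_gt0.
have := hB v ((2 * B)^-1%:C *: (a *m v)).
rewrite dotm_conj dotmZl dotm_self cabs_conjc -rmorphM cabs_real sqnZ cabs_real.
rewrite ger0_norm; last by rewrite mulr_ge0 ?sqn_ge0 ?ltW.
rewrite ger0_norm; last exact: ltW.
move: (sqn _) (sqn _) => p q h.
have alg (b t : R) : 0 < b -> (2 * b)^-1 * t <= b * (p + (2 * b)^-1 ^+ 2 * t) -> t <= (2 * b) ^+ 2 * p.
  move=> b0 h1; have b1 : 0 < (4 * b)^-1 by rewrite invr_gt0 mulr_gt0.
  rewrite -(ler_pM2l b1); have e1 : (2 * b)^-1 * t = (4 * b)^-1 * t + (4 * b)^-1 * t.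
    by field; rewrite gt_eqF.
  have e2 : b * (p + (2 * b)^-1 ^+ 2 * t) = b * p + (4 * b)^-1 * t.
    by field; rewrite gt_eqF.
  have e3 : (4 * b)^-1 * ((2 * b) ^+ 2 * p) = b * p by field; rewrite gt_eqF.
  by rewrite e3; move: h1; rewrite e1 e2 lerD2r.
exact: alg.
Qed.

Variables (N r : nat -> nat).
Local Notation H := (@blockvec R N r).
Local Notation HH := (@block_hilbert R N r).
Variables (U : forall b, 'M[C]_(N b)) (lam mu : forall b, 'I_(N b) -> R).
Hypothesis hU : forall b, adjm (U b) *m U b = 1%:M.
Hypothesis lam1 : forall b (i : 'I_(N b)), `|lam i| <= 1.
Hypothesis mu1 : forall b (i : 'I_(N b)), `|mu i| <= 1.

Lemma unitary1 b : adjm (1%:M : 'M[C]_(N b)) *m 1%:M = 1%:M.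
Proof. by rewrite mulmx1 /adjm map_mx1 trmx1. Qed.

Lemma real_diag_bound (t : forall b, 'I_(N b) -> R) :
  (forall b (i : 'I_(N b)), `|t b i| <= 1) -> exists K : R, forall b (i : 'I_(N b)),
  cabs ((fun b => \row_(i < N b) (t b i)%:C) b 0 i) <= K.
Proof. by move=> h; exists 1 => b i; rewrite mxE cabs_real. Qed.

Lemma cis_diag_bound (t : forall b, 'I_(N b) -> R) : exists K : R, forall b (i : 'I_(N b)),
  cabs ((fun b => \row_(i < N b) cis (t b i)) b 0 i) <= K.
Proof. by exists 1 => b i; rewrite mxE cabs_cis. Qed.

Definition diag_op := sop r unitary1 (real_diag_bound lam1).
Definition rot_op := sop r hU (real_diag_bound mu1).

Variables (f h : R * R -> C).
Hypothesis ih : cintegrable h.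
Hypothesis fh : forall b (i l : 'I_(N b)), f (lam i, mu l) = inv_fourier h (lam i, mu l).

Definition fun_mx b : 'M[C]_(N b) := gmx (U b) (fun i l => f (lam i, mu l)).

Let u b (v y : 'M[C]_(N b, r b)) (st : R * R) : C :=
  dotm (spm 1%:M (\row_i cis (st.1 * lam i)) *m (spm (U b) (\row_i cis (st.2 * mu i)) *m v)) y.

Let uE b (v y : 'M[C]_(N b, r b)) st : u v y st = \sum_i \sum_j \sum_l
  cis (dot2 (lam i, mu l) st) * (U b i l * (adjm (U b) *m v) l j * conjc (y i j)).
Proof.
rewrite /u mulmxA spm_mul_gmx dotm_gmx; apply: eq_bigr => i _; apply: eq_bigr => j _.
apply: eq_bigr => l _; congr (_ * _); rewrite !mxE -cisD; congr cis.
by rewrite /dot2 /= [st.1 * _]mulrC [st.2 * _]mulrC.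
Qed.

Let ccontinuous_u b (v y : 'M[C]_(N b, r b)) : ccontinuous (u v y).
Proof.
rewrite (_ : u v y = fun st => \sum_i \sum_j \sum_l
  cis (dot2 (lam i, mu l) st) * (U b i l * (adjm (U b) *m v) l j * conjc (y i j))); last first.
  by apply/funext => st; rewrite uE.
apply: ccontinuous_sum => i; apply: ccontinuous_sum => j; apply: ccontinuous_sum => l.
by apply: ccontinuousM; [exact: ccontinuous_cis|exact: ccontinuous_cst].
Qed.

Let u_le b (v y : 'M[C]_(N b, r b)) st : cabs (u v y st) <= sqn v + sqn y.
Proof.
apply: le_trans (dotm_le _ _) _; rewrite lerD2r.
apply: le_trans (@sqn_spm _ _ _ _ _ _ 1 (unitary1 b) _) _.
  by move=> i; rewrite mxE cabs_cis.
rewrite expr1n mul1r; apply: le_trans (@sqn_spm _ _ _ _ _ _ 1 (hU b) _) _.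
  by move=> i; rewrite mxE cabs_cis.
by rewrite expr1n mul1r.
Qed.

Let integral_u b (v y : 'M[C]_(N b, r b)) :
  cintegral (fun st => u v y st * h st) = dotm (fun_mx b *m v) y.
Proof.
have ic x : cintegrable (fun st => cis (dot2 x st) * h st).
  apply: (cintegrableM ih (ccontinuous_cmeasurable (ccontinuous_cis x)) (M := 1)) => z.
  by rewrite cabs_cis.
pose c i j l : C := U b i l * (adjm (U b) *m v) l j * conjc (y i j).
have it i j l : cintegrable (fun st => c i j l * (cis (dot2 (lam i, mu l) st) * h st)).
  exact: cintegrableZ.
rewrite (_ : (fun st => _) = fun st => \sum_i \sum_j \sum_l
  c i j l * (cis (dot2 (lam i, mu l) st) * h st)); last first.
  apply/funext => st; rewrite uE mulr_suml; apply: eq_bigr => i _.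
  rewrite mulr_suml; apply: eq_bigr => j _; rewrite mulr_suml; apply: eq_bigr => l _.
  by rewrite /c; ring.
rewrite dotm_gmx cintegral_sum => [|i]; last by do 2!apply: cintegrable_sum => ?.
apply: eq_bigr => i _; rewrite cintegral_sum => [|j]; last by apply: cintegrable_sum => ?.
apply: eq_bigr => j _; rewrite cintegral_sum//; apply: eq_bigr => l _.
rewrite cintegralZ// fh mulrC; congr (_ * _).
by congr cintegral; apply/funext => st; rewrite mulrC.
Qed.

(** The matrix is an average, with density [h], of products of two unitary matrices. The integral of
    [cabs h] therefore bounds it uniformly over the blocks, which the supremum of the symbol would
    not do. *)
Lemma fun_mx_bound : exists K : R, 0 < K /\
  forall b (v : 'M[C]_(N b, r b)), sqn (fun_mx b *m v) <= K ^+ 2 * sqn v.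
Proof.
pose I := \int[leb2]_z cabs (h z).
have I0 : 0 <= I by apply: I2_ge0 => z; exact: cabs_ge0.
have K0 : 0 < 2 * I + 1 by rewrite ltr_wpDl ?mulr_ge0.
exists (2 * (2 * I + 1)); split; first by rewrite mulr_gt0.
move=> b; apply: sqn_bounded_of_dotm => // v y.
rewrite -integral_u; apply: (@le_trans _ _ (2 * \int[leb2]_z ((sqn v + sqn y) * cabs (h z)))).
  apply: cabs_cintegral.
  - exact: (cintegrableM ih (ccontinuous_cmeasurable (ccontinuous_u v y)) (u_le v y)).
  - exact/int2Z/int2_cabs.
  - by move=> z; rewrite cabsM ler_wpM2r ?cabs_ge0.
rewrite I2Z -/I; last exact: int2_cabs.
rewrite mulrCA [leRHS]mulrC ler_wpM2l ?addr_ge0 ?sqn_ge0//.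
by rewrite lerDl.
Qed.

Definition fun_op := BlockOp fun_mx_bound.

(** The spectra lie in [lo, hi] by [spectrum_sop], so agreement with the inverse transform is only
    asked near that square. The exponentials act block by block, and [u_le] with [cvg_sqn2] allows
    the sum over blocks to be taken out of the integral. *)
Lemma is_fun2_block (lo hi : R) :
  (forall b (i : 'I_(N b)), lo <= lam i <= hi) ->
  (forall b (i : 'I_(N b)), lo <= mu i <= hi) ->
  (forall z, lo <= z.1 <= hi -> lo <= z.2 <= hi -> \forall y \near z, f y = inv_fourier h y) ->
  is_fun2 f (bop diag_op : {linear HH -> HH}) (bop rot_op) (bop fun_op).
Proof.
move=> hlam hmu hnear; split; first exact: bop_continuous.
exists h; split=> //.
  have spec (V : forall b, 'M[C]_(N b)) hV (t : forall b, 'I_(N b) -> R)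
      (t1 : forall b (i : 'I_(N b)), `|t b i| <= 1) (x : R) :
      (forall b (i : 'I_(N b)), lo <= t b i <= hi) ->
      spectrum (bop (@sop R N r V hV _ (real_diag_bound t1)) : {linear HH -> HH}) x%:C -> lo <= x <= hi.
    move=> ht; apply: contraPP => /negP; rewrite negb_and -!ltNge => /orP[hx|hx].
      apply: (@spectrum_sop _ _ _ _ _ _ _ _ (lo - x)); first by rewrite subr_gt0.
      move=> b i; rewrite mxE -rmorphB cabs_real; have /andP[h1 h2] := ht b i.
      by apply: le_trans (ler_norm _); rewrite lerD2r.
    apply: (@spectrum_sop _ _ _ _ _ _ _ _ (x - hi)); first by rewrite subr_gt0.
    move=> b i; rewrite mxE -rmorphB cabs_real distrC; have /andP[h1 h2] := ht b i.
    by apply: le_trans (ler_norm _); rewrite lerD2l lerN2.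
  by move=> z [s1 s2]; apply: hnear; [exact: spec hlam s1|exact: spec hmu s2].
move=> x y; change (bdot (bop fun_op x) y = cintegral (fun st => h st *
  bdot (opexp (bop diag_op : {linear HH -> HH}) st.1 (opexp (bop rot_op : {linear HH -> HH}) st.2 x)) y)).
have E st : bdot (opexp (bop diag_op : {linear HH -> HH}) st.1 (opexp (bop rot_op : {linear HH -> HH}) st.2 x)) y =
    csum (fun b => u (x b) (y b) st).
  rewrite (@opexp_sop _ N r U mu st.2 hU mu1 _ (cis_diag_bound (fun b i => st.2 * mu i))).
  rewrite (@opexp_sop _ N r _ lam st.1 unitary1 lam1 _ (cis_diag_bound (fun b i => st.1 * lam i))).
  by apply: eq_csum.
have -> : (fun st => h st * bdot (opexp (bop diag_op : {linear HH -> HH}) st.1 (opexp (bop rot_op : {linear HH -> HH}) st.2 x)) y) =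
    (fun st => csum (fun b => u (x b) (y b) st) * h st).
  by apply/funext => st; rewrite E mulrC.
rewrite (cintegral_csum (u := fun b => u (x b) (y b)) _ _ (cvg_sqn2 x y) ih) => [|b|b z]; [|exact: ccontinuous_u|exact: u_le].
by apply: eq_csum => b; rewrite integral_u.
Qed.
End FunctionsOfTwoOperators.

(** * Singular values *)

Section SingularValues.
Context {R : realType} {H : hilbert R}.
Local Notation C := R[i].
Implicit Types (T K : {linear H -> H}).

Lemma hnormE_C (x : H) : `|x| = (hnorm x)%:C.
Proof.
apply: complexP => //=.
by have := normr_ge0 x; rewrite lecE /= => /andP[/eqP].
Qed.

Lemma hnormZ (a : C) (x : H) : hnorm (a *: x) = cabs a * hnorm x.
Proof. by rewrite {1}/hnorm normrZ hnormE_C cabsE -rmorphM. Qed.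

Lemma hnorm_ge0 (x : H) : 0 <= hnorm x.
Proof. by have := normr_ge0 x; rewrite hnormE_C lecR. Qed.

Lemma hnorm_eq0 (x : H) : hnorm x = 0 -> x = 0.
Proof. by move=> h; apply/eqP; rewrite -normr_eq0 hnormE_C h. Qed.

Lemma continuous_hbounded T : continuous T ->
  exists M : R, forall x, hnorm (T x) <= M * hnorm x.
Proof.
move=> cT.
have h1 := (linear_bounded_continuous T).2 cT.
have h2 := (linear_boundedP T).1 h1.
have [M M0 hM] := pinfty_ex_gt0 h2.
exists (complex.Re M) => x.
have ME : M = (complex.Re M)%:C by rewrite RRe_real// ger0_real// ltW.
have hx := hM x.
by rewrite !hnormE_C ME -rmorphM lecR in hx.
Qed.

Lemma opnorm_ge T x : continuous T -> hnorm x <= 1 -> hnorm (T x) <= opnorm T.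
Proof.
move=> /continuous_hbounded[M hM] x1; apply: ub_le_sup; last by exists x.
exists `|M| => _ [y /= y1 <-]; apply: le_trans (hM y) _.
apply: le_trans (ler_norm _) _; rewrite normrM [`|hnorm y|]ger0_norm ?hnorm_ge0//.
by rewrite ler_piMr.
Qed.

Lemma opnorm_le T (M : R) : 0 <= M -> (forall x, hnorm (T x) <= M * hnorm x) -> opnorm T <= M.
Proof.
move=> M0 h; apply: ge_sup.
  by exists (hnorm (T 0)), 0 => //=; rewrite /hnorm normr0.
by move=> _ [x /= x1 <-]; rewrite (le_trans (h x))// ler_piMr.
Qed.

Lemma opnorm_ge0 T : 0 <= opnorm T.
Proof.
rewrite /opnorm; have [hs|hs] := pselect (has_sup [set hnorm (T x) | x in [set x : H | hnorm x <= 1]]).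
  apply: le_trans (hnorm_ge0 (T 0)) _; apply: ub_le_sup; first by case: hs.
  by exists 0 => //=; rewrite /hnorm normr0.
by rewrite sup_out.
Qed.

Lemma singular_value_ge0 T n : 0 <= singular_value T n.
Proof.
rewrite /singular_value; have [hs|hs] := pselect ([set opnorm (T \- K) | K in
   [set K : {linear H -> H} | continuous K /\ rank_le K n]] !=set0).
  by apply: lb_le_inf => // _ [K _ <-]; exact: opnorm_ge0.
by move/set0P/negP: hs; rewrite negbK => /eqP ->; rewrite inf0.
Qed.

Lemma singular_value_le T K n (M : R) : 0 <= M -> continuous K -> rank_le K n ->
  (forall x, hnorm (T x - K x) <= M * hnorm x) -> singular_value T n <= M.
Proof.
move=> M0 cK rK h; apply: le_trans (opnorm_le (T := T \- K) M0 h).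
apply: ge_inf; last by exists K.
by exists 0 => _ [L _ <-]; exact: opnorm_ge0.
Qed.

Lemma rank_kernel K n r (g : {linear 'rV[C]_r -> H}) : rank_le K n -> (n < r)%N ->
  exists2 c : 'rV[C]_r, c != 0 & K (g c) = 0.
Proof.
move=> [e he] nr.
have [G hG] := choice (fun j : 'I_r => he (g (delta_mx 0 j))).
pose M : 'M[C]_(r, n) := \matrix_(j, i) G j i.
have : kermx M != 0.
  rewrite kermx_eq0 /row_free; apply/eqP => h.
  by have := rank_leq_col M; rewrite h leqNgt nr.
move=> /rowV0Pn[c /sub_kermxP cM c0]; exists c => //.
rewrite (row_sum_delta c) !linear_sum/=.
under eq_bigr do rewrite !linearZ/= hG scaler_sumr.
rewrite exchange_big/= big1// => i _; under eq_bigr do rewrite scalerA.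
have /(congr1 (fun A : 'rV[C]_n => A 0 i)) := cM; rewrite !mxE => hi.
rewrite -scaler_suml (_ : \sum_(j < r) _ = 0) ?scale0r// -[RHS]hi.
by apply: eq_bigr => j _; rewrite mxE.
Qed.

(** Since n < r, an operator of rank at most [n] annihilates some nonzero vector in the range of
    [g], and there the difference acts as [T], which expands by at least [t]. *)
Lemma singular_value_ge T n r (g : {linear 'rV[C]_r -> H}) (t : R) :
  continuous T -> (n < r)%N -> (forall c, g c = 0 -> c = 0) ->
  (forall c, t * hnorm (g c) <= hnorm (T (g c))) -> t <= singular_value T n.
Proof.
move=> cT nr g0 gt; apply: lb_le_inf.
  exists (opnorm (T \- \0)), \0 => //=; split; first by move=> x; exact: cvg_cst.
  exists (fun=> 0) => x; exists (fun=> 0).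
  by rewrite big1// => i _; rewrite scaler0.
move=> _ [K [cK rK] <-].
have [c c0 Kc] := rank_kernel g rK nr.
have n0 : 0 < hnorm (g c).
  rewrite lt_neqAle hnorm_ge0 andbT eq_sym; apply: contra c0 => /eqP/hnorm_eq0/g0 ->//.
have h1 : hnorm ((hnorm (g c))^-1%:C *: g c) <= 1.
  by rewrite hnormZ cabs_real ger0_norm ?invr_ge0 ?hnorm_ge0// mulVf ?gt_eqF.
have cTK : continuous (T \- K).
  by move=> x; apply: cvgB; [exact: cT|exact: cK].
apply: le_trans (opnorm_ge (T := T \- K) cTK h1).
have E (S : {linear H -> H}) (a : C) x : S (a *: x) = a *: S x by exact: linearZ.
change (t <= hnorm (T ((hnorm (g c))^-1%:C *: g c) - K ((hnorm (g c))^-1%:C *: g c))).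
rewrite (E T) (E K) Kc.
rewrite (scaler0 H).
rewrite subr0.
rewrite hnormZ cabs_real ger0_norm ?invr_ge0 ?hnorm_ge0//.
by rewrite ler_pdivlMl// mulrC.
Qed.

Lemma schatten_lower (p : R) T : schatten p T -> 0 <= p -> exists M : R, forall n (t : R), 0 <= t ->
  (forall k, (k < n)%N -> t <= singular_value T k) -> n%:R * t `^ p <= M.
Proof.
move=> [_]; set S := (\sum_(0 <= n <oo) _)%E => Sfin p0.
have S0 : (0 <= S)%E by apply: nneseries_ge0 => n _ _; rewrite lee_fin powR_ge0.
exists (fine S) => n t t0 h; rewrite -lee_fin fineK ?ge0_fin_numE//.
apply: (@le_trans _ _ (\sum_(0 <= k < n) (singular_value T k `^ p)%:E)%E).
  rewrite sumEFin lee_fin mulr_natl -[n in leLHS]subn0 -sumr_const_nat.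
  rewrite big_nat [leRHS]big_nat; apply: ler_sum => k /andP[_ kn].
  by rewrite ge0_ler_powR// ?nnegrE ?h// (le_trans t0 (h k kn)).
by apply: nneseries_lim_ge => k _ _; rewrite lee_fin powR_ge0.
Qed.

Lemma schatten_upper (p : R) T (M : R) : continuous T ->
  (forall n, \sum_(0 <= k < n) singular_value T k `^ p <= M) -> schatten p T.
Proof.
move=> cT h; split=> //.
have cs : cvgn (series (fun k => singular_value T k `^ p)).
  apply: nondecreasing_is_cvgn; last by exists M => _ [n _ <-]; exact: h.
  by apply/nondecreasing_seqP => n; rewrite !seriesEnat /= big_nat_recr//= lerDl powR_ge0.
by rewrite nneseries_EFin// ltry.
Qed.
End SingularValues.

Lemma hcontinuousB {R : realType} {H : hilbert R} (T K : {linear H -> H}) :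
  continuous T -> continuous K -> continuous (T \- K).
Proof. by move=> cT cK x; apply: cvgB; [exact: cT|exact: cK]. Qed.

(** * Singular values of block diagonal operators *)

Section BlockSchatten.
Context {R : realType}.
Variables (N r : nat -> nat).
Local Notation C := R[i].
Local Notation H := (@blockvec R N r).
Local Notation HH := (@block_hilbert R N r).

(** The type of a block depends on its index, so [v] is transported along the equality of indices;
    [emb_fun_same] removes the transport. *)
Definition emb_fun b (v : 'M[C]_(N b, r b)) b' : 'M[C]_(N b', r b') :=
  match b =P b' with
  | ReflectT E => eq_rect b (fun b' => 'M[C]_(N b', r b')) v b' E
  | ReflectF _ => 0
  end.

Lemma emb_fun_same b (v : 'M[C]_(N b, r b)) : emb_fun v b = v.
Proof. by rewrite /emb_fun; case: eqP => // E; rewrite eq_axiomK. Qed.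

Lemma emb_fun_diff b (v : 'M[C]_(N b, r b)) b' : b != b' -> emb_fun v b' = 0.
Proof. by rewrite /emb_fun; case: eqP => //. Qed.

Lemma sum_emb b (v : 'M[C]_(N b, r b)) n :
  \sum_(0 <= b' < n) sqn (emb_fun v b') = if (b < n)%N then sqn v else 0.
Proof.
elim: n => [|n IH]; first by rewrite big_geq.
rewrite big_nat_recr//= IH ltnS; have [bn|bn|<-] := ltngtP b n.
- by rewrite emb_fun_diff ?ltn_eqF// sqn0 addr0.
- by rewrite emb_fun_diff ?gtn_eqF// sqn0 addr0.
- by rewrite emb_fun_same add0r.
Qed.

Lemma emb_summable b (v : 'M[C]_(N b, r b)) : cvgn (series (fun b' => sqn (emb_fun v b'))).
Proof.
apply: nondecreasing_is_cvgn.
  by apply/nondecreasing_seqP => n; rewrite !seriesEnat /= big_nat_recr//= lerDl sqn_ge0.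
exists (sqn v) => _ [n _ <-]; rewrite /series /= sum_emb.
by case: ifP => // _; exact: sqn_ge0.
Qed.

Definition emb b (v : 'M[C]_(N b, r b)) : H := BlockVec (@emb_summable b v).

Let emb_linear b : linear (@emb b).
Proof.
move=> a x y; apply: blockvec_eq => b'; rewrite bv_add bv_scale /=.
have [<-|bb] := eqVneq b b'; first by rewrite !emb_fun_same.
by rewrite !emb_fun_diff// scaler0 addr0.
Qed.
HB.instance Definition _ b := GRing.isLinear.Build C 'M[C]_(N b, r b) H *:%R (@emb b) (emb_linear (b := b)).

Lemma sqnorm_emb b (v : 'M[C]_(N b, r b)) : sqnorm (emb v) = sqn v.
Proof.
apply/eqP; rewrite eq_le; apply/andP; split.
  apply: sqnorm_le => n; rewrite sum_emb; case: ifP => // _; exact: sqn_ge0.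
by rewrite -{1}(emb_fun_same v); exact: (sqn_le_sqnorm (emb v)).
Qed.

(** The condition of [rank_le] for functions not packaged as linear maps, so that ranks of sums can
    be added freely. *)
Definition spanned (F : H -> H) n := exists e : 'I_n -> H,
  forall x, exists c : 'I_n -> C, F x = \sum_(i < n) c i *: e i.

Lemma spanned_add (F G : H -> H) m n : spanned F m -> spanned G n ->
  spanned (fun x => F x + G x) (m + n).
Proof.
move=> [e he] [e' he'].
exists (fun i => match fintype.split i with inl j => e j | inr k => e' k end) => x.
have [c hc] := he x; have [c' hc'] := he' x.
exists (fun i => match fintype.split i with inl j => c j | inr k => c' k end).
rewrite hc hc' big_split_ord /=; congr (_ + _); apply: eq_bigr => i _.
  by rewrite (unsplitK (inl i)).
by rewrite (unsplitK (inr i)).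
Qed.

Lemma spanned0 n : spanned (fun=> 0) n.
Proof.
exists (fun=> 0) => x; exists (fun=> 0).
by rewrite big1// => i _; rewrite scaler0.
Qed.

Lemma spanned_emb b (F : H -> 'M[C]_(N b, r b)) : spanned (fun x => emb (F x)) (N b * r b).
Proof.
exists (fun k => emb (vec_mx (delta_mx 0 k))) => x.
exists (fun k => mxvec (F x) 0 k).
rewrite -[F x in LHS]mxvecK {1}(row_sum_delta (mxvec (F x))) !linear_sum.
by apply: eq_bigr => k _; rewrite !linearZ.
Qed.

Lemma spanned_trunc (F : forall b, H -> 'M[C]_(N b, r b)) b :
  spanned (fun x => \sum_(0 <= b' < b) emb (F b' x)) (\sum_(0 <= b' < b) N b' * r b').
Proof.
elim: b => [|b IH].
  under [X in spanned X]funext do rewrite big_geq//.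
  exact: spanned0.
have := spanned_add IH (spanned_emb (F b)); congr spanned; last by rewrite big_nat_recr.
by apply/funext => x; apply/esym; exact: big_nat_recr.
Qed.

Lemma sum_emb_entry (F : forall b, 'M[C]_(N b, r b)) n b :
  (\sum_(0 <= b' < n) emb (F b')) b = if (b < n)%N then F b else 0.
Proof.
elim: n => [|n IH]; first by rewrite big_geq.
rewrite (_ : \sum_(0 <= b' < n.+1) _ = \sum_(0 <= b' < n) emb (F b') + emb (F n)); last exact: big_nat_recr.
rewrite bv_add IH ltnS /=; have [bn|bn|<-] := ltngtP b n.
- by rewrite emb_fun_diff ?gtn_eqF// addr0.
- by rewrite emb_fun_diff ?ltn_eqF// addr0.
- by rewrite emb_fun_same add0r.
Qed.

Variables (a1 a2 : @blockop R N r).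
Local Notation D := ((bop a1 : {linear HH -> HH}) \- (bop a2 : {linear HH -> HH})).

Lemma D_entry (x : H) b : (D x : H) b = (a1 b - a2 b) *m x b.
Proof. by rewrite mulmxBl. Qed.

Lemma D_continuous : continuous D.
Proof. exact: hcontinuousB (bop_continuous (a:=a1)) (bop_continuous (a:=a2)). Qed.

Section Upper.
Variable del : nat -> R.
Hypothesis del_ge0 : forall b, 0 <= del b.
Hypothesis del_noninc : forall b c, (b <= c)%N -> del c <= del b.
Hypothesis hdel : forall b (v : 'M[C]_(N b, r b)), sqn ((a1 b - a2 b) *m v) <= del b ^+ 2 * sqn v.

Lemma trunc_bound n : exists K : R, 0 < K /\
  forall b (v : 'M[C]_(N b, r b)), sqn ((if (b < n)%N then a1 b - a2 b else 0) *m v) <= K ^+ 2 * sqn v.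
Proof.
exists (del 0 + 1); split; first by rewrite ltr_wpDl.
move=> b v; case: ifP => _; last by rewrite mul0mx sqn0 mulr_ge0 ?sqr_ge0 ?sqn_ge0.
apply: le_trans (hdel v) _; rewrite ler_wpM2r ?sqn_ge0// lerXn2r ?nnegrE ?addr_ge0//.
by rewrite (le_trans (del_noninc (leq0n b)))// lerDl.
Qed.

(** The approximant is the truncation to the blocks before [b], whose rank is at most their total
    dimension; the later blocks have norm at most [del b] by monotonicity. *)
Lemma singular_value_block_le b n : (\sum_(0 <= b' < b) N b' * r b' <= n)%N ->
  singular_value D n <= del b.
Proof.
move=> bn; pose K := BlockOp (trunc_bound b).
have KE x : bop K x = \sum_(0 <= b' < b) emb ((a1 b' - a2 b') *m x b').
  apply: blockvec_eq => c; rewrite sum_emb_entry /=; case: ifP => // _.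
  by rewrite mul0mx.
apply: (@singular_value_le _ _ _ (bop K : {linear HH -> HH})) => //.
- exact: bop_continuous.
- have := spanned_add (spanned_trunc (fun b' x => (a1 b' - a2 b') *m x b') b)
    (spanned0 (n - \sum_(0 <= b' < b) N b' * r b')).
  rewrite subnKC// => -[e he]; exists e => x; have [c hc] := he x; exists c.
  by change (bop K x = \sum_(i < n) c i *: e i); rewrite KE -hc addr0.
- move=> x; change (bnorm ((D x : H) - bop K x) <= del b * bnorm (x : H)).
  apply: bnorm_le_blockwise => // c; rewrite bv_add bv_opp D_entry bopE -mulmxBl /=.
  case: ltnP => bc; first by rewrite subrr mul0mx sqn0 mulr_ge0 ?sqr_ge0 ?sqn_ge0.
  rewrite subr0; apply: le_trans (hdel _) _; rewrite ler_wpM2r ?sqn_ge0//.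
  by rewrite lerXn2r ?nnegrE// del_noninc.
Qed.

Hypothesis dim_gt0 : forall b, (0 < N b * r b)%N.

(** Indices are grouped into intervals whose lengths are the dimensions of the blocks; on the [b]-th
    interval all singular values are at most [del b]. *)
Lemma schatten_block (p M : R) : 0 <= p ->
  (forall n, \sum_(0 <= b < n) (N b * r b)%:R * del b `^ p <= M) -> schatten p D.
Proof.
move=> p0 hM; apply: (@schatten_upper _ _ _ _ M); first exact: D_continuous.
have grp b : \sum_(0 <= k < \sum_(0 <= b' < b) N b' * r b') singular_value D k `^ p <=
    \sum_(0 <= b' < b) (N b' * r b')%:R * del b' `^ p.
  elim: b => [|b IH]; first by rewrite !big_geq.
  rewrite [leRHS]big_nat_recr//= [X in index_iota 0 X]big_nat_recr//=.
  rewrite (@big_cat_nat _ _ _ (\sum_(0 <= b' < b) N b' * r b')%N)//=; last exact: leq_addr.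
  apply: lerD => //; set S := (\sum_(0 <= b' < b) N b' * r b')%N.
  apply: (@le_trans _ _ (\sum_(S <= k < S + N b * r b) del b `^ p)).
    rewrite big_nat [leRHS]big_nat; apply: ler_sum => k /andP[Sk _].
    by rewrite ge0_ler_powR// ?nnegrE ?singular_value_ge0// singular_value_block_le.
  by rewrite sumr_const_nat addKn mulr_natl.
move=> n; apply: le_trans (le_trans (grp n) (hM n)).
(* Blocks have dimension at least 1, so [n] groups cover the first [n] indices. *)
have nS : (n <= \sum_(0 <= b' < n) N b' * r b')%N.
  elim: (n) => // m IH; rewrite big_nat_recr//= -addn1 leq_add//.
by rewrite [leRHS](@big_cat_nat _ _ _ n)//= lerDl sumr_ge0// => k _; exact: powR_ge0.
Qed.
End Upper.

Lemma sqn_rank1 n m (v : 'cV[C]_n) (c : 'rV[C]_m) : sqn (v *m c) = sqn v * sqn c.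
Proof.
rewrite /sqn mulr_suml; apply: eq_bigr => i _.
rewrite !big_ord1 mulr_sumr; apply: eq_bigr => j _.
by rewrite mxE big_ord1 cabsM exprMn.
Qed.

(** The multiplicity provides the dimension: the matrices [v *m c] form a space of dimension [r b],
    on all of which the difference expands exactly as it does on [v]. One good vector per block is
    thus enough. *)
Lemma singular_value_block_ge b (v : 'cV[C]_(N b)) (t : R) n : sqn v = 1 -> 0 <= t ->
  t ^+ 2 <= sqn ((a1 b - a2 b) *m v) -> (n < r b)%N -> t <= singular_value D n.
Proof.
move=> v1 t0 ht nr; pose g (c : 'rV[C]_(r b)) : HH := emb (v *m c).
have glin : linear g.
  by move=> a x y; rewrite /g mulmxDr -scalemxAr; exact: (linearP (@emb b)).
pose gl := HB.pack_for {linear 'rV[C]_(r b) -> HH} g (GRing.isLinear.Build _ _ _ _ g glin).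
have gn c : bnorm (g c) = Num.sqrt (sqn c) by rewrite /bnorm sqnorm_emb sqn_rank1 v1 mul1r.
apply: (@singular_value_ge _ _ _ _ _ gl _ D_continuous nr).
  move=> c gc; have := gn c; rewrite [g c]gc => h; apply: sqn_eq0.
  have : bnorm (0 : H) = 0 by rewrite -(scale0r (0 : H)) bnormZ cabs0 mul0r.
  move: h => -> /eqP; rewrite sqrtr_eq0 => h2.
  by apply/eqP; rewrite eq_le h2 sqn_ge0.
move=> c; change (t * bnorm (g c) <= bnorm (D (g c) : H)).
have -> : (D (g c) : H) = emb ((a1 b - a2 b) *m v *m c).
  apply: blockvec_eq => b'; rewrite D_entry /=; have [<-|bb] := eqVneq b b'.
    by rewrite !emb_fun_same mulmxA.
  by rewrite !emb_fun_diff// mulmx0.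
rewrite gn /bnorm sqnorm_emb sqn_rank1 sqrtrM ?sqn_ge0//.
rewrite ler_wpM2r ?sqrtr_ge0// -(@ler_pXn2r _ 2) ?nnegrE ?sqrtr_ge0//.
by rewrite sqr_sqrtr ?sqn_ge0.
Qed.
End BlockSchatten.

(** * Integrable symbols near the spectra *)

Section SummableDomination.
Context {R : realType}.
Variables (B : nat -> R * R -> R).
Hypothesis B0 : forall m z, 0 <= B m z.
Hypothesis iB : forall m, int2 (B m).
Hypothesis cB : forall z, cvgn (series (B ^~ z)).
Hypothesis cI : cvgn (series (fun m => \int[leb2]_z B m z)).

Lemma int2_series : int2 (fun z => limn (series (B ^~ z))).
Proof.
have mG : measurable_fun setT ((fun z => limn (series (B ^~ z))) : plane R -> R).
  apply: (measurable_fun_cvg (h := (fun n z => series (B ^~ z) n) : nat -> plane R -> R)) => //.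
  by move=> n; apply: measurable_sum => m; exact: int2_measurable.
apply/integrableP; split; first exact/measurable_EFinP.
have G0 z : 0 <= limn (series (B ^~ z)).
  by apply: limr_ge; [exact: (@cB z)|apply: nearW => n; exact: sumr_ge0].
under eq_integral do rewrite gee0_abs ?lee_fin// -nneseries_EFin//.
rewrite integral_nneseries//.
- rewrite (eq_eseriesr (g := fun m => (\int[leb2]_z B m z)%:E)); last first.
    by move=> m _; rewrite /Rintegral fineK//; exact: integrable_fin_num.
  by rewrite nneseries_EFin// ltry.
- by move=> m; apply/measurable_EFinP; exact: int2_measurable.
- by move=> m z _; rewrite lee_fin.
Qed.

Lemma cvg_I2_tail :
  (fun n => \int[leb2]_z tail (B ^~ z) n) @ \oo --> 0.
Proof.
have t0 n z : 0 <= tail (B ^~ z) n.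
  by rewrite /tail subr_ge0; by apply: (@series_le_lim _ (B ^~ z)) => [m|]; [exact: B0|exact: (@cB z)].
have mt n : measurable_fun setT ((fun z => tail (B ^~ z) n) : plane R -> R).
  apply: measurable_funB; first exact: int2_measurable int2_series.
  by apply: measurable_sum => m; exact: int2_measurable.
have tG n z : `|tail (B ^~ z) n| <= limn (series (B ^~ z)).
  by rewrite ger0_norm// /tail gerBl sumr_ge0.
have [_] := I2_dominated mt (fun z => cvg_tail (cB (z:=z))) int2_series tG.
by rewrite I2_0.
Qed.

Lemma int2_tail n : int2 (fun z => tail (B ^~ z) n).
Proof. by apply: int2B; [exact: int2_series|apply: int2_sum]. Qed.

Variables (u : nat -> R * R -> R[i]).
Hypothesis iu : forall m, cintegrable (u m).
Hypothesis uB : forall m z, cabs (u m z) <= B m z.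

Lemma cmeasurable_csum : cmeasurable (fun z => csum (u ^~ z)).
Proof.
split => /=.
  apply: (measurable_fun_cvg (h := (fun n z => series (fun m => complex.Re (u m z)) n) : nat -> plane R -> R)) => //.
    by move=> n; apply: measurable_sum => m; exact: int2_measurable (iu m).1.
  move=> z _; apply: (@dominated_series_cvg _ (fun m => complex.Re (u m z)) (B ^~ z)) => [n|]; last exact: (@cB z).
  by rewrite (le_trans (Re_le_cabs _)).
apply: (measurable_fun_cvg (h := (fun n z => series (fun m => complex.Im (u m z)) n) : nat -> plane R -> R)) => //.
  by move=> n; apply: measurable_sum => m; exact: int2_measurable (iu m).2.
move=> z _; apply: (@dominated_series_cvg _ (fun m => complex.Im (u m z)) (B ^~ z)) => [n|]; last exact: (@cB z).
by rewrite (le_trans (Im_le_cabs _)).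
Qed.

Lemma csum_le_lim z : cabs (csum (u ^~ z)) <= 2 * limn (series (B ^~ z)).
Proof. by apply: (@csum_le _ (u ^~ z) (B ^~ z)) => [n|]; [exact: uB|exact: (@cB z)]. Qed.

Lemma cintegrable_csum : cintegrable (fun z => csum (u ^~ z)).
Proof.
have [mR mI] := cmeasurable_csum.
split; apply: (int2_le _ _ (g := fun z => 2 * limn (series (B ^~ z)))).
- exact: mR.
- by move=> z; rewrite (le_trans (Re_le_cabs _)) ?csum_le_lim.
- exact/int2Z/int2_series.
- exact: mI.
- by move=> z; rewrite (le_trans (Im_le_cabs _)) ?csum_le_lim.
- exact/int2Z/int2_series.
Qed.

(** The counterpart of [cintegral_csum] with the roles exchanged: here [psi] is only bounded, and
    the majorants are integrable functions with summable integrals. *)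
Lemma cintegral_csum_dominated (psi : R * R -> R[i]) : cmeasurable psi ->
  (forall z, cabs (psi z) <= 1) ->
  cintegral (fun z => csum (u ^~ z) * psi z) = csum (fun m => cintegral (fun z => u m z * psi z)).
Proof.
move=> mpsi psi1; apply/esym.
have im m : cintegrable (fun z => u m z * psi z).
  under eq_fun do rewrite mulrC.
  exact: (cintegrableM (iu m) mpsi psi1).
have iS : cintegrable (fun z => csum (u ^~ z) * psi z).
  under eq_fun do rewrite mulrC.
  exact: (cintegrableM cintegrable_csum mpsi psi1).
apply: (@csum_unique _ _ _ (fun n => 4 * \int[leb2]_z tail (B ^~ z) n)).
  rewrite -[X in _ --> X](mulr0 4); apply: cvgM; [exact: cvg_cst|exact: cvg_I2_tail].
move=> n; rewrite -cintegral_sum// -[X in _ - X]mul1r -mulNr -cintegralZ; last exact: cintegrable_sum.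
rewrite -cintegralD//; last by apply: cintegrableZ; exact: cintegrable_sum.
have -> : 4 * \int[leb2]_z tail (B ^~ z) n = 2 * \int[leb2]_z (2 * tail (B ^~ z) n).
  by rewrite I2Z; [ring|exact: int2_tail].
apply: cabs_cintegral.
- by apply: cintegrableD => //; apply: cintegrableZ; exact: cintegrable_sum.
- exact/int2Z/int2_tail.
- move=> z; rewrite -mulr_suml mulNr mul1r -mulrBl cabsM.
  apply: le_trans (ler_piMr _ (psi1 z)) _; first exact: cabs_ge0.
  by apply: (@csum_tail _ (u ^~ z) (B ^~ z)) => [m|]; [exact: uB|exact: (@cB z)].
Qed.
End SummableDomination.

(** * Cutting a trigonometric series off to an annulus *)

Section LocalizedSymbol.
Context {R : realType}.

Lemma Cweight_compact k j (F : R * R -> R) (r : R) : (forall z, r < norm2 z -> F z = 0) ->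
  Cweight (fun=> 1) k j F -> Cweight (poisson2 1 0) k j F.
Proof.
have bnd (G : R * R -> R) : (forall z, r < norm2 z -> G z = 0) ->
    (exists M, forall z, `|G z| <= M * 1) -> exists M, forall z, `|G z| <= M * poisson2 1 0 z.
  move=> G0 [M GM]; exists (`|M| * (1 + r ^+ 2) ^+ 2) => z.
  have [zr|zr] := ltP r (norm2 z).
    rewrite G0// normr0; apply: mulr_ge0; last exact: ltW (poisson2_gt0 _ _ ltr01).
    by rewrite mulr_ge0// sqr_ge0.
  have GM' : `|G z| <= `|M| by rewrite (le_trans (GM z))// mulr1 ler_norm.
  apply: le_trans GM' _; rewrite -mulrA ler_peMr//.
  rewrite /poisson2 /poisson !subr0 expr1n !div1r -invfM.
  have h := norm2_sqr z; have n0 := norm2_ge0 z.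
  have hr : norm2 z ^+ 2 <= r ^+ 2 by rewrite lerXn2r ?nnegrE// (le_trans n0).
  rewrite ler_pdivlMr ?mul1r; last by rewrite mulr_gt0// ltr_wpDr// sqr_ge0.
  rewrite h in hr; rewrite expr2; apply: ler_pM.
  - by rewrite addr_ge0// sqr_ge0.
  - by rewrite addr_ge0// sqr_ge0.
  - by rewrite lerD2l (le_trans _ hr)// lerDl sqr_ge0.
  - by rewrite lerD2l (le_trans _ hr)// lerDr sqr_ge0.
elim: k F => [|k IH] F F0 [cF bF dF]; first by split=> //; exact: bnd.
split=> //; first exact: bnd.
have [dF1 CF] := dF; split=> //; apply: IH CF => z zr.
rewrite (@near_eq_derive _ _ _ F (fun=> 0)) ?derive_cst//.
have /cvgr_gt/(_ _ zr) := @continuous_norm2 R z.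
by apply: filterS => y; exact: F0.
Qed.

Variables (w : R -> R).
Hypothesis hw : besov_window w.

(** The given window itself supplies the smooth cutoff: of these three consecutive dilates, two add
    up to 1 at each point of 1/2 <= |z| <= 2 while the third vanishes. *)
Definition bump (z : R * R) : R := w (2 * norm2 z) + w (1 * norm2 z) + w (2^-1 * norm2 z).

Lemma bump_decay k j : Cweight (poisson2 1 0) k j bump.
Proof.
have c (a : R) : 2^-1 <= a -> Cweight (poisson2 1 0) k j (fun z => w (a * norm2 z)).
  (* The widest dilate, with factor 1/2, vanishes from |z| = 4 on. *)
  move=> hc; apply: (@Cweight_compact _ _ _ 4) => [z z4|].
    by apply: (window_out hw); apply/negP => /andP[_ h]; nra.
  by apply: Cweight_window => //; lra.
have p0 (z : R * R) : 0 <= poisson2 1 0 z := poisson2_ge0 z.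
apply: CweightD => //; last by apply: c; lra.
by apply: CweightD => //; apply: c; lra.
Qed.

Lemma bump_eq1 z : 2^-1 <= norm2 z <= 2 -> bump z = 1.
Proof.
move=> /andP[z1 z2]; rewrite /bump mul1r; have [h|h] := leP (norm2 z) 1.
  rewrite (window_half hw) ?z1//.
  rewrite (window_out hw) ?addr0//; apply/negP => /andP[h1 _]; lra.
rewrite (window_out hw) ?add0r; last by apply/negP => /andP[_ h2]; lra.
rewrite -[X in w X](_ : 2 * (2^-1 * norm2 z) = norm2 z); last by rewrite mulrA mulfV// mul1r.
by apply: (window_half hw); apply/andP; split; lra.
Qed.

(** The integrable replacement for the point mass at [xi]. Modulation becomes translation
    ([atom_shift]), so one profile yields a bound for all frequencies. *)
Definition atom (xi : R * R) : R * R -> R[i] :=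
  fourier (fun z => (bump z)%:C * cis (dot2 xi z)).

Let bump_rapid xi : rapid (fun z => complex.Re ((bump z)%:C * cis (dot2 xi z))) /\
  rapid (fun z => complex.Im ((bump z)%:C * cis (dot2 xi z))).
Proof.
have p0 (z : R * R) : 0 <= poisson2 1 0 z := poisson2_ge0 z.
have h j : Cweight (poisson2 1 0) 4 j (fun z => complex.Re ((bump z)%:C * cis (dot2 xi z))) /\
    Cweight (poisson2 1 0) 4 j (fun z => complex.Im ((bump z)%:C * cis (dot2 xi z))).
  have [hc hs] := @Cweight_cos_sin R 4 j xi.
  split.
    have := CweightM hc (bump_decay 4 j) p0; congr Cweight; apply/funext => z.
    by rewrite ReM /= mul0r subr0 mulrC dot2C.
  have := CweightM hs (bump_decay 4 j) p0; congr Cweight; apply/funext => z.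
  by rewrite ImM /= mul0r addr0 mulrC dot2C.
have [f1 f2] := h false; have [t1 t2] := h true.
by split; split.
Qed.

Lemma cintegrable_atom xi : cintegrable (atom xi).
Proof.
have [h1 h2] := bump_rapid xi; rewrite /atom.
exact: (@rapid_cintegrable_fourier R (fun z => (bump z)%:C * cis (dot2 xi z)) h1 h2).
Qed.

Lemma inv_fourier_atom xi z : inv_fourier (atom xi) z = (bump z)%:C * cis (dot2 xi z).
Proof.
have [/rapid_fourier_nice[n1 _] /rapid_fourier_nice[n2 _]] := bump_rapid xi; rewrite /atom.
exact: (@fourier_inversion R (fun z => (bump z)%:C * cis (dot2 xi z)) z n1 n2).
Qed.

Lemma atom_shift xi z : atom xi z = atom 0 (z - xi).
Proof.
rewrite /atom /fourier; congr (_ * cintegral _); apply/funext => x.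
rewrite (_ : dot2 0 x = 0); last by rewrite /dot2 /= !mul0r addr0.
rewrite cis0 mulr1 -mulrA -cisD; congr (_ * cis _).
by rewrite /dot2 /=; ring.
Qed.

Lemma atom_bound : exists2 K : R, 0 <= K &
  forall xi z, cabs (atom xi z) <= K * poisson2 1 xi z.
Proof.
have [hR hI] := bump_rapid 0.
have [[_ _ iR _ _] [K1 h1]] := rapid_fourier_nice hR.
have [[_ _ iI _ _] [K2 h2]] := rapid_fourier_nice hI.
have p20 : 0 <= ((2 * pi) ^- 2 : R) by rewrite invr_ge0 exprn_ge0// mulr_ge0// pi_ge0.
pose K := (2 * pi) ^- 2 * (2 * (`|K1| + `|K2|)).
exists K; first by rewrite mulr_ge0// mulr_ge0// addr_ge0.
move=> xi z; rewrite atom_shift.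
have -> : poisson2 1 xi z = poisson2 1 0 (z - xi) by rewrite /poisson2 /poisson /= !subr0.
move: (z - xi) => y; have P0 := poisson2_ge0 (R:=R) y.
have {}h1 : `|fcos (fun z => complex.Re ((bump z)%:C * cis (dot2 0 z))) y| <= `|K1| * poisson2 1 0 y /\
    `|fsin (fun z => complex.Re ((bump z)%:C * cis (dot2 0 z))) y| <= `|K1| * poisson2 1 0 y.
  by have [a b] := h1 y; split; [apply: le_trans a _|apply: le_trans b _]; rewrite ler_wpM2r// ler_norm.
have {}h2 : `|fcos (fun z => complex.Im ((bump z)%:C * cis (dot2 0 z))) y| <= `|K2| * poisson2 1 0 y /\
    `|fsin (fun z => complex.Im ((bump z)%:C * cis (dot2 0 z))) y| <= `|K2| * poisson2 1 0 y.
  by have [a b] := h2 y; split; [apply: le_trans a _|apply: le_trans b _]; rewrite ler_wpM2r// ler_norm.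
rewrite (le_trans (cabs_le_ReIm _))// /atom fourierE//= !normrM !(ger0_norm p20) -mulrDr.
rewrite /K -!mulrA ler_wpM2l//.
move: h1 h2 => [a1 a2] [b1 b2].
apply: le_trans (lerD (ler_normD _ _) (ler_normB _ _)) _.
rewrite mulrA mulrDr mulrDl; lra.
Qed.

Variable s : nat -> seq (R[i] * (R * R)).
Hypothesis cvg_wiener : cvgn (series (fun m => wiener_norm (s m))).

(** Take the series of the coefficients times the atoms at their frequencies. All atoms have the
    same mass bound, so summability of the Wiener norms makes it integrable, and its inverse
    transform is the bump times the trigonometric series. *)
Lemma localized_symbol : exists h : R * R -> R[i], cintegrable h /\
  forall z, 2^-1 <= norm2 z <= 2 -> trigseries (fun=> 1) s z = inv_fourier h z.
Proof.
have [K K0 hK] := atom_bound.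
pose B m z := \sum_(t <- s m) cabs t.1 * (K * poisson2 1 t.2 z).
pose u m z := \sum_(t <- s m) t.1 * atom t.2 z.
have P0 xi (z : R * R) : 0 <= poisson2 1 xi z by exact/ltW/poisson2_gt0.
have B0 m z : 0 <= B m z.
  by apply: sumr_ge0 => t _; apply: mulr_ge0; [exact: cabs_ge0|exact: mulr_ge0].
have iP (a : R) xi : int2 (fun z => a * (K * poisson2 1 xi z)).
  by apply/int2Z/int2Z/int2_poisson2.
have iB m : int2 (B m) by apply: int2_sum => t.
have IB m : \int[leb2]_z B m z = (K * pi ^+ 2) * wiener_norm (s m).
  rewrite I2_sum => [|t]; last exact: iP.
  rewrite /wiener_norm mulr_sumr; apply: eq_bigr => t _.
  rewrite I2Z ?I2Z ?I2_poisson2// ?mulrA; [ring|exact: int2_poisson2|].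
  exact/int2Z/int2_poisson2.
have Bw m z : B m z <= K * wiener_norm (s m).
  rewrite /B /wiener_norm mulr_sumr; apply: ler_sum => t _.
  rewrite mulrCA ler_wpM2l// ler_piMr ?cabs_ge0//.
  have p1 (a x : R) : poisson 1 a x <= 1.
    rewrite /poisson expr1n ler_pdivrMr ?mul1r ?lerDl ?sqr_ge0//.
    by rewrite ltr_wpDr// sqr_ge0.
  by rewrite /poisson2 mulr_ile1// ltW// poisson_gt0.
have cB z : cvgn (series (B ^~ z)).
  apply: (@summable_le _ _ (fun m => K * wiener_norm (s m))) => [m|].
    by rewrite B0 Bw.
  exact: (cvg_series_scale _ cvg_wiener).1.
have cI : cvgn (series (fun m => \int[leb2]_z B m z)).
  under eq_fun do rewrite IB.
  exact: (cvg_series_scale _ cvg_wiener).1.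
have iu m : cintegrable (u m).
  by apply: cintegrable_sum => t; apply: cintegrableZ; exact: cintegrable_atom.
have uB m z : cabs (u m z) <= B m z.
  rewrite (le_trans (cabs_sum _ _ _))//; apply: ler_sum => t _.
  by rewrite cabsM ler_wpM2l ?cabs_ge0.
exists (fun z => csum (u ^~ z)); split; first exact: (cintegrable_csum B0 iB cB cI iu uB).
move=> z /bump_eq1 z1; rewrite /inv_fourier.
rewrite (cintegral_csum_dominated B0 iB cB cI iu uB).
- apply: eq_csum => m; rewrite /trigpoly /u.
  have ic t : cintegrable (fun xi => atom t xi * cis (dot2 z xi)).
    under eq_fun do rewrite mulrC.
    apply: (cintegrableM (cintegrable_atom t) (ccontinuous_cmeasurable (ccontinuous_cis z)) (M := 1)) => y.
    by rewrite cabs_cis.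
  under [X in _ = cintegral X]funext do rewrite mulr_suml.
  under [X in _ = cintegral X]funext do under eq_bigr do rewrite -mulrA.
  rewrite cintegral_sum => [|t]; last exact: cintegrableZ.
  apply: eq_bigr => t _; rewrite cintegralZ// (_ : (1 : R)%:C = 1)// mul1r.
  by have := inv_fourier_atom t.2 z; rewrite /inv_fourier z1 mul1r => ->.
- exact/ccontinuous_cmeasurable/ccontinuous_cis.
- by move=> xi; rewrite cabs_cis.
Qed.
End LocalizedSymbol.

(** * The example *)

Section DiscreteFourier.
Context {R : realType}.
Local Notation C := R[i].

Lemma cisX (t : R) n : cis t ^+ n = cis (n%:R * t).
Proof.
elim: n => [|n IH]; first by rewrite expr0 mul0r cis0.
by rewrite exprS IH -cisD; congr cis; rewrite -natr1; ring.
Qed.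

Lemma conjc_cis (t : R) : conjc (cis t) = cis (- t).
Proof. by rewrite cisN. Qed.

Lemma conjcM (a b : C) : conjc (a * b) = conjc a * conjc b.
Proof. exact: rmorphM. Qed.

Lemma cis_2pin n : cis (n%:R * (2 * pi)) = 1 :> C.
Proof.
rewrite -cisX (_ : cis (2 * pi) = 1) ?expr1n//.
by rewrite /cis mulr_natl cos2pi sin2pi.
Qed.

Lemma cis_neq1 (t : R) : 0 < t < 2 * pi -> cis t != 1.
Proof.
move=> /andP[t0 t1]; apply/eqP => -[] h _.
have sp : 0 < sin (t / 2) by apply: sin_gt0_pi; apply/andP; split; lra.
have := cos2Dsin2 (t / 2); have := cosD (t / 2) (t / 2).
rewrite (_ : t / 2 + t / 2 = t); last by lra.
by rewrite h -!expr2 => h1 h2; nra.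
Qed.

Lemma sum_cis n (a b : nat) : (a < n)%N -> (b < n)%N -> a != b ->
  \sum_(j < n) cis (j%:R * (2 * pi * (b%:R - a%:R) / n%:R)) = 0 :> C.
Proof.
move=> an bn ab.
have n0 : 0 < n%:R :> R by rewrite ltr0n (leq_trans _ an).
have p0 : 0 < 2 * pi :> R by rewrite mulr_gt0// pi_gt0.
have less (c d : nat) : (c < d)%N -> (d < n)%N -> cis (2 * pi * (d%:R - c%:R) / n%:R) != 1 :> C.
  move=> cd dn; have d0 : 0 < (d%:R - c%:R : R) by rewrite subr_gt0 ltr_nat.
  have d1 : (d%:R - c%:R : R) < n%:R by rewrite ltrBlDl ltr_wpDl// ltr_nat.
  apply: cis_neq1; rewrite divr_gt0 ?mulr_gt0 ?pi_gt0//=.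
  by rewrite ltr_pdivrMr// ltr_pM2l.
have tneq : cis (2 * pi * (b%:R - a%:R) / n%:R) != 1 :> C.
  move: ab; rewrite neq_ltn => /orP[h|h]; first exact: less.
  apply: contra (less _ _ h an) => /eqP h2; have := congr1 conjc h2; rewrite conjc_cis conjc1 => <-.
  by apply/eqP; congr cis; ring.
move: tneq; set t := 2 * pi * _ / _ => tneq.
under eq_bigr do rewrite -cisX.
have := subrX1 (cis t) n; rewrite cisX (_ : n%:R * t = b%:R * (2 * pi) - a%:R * (2 * pi)); last first.
  by rewrite /t; field; rewrite gt_eqF.
rewrite cisD -conjc_cis !cis_2pin conjc1 mulr1 subrr => /esym/eqP.
by rewrite mulf_eq0 subr_eq0 (negPf tneq) => /eqP.
Qed.

Definition dft n : 'M[C]_n := \matrix_(j, l)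
  ((Num.sqrt n%:R)^-1%:C * cis (j%:R * (2 * pi * l%:R / n%:R))).

Lemma dft_unitary n : adjm (dft n) *m dft n = 1%:M.
Proof.
apply/matrixP => i k; rewrite !mxE.
have n0 : 0 < n%:R :> R by rewrite ltr0n (leq_trans _ (ltn_ord i)).
have sq : ((Num.sqrt n%:R)^-1 * (Num.sqrt n%:R)^-1 : R) = n%:R^-1.
  by rewrite -invfM -expr2 sqr_sqrtr// ltW.
under eq_bigr => j _.
  rewrite !mxE conjcM conjc_cis conjc_real mulrACA -rmorphM sq -cisD.
  rewrite (_ : - _ + _ = j%:R * (2 * pi * (k%:R - i%:R) / n%:R)); last first.
    by field; rewrite gt_eqF.
  over.
rewrite -mulr_sumr; case: (eqVneq i k) => [<-|ik].
  rewrite (eq_bigr (fun=> 1)) => [|j _]; last by rewrite subrr mulr0 mul0r mulr0 cis0.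
  rewrite sumr_const card_ord -(rmorph_nat (real_complex R)) -rmorphM mulVf ?gt_eqF//.
by rewrite sum_cis ?mulr0.
Qed.
End DiscreteFourier.

(** * One piece of the symbol *)

Section SingleBlock.
Context {R : realType}.
Local Notation C := R[i].
Variables (n : nat) (P al : R).
Hypothesis n_gt0 : (0 < n)%N.
Hypothesis al_ge0 : 0 <= al.
Let T := ('I_n * ('I_n * 'I_n))%type.

(* Coefficients and frequencies of [al e^{i P x} \sum_j |D_j(x)|^2 e^{-2 pi i j Y / n}],
   where [X = 8 n (x - 5 / 8)], [Y = 8 n (y - 5 / 8)] and
   [D_j(x) = n^-1 \sum_l e^{2 pi i l (X - j) / n}] (the vector [fejer x]) interpolates the
   [j]-th basis vector at the nodes. *)
Definition block_coef (t : T) : C := (al / n%:R ^+ 2)%:C *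
  cis (t.1%:R * (10 * pi) - (t.2.1%:R - t.2.2%:R) * (10 * pi + 2 * pi * t.1%:R / n%:R)).
Definition block_freq (t : T) : R * R :=
  (P + 16 * pi * (t.2.1%:R - t.2.2%:R), - (16 * pi * t.1%:R)).
Definition block_seq : seq (C * (R * R)) :=
  [seq (block_coef t, block_freq t) | t <- enum {: T}].

(** Here [16 * pi * x - 10 * pi] is 2 pi X / n. At the i-th node this is the i-th column of [dft n],
    so [fejer] is a basis vector there. *)
Definition wave (x : R) : 'cV[C]_n := \col_l
  ((Num.sqrt n%:R)^-1%:C * cis (l%:R * (16 * pi * x - 10 * pi))).
Definition fejer (x : R) : 'cV[C]_n := adjm (dft n) *m wave x.

Let n0 : 0 < n%:R :> R. Proof. by rewrite ltr0n. Qed.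
Let sq : ((Num.sqrt n%:R)^-1 * (Num.sqrt n%:R)^-1 : R) = n%:R^-1.
Proof. by rewrite -invfM -expr2 sqr_sqrtr// ltW. Qed.

Lemma fejerE x j : fejer x j 0 = \sum_(l < n) n%:R^-1%:C *
  cis (l%:R * (16 * pi * x - 10 * pi - 2 * pi * j%:R / n%:R)).
Proof.
rewrite mxE; apply: eq_bigr => l _; rewrite !mxE conjcM conjc_cis conjc_real.
rewrite mulrACA -rmorphM sq -cisD; congr (_ * cis _); ring.
Qed.

Lemma sum_block_seq (F : C * (R * R) -> C) :
  \sum_(t <- block_seq) F t = \sum_(j < n) \sum_(l < n) \sum_(k < n)
    F (block_coef (j, (l, k)), block_freq (j, (l, k))).
Proof.
rewrite /block_seq big_map big_enum/=.
rewrite -(pair_bigA _ (fun j p => F (block_coef (j, p), block_freq (j, p))))/=.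
apply: eq_bigr => j _.
by rewrite -(pair_bigA _ (fun l k => F (block_coef (j, (l, k)), block_freq (j, (l, k))))).
Qed.

Lemma trigpoly_block z : trigpoly (fun=> 1) block_seq z =
  al%:C * cis (P * z.1) * \sum_(j < n) (cabs (fejer z.1 j 0) ^+ 2)%:C *
    cis (j%:R * (10 * pi - 16 * pi * z.2)).
Proof.
rewrite /trigpoly sum_block_seq mulr_sumr; apply: eq_bigr => j _.
have E (F : 'I_n -> C) : (\sum_l F l) * conjc (\sum_k F k) = \sum_l \sum_k F l * conjc (F k).
  by rewrite rmorph_sum big_distrlr.
rewrite -mul_conjc fejerE E mulr_suml mulr_sumr.
apply: eq_bigr => l _; rewrite mulr_suml mulr_sumr; apply: eq_bigr => k _.
rewrite conjcM conjc_real conjc_cis (_ : (1 : R)%:C = 1)// mul1r /block_coef /block_freq /dot2 /=.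
rewrite (_ : (al / n%:R ^+ 2)%:C = al%:C * (n%:R^-1%:C * n%:R^-1%:C)); last first.
  by rewrite -!rmorphM; congr (_%:C); field; rewrite gt_eqF.
set a := al%:C; set b := n%:R^-1%:C.
rewrite -mulrA -cisD.
have -> : a * cis (P * z.1) * (b * cis (l%:R * (16 * pi * z.1 - 10 * pi - 2 * pi * j%:R / n%:R)) *
   (b * cis (- (k%:R * (16 * pi * z.1 - 10 * pi - 2 * pi * j%:R / n%:R)))) *
   cis (j%:R * (10 * pi - 16 * pi * z.2))) = a * (b * b) * (cis (P * z.1) *
   (cis (l%:R * (16 * pi * z.1 - 10 * pi - 2 * pi * j%:R / n%:R)) *
   (cis (- (k%:R * (16 * pi * z.1 - 10 * pi - 2 * pi * j%:R / n%:R))) *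
   cis (j%:R * (10 * pi - 16 * pi * z.2))))) by ring.
by rewrite -!cisD; congr (_ * cis _); ring.
Qed.

(** The squares |D_j(x)|^2 are therefore convex weights for every [x], not just at nodes. This keeps
    the piece below [al] in modulus although its coefficients have total mass [al * n]. *)
Lemma sqn_fejer x : sqn (fejer x) = 1.
Proof.
rewrite /fejer sqn_isometry; last exact/unitary_adj/dft_unitary.
rewrite /sqn; under eq_bigr do rewrite big_ord1 mxE cabsM cabs_cis mulr1 cabs_real.
rewrite sumr_const card_ord ger0_norm ?invr_ge0 ?sqrtr_ge0// expr2 sq.
by rewrite -(mulr_natr (n%:R^-1) n) mulVf// gt_eqF.
Qed.

Lemma cabs_trigpoly_block z : cabs (trigpoly (fun=> 1) block_seq z) <= al.
Proof.
rewrite trigpoly_block !cabsM cabs_real cabs_cis mulr1 ger0_norm// ler_piMr//.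
rewrite (le_trans (cabs_sum _ _ _))// -(sqn_fejer z.1) /sqn; apply: ler_sum => j _.
by rewrite big_ord1 cabsM cabs_cis mulr1 cabs_real ger0_norm ?sqr_ge0.
Qed.

Lemma trigpoly_block_node (i : 'I_n) y :
  trigpoly (fun=> 1) block_seq (5 / 8 + i%:R / (8 * n%:R), y) =
  al%:C * cis (P * (5 / 8 + i%:R / (8 * n%:R)) + i%:R * (10 * pi - 16 * pi * y)).
Proof.
have fe j : fejer (5 / 8 + i%:R / (8 * n%:R)) j 0 = (j == i)%:R.
  rewrite /fejer; have -> : wave (5 / 8 + i%:R / (8 * n%:R)) = col i (dft n).
    apply/matrixP => l k; rewrite !mxE; congr (_ * cis (_ * _)).
    by field; rewrite gt_eqF.
  by rewrite colE mulmxA dft_unitary mul1mx !mxE andbT.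
rewrite trigpoly_block /= (bigD1 i)//= big1 => [|j ji].
  by rewrite fe eqxx cabs1 expr1n mul1r addr0 -mulrA -cisD.
by rewrite fe (negPf ji) cabs0 expr0n mul0r.
Qed.

Lemma wiener_block_seq : wiener_norm block_seq = al * n%:R.
Proof.
rewrite /wiener_norm /block_seq big_map big_enum/=.
rewrite (eq_bigr (fun=> al / n%:R ^+ 2)) => [|t _]; last first.
  by rewrite cabsM cabs_cis mulr1 cabs_real ger0_norm// divr_ge0// sqr_ge0.
rewrite sumr_const (_ : #|_| = (n * (n * n))%N); last by rewrite !card_prod !card_ord.
rewrite -(mulr_natr (al / _)) !natrM.
by field; rewrite gt_eqF.
Qed.

Lemma block_seq_freq t : t \in block_seq ->
  `|t.2.1 - P| <= 16 * pi * n%:R /\ `|t.2.2| <= 16 * pi * n%:R.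
Proof.
move=> /mapP[[j [l k]] _ ->] /=; have p0 : 0 < 16 * pi :> R by rewrite mulr_gt0// pi_gt0.
have e (x : R) : `|16 * pi * x| = 16 * pi * `|x| by rewrite normrM ger0_norm// ltW.
rewrite addrAC subrr add0r normrN !e !ler_pM2l// normr_nat ler_nat (ltnW (ltn_ord j)); split=> //.
rewrite ler_norml; apply/andP; split.
  rewrite lerNl opprB lerBlDr (le_trans _ (_ : n%:R <= _))// ?ler_nat ?(ltnW (ltn_ord k))//.
  by rewrite lerDl.
by rewrite lerBlDr (le_trans _ (_ : n%:R <= _))// ?ler_nat ?(ltnW (ltn_ord l))// lerDl.
Qed.
End SingleBlock.

(** * The parameters of the example and its Besov norm *)

Section BesovMembership.
Context {R : realType}.
Local Notation C := R[i].

Lemma window_lipschitz (w : R -> R) : besov_window w ->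
  exists2 L : R, 0 <= L & forall x y, `|w x - w y| <= L * `|x - y|.
Proof.
move=> hw; have a2 := annular_window 1 hw.
have [_ _ [_ a1]] := a2; have [L hL] := @annular_bound R 0 _ a1.
have L0 : 0 <= L by exact: le_trans (normr_ge0 _) (hL 0).
exists L => // x y; wlog xy : x y / x < y.
  move=> th; have [h|h|->] := ltgtP x y; first exact: th.
    by rewrite distrC [`|x - y|]distrC; exact: th.
  by rewrite !subrr normr0 mulr0.
rewrite distrC [`|x - y|]distrC.
have [|c _ ->] := MVT xy (fun t _ => is_derive_annular t a2).
  by apply: continuous_subspaceT; exact: annular_continuous a2.
by rewrite normrM ler_wpM2r.
Qed.

Lemma norm2_near (xi : R * R) (P e : R) : 0 <= P -> `|xi.1 - P| <= e -> `|xi.2| <= e ->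
  `|norm2 xi - P| <= 2 * e.
Proof.
move=> P0 h1 h2; have n0 := norm2_ge0 xi; have ns := norm2_sqr xi.
have e0 : 0 <= e by exact: le_trans h2.
move: h1 h2; rewrite !ler_norml => /andP[a1 a2] /andP[b1 b2].
have up : norm2 xi <= P + 2 * e.
  rewrite -(@ler_pXn2r _ 2) ?nnegrE ?addr_ge0 ?mulr_ge0// ns.
  by have : 0 <= (P + e - xi.1) * (P + e + xi.1) \/ xi.1 < 0; nra.
have lo : xi.1 <= norm2 xi by have := coord2_le_norm2 false xi; rewrite /= ler_norml => /andP[].
by apply/andP; split; lra.
Qed.

Lemma trigpoly_split (mu : R * R -> R) l z (a : R) :
  trigpoly mu l z = a%:C * trigpoly (fun=> 1) l z + trigpoly (fun xi => mu xi - a) l z.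
Proof.
rewrite /trigpoly mulr_sumr -big_split/=; apply: eq_bigr => t _.
by rewrite rmorphB (_ : (1 : R)%:C = 1)//; ring.
Qed.

(** In the notation of the overview, [bdim], [carrier_exp], [carrier], [wgt] and [ampl] are N_m,
    q_m, 2^{q_m}, c_m and c_m 2^{-q_m}. *)
Definition bdim (m : nat) : nat := (2 ^ 4 ^ m.+2)%N.
Definition carrier_exp (m : nat) : nat := (4 * 4 ^ m.+2)%N.
Definition carrier (m : nat) : R := 2 ^+ carrier_exp m.
Definition wgt (m : nat) : R := 2^-1 ^+ m.
Definition ampl (m : nat) : R := wgt m / carrier m.

Lemma bdim_ge m : 64 <= (bdim m)%:R :> R.
Proof.
rewrite (_ : 64 = (2 ^ 6)%N%:R); last by rewrite natrX; ring.
rewrite ler_nat leq_exp2l// (@leq_trans (4 ^ 2)%N)//.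
by rewrite leq_exp2l.
Qed.

Lemma bdim_gt0 m : (0 < bdim m)%N. Proof. by rewrite expn_gt0. Qed.

Lemma carrier_bdim m : carrier m = (bdim m)%:R ^+ 4.
Proof. by rewrite /carrier /bdim /carrier_exp natrX -exprM mulnC. Qed.

Lemma bdim_succ m : (bdim m.+1)%:R = (bdim m)%:R ^+ 4 :> R.
Proof. by rewrite /bdim !natrX -exprM [(4 ^ m.+3)%N]expnS mulnC. Qed.

Lemma carrier_gt0 m : 0 < carrier m. Proof. by rewrite exprn_gt0. Qed.
Lemma wgt_gt0 m : 0 < wgt m. Proof. by rewrite exprn_gt0// invr_gt0. Qed.
Lemma ampl_gt0 m : 0 < ampl m. Proof. by rewrite divr_gt0 ?wgt_gt0 ?carrier_gt0. Qed.
Lemma ampl_ge0 m : 0 <= ampl m. Proof. exact: ltW (ampl_gt0 m). Qed.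

Lemma cvg_wgt : cvgn (series wgt).
Proof.
have := @is_cvg_geometric_series R 1 2^-1; rewrite ger0_norm// invf_lt1// ltr1n => /(_ isT).
rewrite (_ : geometric 1 2^-1 = wgt)//.
by apply/funext => m; rewrite /geometric /= mul1r.
Qed.

Definition lines m := block_seq (bdim m) (carrier m) (ampl m).

Lemma ampl_bdim_le m : ampl m * (bdim m)%:R <= wgt m.
Proof.
rewrite /ampl carrier_bdim -mulrA ler_piMr ?(ltW (wgt_gt0 m))//.
have := bdim_ge m; move: ((bdim m)%:R) => n hn.
by rewrite ler_pdivrMl ?exprn_gt0 ?mulr1 ?ler_eXnr//; lra.
Qed.

Lemma cvg_wiener_lines : cvgn (series (fun m => wiener_norm (lines m))).
Proof.
apply: (@summable_le _ _ wgt) cvg_wgt => m.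
by rewrite wiener_norm_ge0 wiener_block_seq ?bdim_gt0 ?ampl_ge0// ampl_bdim_le.
Qed.

Lemma pi_lt4 : pi < 4 :> R.
Proof. by have := pihalf_lt2 R; lra. Qed.

Lemma lines_freq m t : t \in lines m -> `|norm2 t.2 - carrier m| <= 2 * (16 * pi * (bdim m)%:R).
Proof.
by move=> /(block_seq_freq)[h1 h2]; apply: norm2_near => //; exact/ltW/carrier_gt0.
Qed.

Lemma lines_width m : 2 * (16 * pi * (bdim m)%:R) <= carrier m / 8.
Proof.
rewrite carrier_bdim; have := bdim_ge m; move: ((bdim m)%:R) => n hn; have := pi_lt4.
have : 0 <= pi :> R by exact: pi_ge0.
move: (pi : R) => p p0 p4.
have : 1024 * n <= n ^+ 4.
  have -> : n ^+ 4 = (n * n * n) * n by ring.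
  rewrite ler_wpM2r//; nra.
nra.
Qed.

Lemma lines_freq_ge2 m t : t \in lines m -> 2 <= norm2 t.2.
Proof.
move=> /lines_freq h; have := lines_width m.
have : 4 <= carrier m by rewrite carrier_bdim; have := bdim_ge m; move: ((bdim m)%:R) => n hn;
    apply: le_trans (_ : n <= _); [lra|rewrite ler_eXnr//; lra].
by move: h; rewrite ler_norml => /andP[h1 h2]; lra.
Qed.

(** The window is replaced by its value at the carrier, which leaves a multiple of the piece,
    bounded by its amplitude. The difference is estimated by the Lipschitz constant, the spread of
    frequencies and the Wiener norm, whose product is small against the carrier. If [n] is not
    adjacent to [carrier_exp m], the window vanishes at every frequency of the piece. *)
Lemma lines_blocks (w : R -> R) : besov_window w -> exists2 K : R, 0 <= K & forall m n z,
  2 ^ n * cabs (trigpoly (fun xi => w (norm2 xi / 2 ^ n)) (lines m) z) <=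
  if `|n - (carrier_exp m)%:Z| <= 1 then K * wgt m else 0.
Proof.
move=> hw; have [L L0 hL] := window_lipschitz hw.
(* The 2 comes from 2^n <= 2 [carrier m]; 128 is 32 * 4, with 32 from the frequency spread and
   [pi / bdim m ^+ 2] bounded by 4. *)
exists (2 + 128 * L); first by rewrite addr_ge0// mulr_ge0.
move=> m n z; have Pn0 : 0 < (2 : R) ^ n by rewrite exprz_gt0.
have PE : carrier m = 2 ^ (carrier_exp m)%:Z by [].
case: ifPn => [|].
  rewrite ler_norml => /andP[_ n1].
  have nP : (2 : R) ^ n <= 2 * carrier m.
    rewrite PE -[X in X * _]expr1z -expfzDr//; apply: ler_weXz2l; first by rewrite ler1n.
    by rewrite -lerBlDr.
  rewrite (trigpoly_split _ _ _ (w (carrier m / 2 ^ n))).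
  apply: le_trans (ler_wpM2l (ltW Pn0) (cabsD _ _)) _.
  rewrite mulrDr mulrDl; apply: lerD.
    rewrite cabsM cabs_real ger0_norm ?(window_ge0 hw)//.
    apply: le_trans (_ : 2 * carrier m * ampl m <= _); last by rewrite /ampl -mulrA [carrier m * _]mulrC mulfVK// gt_eqF// carrier_gt0.
    apply: ler_pM => //; first exact: ltW.
      by rewrite mulr_ge0 ?cabs_ge0 ?(window_ge0 hw).
    apply: le_trans (ler_piMl (cabs_ge0 _) (window_le1 hw _)) _.
    exact: cabs_trigpoly_block (bdim_gt0 m) (ampl_ge0 m) z.
  have b t : t \in lines m -> `|w (norm2 t.2 / 2 ^ n) - w (carrier m / 2 ^ n)| <=
      L * (2 * (16 * pi * (bdim m)%:R)) / 2 ^ n.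
    move=> /lines_freq ht; apply: le_trans (hL _ _) _.
    rewrite -mulrBl normrM [`|_^-1|]gtr0_norm ?invr_gt0// -[leRHS]mulrA.
    by rewrite ler_wpM2l// ler_wpM2r// invr_ge0 ltW.
  have := @trigpoly_le R (fun xi => w (norm2 xi / 2 ^ n) - w (carrier m / 2 ^ n)) (lines m) z _ b.
  rewrite wiener_block_seq ?bdim_gt0 ?ampl_ge0// => h.
  apply: le_trans (ler_wpM2l (ltW Pn0) h) _.
  rewrite -mulrA mulrCA [2 ^ n * _]mulrA mulfV ?gt_eqF// mul1r.
  rewrite /ampl carrier_bdim; have := bdim_ge m; move: ((bdim m)%:R) => k hk; have := wgt_gt0 m.
  have := pi_lt4; have := pi_ge0 R; move: (pi : R) (wgt m) => p c p0 p4 c0.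
  have k0 : 0 < k by lra.
  have -> : L * (2 * (16 * p * k)) * (c / k ^+ 4 * k) = (32 * L * c) * (p / k ^+ 2).
    by field; rewrite gt_eqF.
  have -> : 128 * L * c = (32 * L * c) * 4 by ring.
  apply: ler_wpM2l; first by rewrite !mulr_ge0// ltW.
  rewrite ler_pdivrMr ?exprn_gt0//; nra.
rewrite -ltNge => far.
rewrite /trigpoly big_seq big1 ?cabs0 ?mulr0// => t ts.
rewrite (window_out hw) ?mul0r ?mul0r//.
have := lines_freq ts; have := lines_width m; rewrite ler_norml => hw1 /andP[h1 h2].
have P0 := carrier_gt0 m; apply/negP => /andP[].
rewrite ltr_pdivlMr// ltr_pdivrMr// => k1 k2.
have [nq|nq] := leP (n : int) ((carrier_exp m)%:Z - 2).
  have : (2 : R) ^ n <= 2 ^ ((carrier_exp m)%:Z - 2) by apply: ler_weXz2l; rewrite ?ler1n.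
  rewrite expfzDr// -PE (_ : 2 ^ (- 2) = 4^-1 :> R); last first.
    by rewrite -exprnN; congr (_^-1); ring.
  move=> k3; lra.
have nq2 : (carrier_exp m)%:Z + 2 <= n.
  move: far nq; move: (carrier_exp m)%:Z => q; case: (lerP 0 (n - q)) => h.
    by rewrite ger0_norm//; lia.
  by rewrite ltr0_norm//; lia.
have : (2 : R) ^ ((carrier_exp m)%:Z + 2) <= 2 ^ n by apply: ler_weXz2l; rewrite ?ler1n.
rewrite expfzDr// -PE (_ : 2 ^ 2 = 4 :> R); last by rewrite -exprnP; ring.
move=> k3; lra.
Qed.

Lemma besov_example (w : R -> R) : besov_window w -> besov w (trigseries (fun=> 1) lines).
Proof.
move=> hw; have [K K0 hK] := lines_blocks hw.
exact: (@besov_trigseries R w lines (fun m => K * wgt m) (fun m => (carrier_exp m)%:Z) hw cvg_wiener_lines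
  lines_freq_ge2 (cvg_series_scale K cvg_wgt).1 hK).
Qed.
End BesovMembership.

(** * Nodes, the half-period shift, and sums over other pieces *)

Section Nodes.
Context {R : realType}.
Local Notation C := R[i].

(** The nodes fill [5/8, 3/4] and the shift is at most 1/8, so everything stays in [5/8, 7/8]. The
    square over this interval lies inside the annulus where the bump is 1, and the operators are
    contractions. *)
Definition node1 (b : nat) (i : 'I_(bdim b)) : R := 5 / 8 + i%:R / (8 * (bdim b)%:R).
Definition shift (b : nat) : R := pi / carrier b.
Definition node2 (b : nat) (i : 'I_(bdim b)) : R := node1 i + shift b.

Lemma bdimR_gt0 b : 0 < (bdim b)%:R :> R. Proof. by rewrite ltr0n bdim_gt0. Qed.

Lemma bdim_ge128 b : 128 <= (bdim b)%:R :> R.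
Proof.
rewrite (_ : 128 = (2 ^ 7)%N%:R); last by rewrite natrX; ring.
by rewrite ler_nat leq_exp2l// (@leq_trans (4 ^ 2)%N)// leq_exp2l.
Qed.

Lemma bdim_le_carrier b : (bdim b)%:R <= carrier b :> R.
Proof. by rewrite carrier_bdim ler_eXnr//; have := bdim_ge (R:=R) b; lra. Qed.

Lemma shift_bounds b : 0 < shift b <= 1 / 8.
Proof.
have P0 := carrier_gt0 (R:=R) b; rewrite /shift divr_gt0 ?pi_gt0//= ler_pdivrMr//.
by have := bdim_ge (R:=R) b; have := bdim_le_carrier b; have := pi_lt4 (R:=R); lra.
Qed.

Lemma node1_bounds b (i : 'I_(bdim b)) : 5 / 8 <= node1 i <= 3 / 4.
Proof.
have n0 := bdimR_gt0 b; rewrite /node1 lerDl divr_ge0 ?mulr_ge0//=.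
have : i%:R / (8 * (bdim b)%:R) <= 1 / 8 :> R.
  rewrite ler_pdivrMr ?mulr_gt0// mulrA (_ : 1 / 8 * 8 = 1 :> R) ?mul1r; last by field.
  by rewrite ler_nat ltnW.
lra.
Qed.

Lemma node1_range b (i : 'I_(bdim b)) : 5 / 8 <= node1 i <= 7 / 8.
Proof. by have /andP[] := node1_bounds i; lra. Qed.

Lemma node2_range b (i : 'I_(bdim b)) : 5 / 8 <= node2 i <= 7 / 8.
Proof.
have /andP[h1 h2] := node1_bounds i; have /andP[h3 h4] := shift_bounds b.
by rewrite /node2; apply/andP; split; lra.
Qed.

Lemma node1_le1 b (i : 'I_(bdim b)) : `|node1 i| <= 1.
Proof. by have /andP[h1 h2] := node1_range i; rewrite ger0_norm; lra. Qed.

Lemma node2_le1 b (i : 'I_(bdim b)) : `|node2 i| <= 1.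
Proof. by have /andP[h1 h2] := node2_range i; rewrite ger0_norm; lra. Qed.

Lemma norm2_range (z : R * R) : 5 / 8 <= z.1 <= 7 / 8 -> 5 / 8 <= z.2 <= 7 / 8 ->
  2^-1 < norm2 z < 2.
Proof.
move=> /andP[h1 h2] /andP[h3 h4]; have ns := norm2_sqr z; have n0 := norm2_ge0 z.
by apply/andP; split; nra.
Qed.

Lemma cis_lipschitz (a b : R) : cabs (cis a - cis b) <= 2 * `|a - b|.
Proof.
rewrite (le_trans (cabs_le_ReIm _))// mulrDl mul1r ReD ReN ImD ImN /=.
have gen (f df : R -> R) : (forall x, is_derive x (1 : R) f (df x)) ->
    (forall x, `|df x| <= 1) -> forall x y, `|f x - f y| <= `|x - y|.
  move=> hf hd x y; wlog xy : x y / y < x.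
    move=> th; have [h|h|->] := ltgtP x y; last by rewrite !subrr.
      by rewrite distrC [leRHS]distrC; exact: th.
    exact: th.
  have [|c _ ->] := MVT xy (fun t _ => hf t).
    by apply: continuous_subspaceT => t; apply/differentiable_continuous/derivable1_diffP; exact: ex_derive.
  by rewrite normrM ler_piMl.
apply: lerD.
  by apply: (gen cos (fun x => - sin x)) => x; rewrite normrN; exact: norm_sin_le1.
by apply: (gen sin cos) => x; exact: norm_cos_le1.
Qed.

(** The ratio 1/17 is chosen because the geometric tail is then 1/16 of the last term kept, as in
    [tail_ampl]. *)
Lemma ampl_succ m : ampl m.+1 <= ampl m / 17 :> R.
Proof.
have -> : ampl m.+1 = ampl m * (2^-1 / (bdim m)%:R ^+ 12) :> R.
  rewrite /ampl !carrier_bdim bdim_succ /wgt exprS; have := bdimR_gt0 m; move: ((bdim m)%:R) => n n0.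
  by field; rewrite gt_eqF.
rewrite ler_pM2l ?ampl_gt0//; have := bdim_ge (R:=R) m; move: ((bdim m)%:R : R) => n hn.
have n0 : 0 < n by lra.
rewrite ler_pdivrMr ?exprn_gt0//.
have : n <= n ^+ 12 by rewrite ler_eXnr//; lra.
lra.
Qed.

Lemma cvg_ampl : cvgn (series (ampl : nat -> R)).
Proof.
apply: (@summable_le _ _ wgt) cvg_wgt => m; rewrite ampl_ge0.
rewrite /ampl ler_pdivrMr ?carrier_gt0// ler_peMr ?(ltW (wgt_gt0 m))//.
by apply: le_trans (bdim_le_carrier m); have := bdim_ge (R:=R) m; lra.
Qed.

Lemma tail_ampl M : tail (ampl : nat -> R) M.+1 <= ampl M / 16.
Proof.
rewrite /tail lerBlDr addrC; apply: limr_le; first exact: cvg_ampl.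
have step n : series ampl n.+2 + ampl n.+1 / 16 <= series (ampl : nat -> R) n.+1 + ampl n / 16.
  rewrite [in leLHS]/series /= big_nat_recr//= -/(series ampl n.+1).
  by have := ampl_succ n; have := ampl_gt0 (R:=R) n; rewrite /series /=; lra.
have main k : series ampl (M + k).+1 + ampl (M + k) / 16 <= series (ampl : nat -> R) M.+1 + ampl M / 16.
  elim: k => [|k IH]; first by rewrite addn0.
  by rewrite addnS; exact: le_trans (step _) IH.
exists M.+1 => // n /= Mn; have := main (n - M.+1)%N.
rewrite -addSn subnKC//; apply: le_trans.
by rewrite lerDl divr_ge0 ?ampl_ge0.
Qed.

(** Here the growth of the dimensions is spent: the root of the next dimension is the square of the
    current one and absorbs the new linear term. The constant 32 is 2 * 4 * 4, so that with pi < 4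
    the lower pieces cost at most half of the main amplitude in [block_lower]. *)
Lemma sum_wgt_bdim M : 32 * \sum_(0 <= m < M) wgt m * (bdim m)%:R <= wgt M * Num.sqrt (bdim M)%:R :> R.
Proof.
elim: M => [|M IH].
  by rewrite big_geq// mulr0 mulr_ge0 ?sqrtr_ge0// ltW ?wgt_gt0.
rewrite big_nat_recr//= bdim_succ (_ : (bdim M)%:R ^+ 4 = ((bdim M)%:R ^+ 2) ^+ 2 :> R); last by rewrite -exprM.
rewrite sqrtr_sqr ger0_norm ?sqr_ge0//.
have h : Num.sqrt (bdim M)%:R <= (bdim M)%:R :> R.
  rewrite -(@ler_pXn2r _ 2) ?nnegrE ?sqrtr_ge0// sqr_sqrtr// ler_eXnr//.
  by have := bdim_ge (R:=R) M; lra.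
have -> : wgt M.+1 = wgt M / 2 :> R by rewrite /wgt exprS mulrC.
have := bdim_ge128 M; have c0 := wgt_gt0 (R:=R) M.
have alg (S q n c : R) : 0 < c -> 32 * S <= c * q -> q <= n -> 128 <= n ->
    32 * (S + c * n) <= c / 2 * n ^+ 2.
  move=> {}c0 {}IH {}h hn; have : c * q <= c * n by rewrite ler_wpM2l// ltW.
  have : c * (128 * n) <= c * (n * n) by rewrite ler_pM2l// ler_wpM2r//; lra.
  have : 0 <= c * n by rewrite mulr_ge0 ?ltW//; lra.
  by rewrite expr2; lra.
by move=> hn; apply: (alg _ (Num.sqrt (bdim M)%:R)).
Qed.
End Nodes.

(** * The difference of the functions on one block *)

Section LowerBound.
Context {R : realType}.
Local Notation C := R[i].

Definition piece (m : nat) (z : R * R) : C := trigpoly (fun=> 1) (lines m) z.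

(** This is the zeroth coordinate vector, written through its coordinates in the eigenbasis of B,
    all of which equal n^{-1/2}. On it the interpolated symbol produces no cancellation. *)
Definition probe (n : nat) : 'cV[C]_n := dft n *m const_mx (Num.sqrt n%:R)^-1%:C.

Lemma sqn_probe n : (0 < n)%N -> sqn (probe n) = 1.
Proof.
move=> n0; have nR : 0 < n%:R :> R by rewrite ltr0n.
rewrite /probe sqn_isometry ?dft_unitary// /sqn.
under eq_bigr do rewrite big_ord1 mxE cabs_real.
rewrite sumr_const card_ord ger0_norm ?invr_ge0 ?sqrtr_ge0// exprVn sqr_sqrtr ?ltW//.
by rewrite -(mulr_natr (n%:R^-1) n) mulVf// gt_eqF.
Qed.

Lemma gmx_probe n (G : 'I_n -> 'I_n -> C) i : (gmx (dft n) G *m probe n) i 0 =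
  \sum_l G i l * (n%:R^-1%:C * cis (i%:R * (2 * pi * l%:R / n%:R))).
Proof.
have nR : 0 < n%:R :> R by rewrite ltr0n (leq_trans _ (ltn_ord i)).
rewrite gmx_mul; apply: eq_bigr => l _; congr (_ * _).
rewrite /probe mulmxA dft_unitary mul1mx !mxE mulrAC -rmorphM -invfM -expr2 sqr_sqrtr//.
Qed.

(** Each coordinate of the image is an average over [l] of symbol values times unimodular numbers.
    Uniformly small errors in the symbol therefore stay small in every coordinate. *)
Lemma gmx_probe_le n (G : 'I_n -> 'I_n -> C) (B : R) i : (forall l, cabs (G i l) <= B) ->
  cabs ((gmx (dft n) G *m probe n) i 0) <= B.
Proof.
move=> GB; have nR : 0 < n%:R :> R by rewrite ltr0n (leq_trans _ (ltn_ord i)).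
rewrite gmx_probe (le_trans (cabs_sum _ _ _))//.
apply: (@le_trans _ _ (\sum_(l < n) B / n%:R)).
  apply: ler_sum => l _; rewrite !cabsM cabs_cis mulr1 cabs_real ger0_norm ?invr_ge0 ?(ltW nR)//.
  by rewrite ler_wpM2r ?invr_ge0 ?(ltW nR).
by rewrite sumr_const card_ord -(mulr_natr (B / _) n) mulfVK// gt_eqF.
Qed.

Lemma gmxD n (U : 'M[C]_n) (G1 G2 : 'I_n -> 'I_n -> C) :
  gmx U (fun i l => G1 i l + G2 i l) = gmx U G1 + gmx U G2.
Proof.
apply/matrixP => i k; rewrite !mxE -big_split/=; apply: eq_bigr => l _; ring.
Qed.

Lemma gmxN n (U : 'M[C]_n) (G : 'I_n -> 'I_n -> C) : gmx U (fun i l => - G i l) = - gmx U G.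
Proof.
apply/matrixP => i k; rewrite !mxE -sumrN; apply: eq_bigr => l _; ring.
Qed.

Lemma gmx_sum n (U : 'M[C]_n) (I : Type) (s : seq I) (a : I -> C) (G : I -> 'I_n -> 'I_n -> C) :
  gmx U (fun i l => \sum_(t <- s) a t * G t i l) = \sum_(t <- s) a t *: gmx U (G t).
Proof.
elim: s => [|t s IH].
  rewrite big_nil; apply/matrixP => i k; rewrite !mxE big1// => l _.
  by rewrite big_nil !mul0r.
rewrite big_cons -IH; apply/matrixP => i k; rewrite !mxE mulr_sumr -big_split/=.
by apply: eq_bigr => l _; rewrite big_cons; ring.
Qed.

Lemma lines_freq1 m t : t \in (lines m : seq (C * (R * R))) -> `|t.2.1| <= 2 * carrier m.
Proof.
move=> ts; have [h _] := block_seq_freq ts; have := lines_width (R:=R) m.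
have P0 := carrier_gt0 (R:=R) m; have := pi_ge0 R; have := bdimR_gt0 (R:=R) m.
move: h; rewrite !ler_norml => /andP[h1 h2] n0 p0 hw; apply/andP; split; lra.
Qed.

(** Each exponential in two variables is a product of diagonal operators, one of them of size
    [carrier m * shift M], so the norm is controlled by the Wiener norm. A coordinatewise bound
    would lose the root of [bdim M], which is the whole gain. *)
Lemma piece_shift_norm m M : Num.sqrt (sqn (gmx (dft (bdim M))
    (fun i l => piece m (node1 i, node1 l) - piece m (node2 i, node1 l)) *m probe (bdim M))) <=
  4 * shift M * (wgt m * (bdim m)%:R).
Proof.
set n := bdim M; pose D (xi : R * R) := (\row_(i < n) (cis (xi.1 * node1 i) - cis (xi.1 * node2 i)) : 'rV[C]_n).
pose E (xi : R * R) := (\row_(l < n) cis (xi.2 * node1 l) : 'rV[C]_n).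
have s0 : 0 < shift M :> R by have /andP[] := shift_bounds (R:=R) M.
have -> : gmx (dft n) (fun i l => piece m (node1 i, node1 l) - piece m (node2 i, node1 l)) =
    \sum_(t <- lines m) t.1 *: (spm 1%:M (D t.2) *m spm (dft n) (E t.2)).
  under [RHS]eq_bigr do rewrite spm_mul_gmx.
  rewrite -gmx_sum; congr gmx; apply/funext => i; apply/funext => l.
  rewrite /piece /trigpoly -sumrB; apply: eq_bigr => t _.
  rewrite !mxE (_ : (1 : R)%:C = 1)// mul1r /dot2 /= !cisD; ring.
rewrite mulmx_suml (le_trans (sqrt_sqn_sum _ _))//.
apply: (@le_trans _ _ (\sum_(t <- lines m) cabs t.1 * (4 * carrier m * shift M))).
  rewrite big_seq [leRHS]big_seq; apply: ler_sum => t /lines_freq1 ht.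
  have K0 : (0 : R) <= 4 * carrier m * shift M.
    by apply: mulr_ge0; [apply: mulr_ge0 => //; exact/ltW/carrier_gt0|exact: ltW].
  rewrite -scalemxAl sqnZ sqrtrM ?sqr_ge0// sqrtr_sqr ger0_norm ?cabs_ge0//.
  rewrite ler_wpM2l ?cabs_ge0// -(@ler_pXn2r _ 2) ?nnegrE ?sqrtr_ge0// sqr_sqrtr ?sqn_ge0//.
  rewrite -mulmxA; apply: le_trans (@sqn_spm _ _ _ _ _ _ (4 * carrier m * shift M) _ _) _.
  - by rewrite mulmx1 /adjm map_mx1 trmx1.
  - move=> i; rewrite mxE (le_trans (cis_lipschitz _ _))// -mulrBr normrM.
    rewrite /node2 opprD addrA subrr sub0r normrN (gtr0_norm s0) [leLHS]mulrA ler_wpM2r ?(ltW s0)//.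
    lra.
  rewrite ler_piMr ?sqr_ge0//.
  apply: le_trans (@sqn_spm _ _ _ _ _ _ 1 (dft_unitary n) _) _.
    by move=> i; rewrite mxE cabs_cis.
  by rewrite sqn_probe ?bdim_gt0// expr1n mul1r.
rewrite -mulr_suml -/(wiener_norm _) wiener_block_seq ?bdim_gt0 ?ampl_ge0//.
have P0 := carrier_gt0 (R:=R) m; rewrite /ampl le_eqVlt; apply/orP; left; apply/eqP.
by field; rewrite gt_eqF.
Qed.

(* The shift is half a period of the carrier; the deviation of the other frequencies from
   the carrier is too small to matter. *)
Lemma piece_antiperiodic M x y : cabs (piece M (x + shift M, y) + piece M (x, y)) <= ampl M / 8.
Proof.
have P0 := carrier_gt0 (R:=R) M; have s0 : 0 < shift M :> R by have /andP[] := shift_bounds (R:=R) M.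
have Pd : carrier M * shift M = pi :> R by rewrite /shift mulrC mulfVK// gt_eqF.
have cpi : cis (carrier M * shift M) = -1 :> C.
  by rewrite Pd /cis cospi sinpi; apply: complexP => /=; rewrite ?oppr0.
have -> : piece M (x + shift M, y) + piece M (x, y) = \sum_(t <- lines M)
    t.1 * (cis (dot2 t.2 (x, y)) * (cis (t.2.1 * shift M) - cis (carrier M * shift M))).
  rewrite /piece /trigpoly -big_split/=; apply: eq_bigr => t _.
  rewrite (_ : (1 : R)%:C = 1)// mul1r cpi opprK.
  rewrite (_ : dot2 t.2 (x + shift M, y) = dot2 t.2 (x, y) + t.2.1 * shift M); last by rewrite /dot2 /=; ring.
  by rewrite cisD; ring.
rewrite (le_trans (cabs_sum _ _ _))//.
apply: (@le_trans _ _ (\sum_(t <- lines M) cabs t.1 * (2 * (16 * pi * (bdim M)%:R) * shift M))).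
  rewrite big_seq [leRHS]big_seq; apply: ler_sum => t /block_seq_freq[ht _].
  rewrite !cabsM cabs_cis mul1r ler_wpM2l ?cabs_ge0// (le_trans (cis_lipschitz _ _))//.
  by rewrite -mulrBl normrM (gtr0_norm s0) -[leRHS]mulrA ler_wpM2l// ler_wpM2r// ltW.
rewrite -mulr_suml -/(wiener_norm _) wiener_block_seq ?bdim_gt0 ?ampl_ge0//.
rewrite /shift carrier_bdim; have n0 := bdimR_gt0 (R:=R) M; have := bdim_ge (R:=R) M.
move: ((bdim M)%:R : R) n0 => n n0 hn; have := pi_ge0 R; have := pi_lt4 (R:=R).
move: (pi : R) => p p4 p0.
have -> : ampl M * n * (2 * (16 * p * n) * (p / n ^+ 4)) = ampl M * (32 * p ^+ 2 / n ^+ 2).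
  by field; rewrite gt_eqF.
rewrite ler_wpM2l ?ampl_ge0// ler_pdivrMr ?exprn_gt0//.
have : p ^+ 2 <= 16 by rewrite expr2; nra.
have : 4096 <= n ^+ 2 by rewrite expr2; nra.
lra.
Qed.

Let f := trigseries (fun=> 1) (lines : nat -> seq (C * (R * R))).

Lemma symbol_tail M (z : R * R) : cabs (f z - \sum_(0 <= m < M.+1) piece m z) <= ampl M / 8.
Proof.
have := @csum_tail _ (fun m => piece m z) (ampl : nat -> R) M.+1 _ cvg_ampl.
rewrite -/(trigseries _ _ z) => h; apply: le_trans (h _) _.
  by move=> m; apply: cabs_trigpoly_block; [exact: bdim_gt0|exact: ampl_ge0].
by have := tail_ampl (R:=R) M; lra.
Qed.

(* The [M]-th piece contributes twice its amplitude to every coordinate. The lower pieces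
   are Lipschitz with a constant given by their Wiener norm; the higher ones are bounded
   uniformly. *)
Lemma block_lower M : ampl M ^+ 2 * (bdim M)%:R <= sqn (gmx (dft (bdim M))
    (fun i l => f (node1 i, node1 l) - f (node2 i, node1 l)) *m probe (bdim M)).
Proof.
set n := bdim M; have a0 := ampl_gt0 (R:=R) M; have n0 := bdimR_gt0 (R:=R) M.
pose F m (i l : 'I_n) := piece m (node1 i, node1 l) - piece m (node2 i, node1 l).
pose G (i l : 'I_n) := f (node1 i, node1 l) - f (node2 i, node1 l).
pose Main (i l : 'I_n) := G i l - \sum_(0 <= m < M) 1 * F m i l.
have MainE : gmx (dft n) Main *m probe n =
    gmx (dft n) G *m probe n + (- \sum_(0 <= m < M) gmx (dft n) (F m) *m probe n).
  rewrite -mulmx_suml -mulmxBl; congr (_ *m _).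
  have -> : \sum_(0 <= m < M) gmx (dft n) (F m) = gmx (dft n) (fun i l => \sum_(0 <= m < M) 1 * F m i l).
    by rewrite gmx_sum; apply: eq_bigr => m _; rewrite scale1r.
  by rewrite -gmxN -gmxD.
(* The main term has modulus 2 [ampl M]. The errors are 1/8 for each of the two tails and 1/8 for
   the imperfect sign change, and 2 - 3/8 exceeds 3/2. *)
have coord i : 3 / 2 * ampl M <= cabs ((gmx (dft n) Main *m probe n) i 0).
  pose T0 (i l : 'I_n) := 2 * piece M (node1 i, node1 l).
  pose E (i l : 'I_n) := Main i l - T0 i l.
  have -> : gmx (dft n) Main *m probe n = gmx (dft n) T0 *m probe n + gmx (dft n) E *m probe n.
    rewrite -mulmxDl -gmxD; congr (gmx _ _ *m _); apply/funext => j; apply/funext => l.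
    by rewrite /E addrC subrK.
  have hE : cabs ((gmx (dft n) E *m probe n) i 0) <= 3 / 8 * ampl M.
    apply: gmx_probe_le => l.
    have -> : E i l = (f (node1 i, node1 l) - \sum_(0 <= m < M.+1) piece m (node1 i, node1 l)) +
       (- (f (node2 i, node1 l) - \sum_(0 <= m < M.+1) piece m (node2 i, node1 l)) +
        - (piece M (node1 i + shift M, node1 l) + piece M (node1 i, node1 l))).
      rewrite /E /Main /G /T0 /F.
      under eq_bigr do rewrite mul1r.
      by rewrite sumrB !big_nat_recr//= -/(node2 i); ring.
    have h1 := symbol_tail M (node1 i, node1 l); have h2 := symbol_tail M (node2 i, node1 l).
    have h3 := piece_antiperiodic M (node1 i) (node1 l).
    apply: le_trans (cabsD _ _) _; rewrite (_ : 3 / 8 * ampl M = ampl M / 8 + (ampl M / 8 + ampl M / 8)); last by lra.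
    apply: lerD => //; apply: le_trans (cabsD _ _) _; rewrite !cabsN; exact: lerD.
  (* The phase of the symbol at the nodes and the phase in [gmx_probe] are conjugate in [l], so all
     [n] summands coincide. *)
  have hT : cabs ((gmx (dft n) T0 *m probe n) i 0) = 2 * ampl M.
    have -> : (gmx (dft n) T0 *m probe n) i 0 = (2 * ampl M)%:C * cis (carrier M * node1 i).
      rewrite gmx_probe (eq_bigr (fun=> ((2 * ampl M) * n%:R^-1)%:C * cis (carrier M * node1 i))) => [|l _].
        rewrite sumr_const card_ord -mulrnAl -rmorphMn.
        by rewrite -(mulr_natr (2 * ampl M / n%:R) n) mulfVK// gt_eqF.
      rewrite /T0 /piece /lines /node1 trigpoly_block_node ?bdim_gt0// -/(node1 l) -/(node1 i).
      have -> : (2 * ampl M / n%:R)%:C = 2 * (ampl M)%:C * (n%:R^-1)%:C :> C by rewrite !rmorphM rmorph_nat.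
      rewrite -!mulrA; congr (_ * (_ * _)); rewrite mulrCA; congr (_ * _); rewrite -cisD; congr cis.
      by rewrite -/n /node1; field; rewrite gt_eqF.
    by rewrite cabsM cabs_cis mulr1 cabs_real ger0_norm// mulr_ge0// ltW.
  have tri (a b : C) : cabs a <= cabs (a + b) + cabs b.
    by have := cabsD (a + b) (- b); rewrite addrK cabsN.
  have := tri ((gmx (dft n) T0 *m probe n) i 0) ((gmx (dft n) E *m probe n) i 0).
  rewrite [in X in _ -> X]mxE hT; lra.
have hM : 3 / 2 * ampl M * Num.sqrt n%:R <= Num.sqrt (sqn (gmx (dft n) Main *m probe n)).
  have A0 : (0 : R) <= 3 / 2 * ampl M by lra.
  have B0 : (0 : R) <= 3 / 2 * ampl M * Num.sqrt n%:R := mulr_ge0 A0 (sqrtr_ge0 _).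
  rewrite -(@ler_pXn2r _ 2) ?nnegrE ?sqrtr_ge0// [leRHS]sqr_sqrtr ?sqn_ge0//.
  rewrite exprMn sqr_sqrtr ?(ltW n0)// mulr_natr -[X in _ *+ X]card_ord -sumr_const /sqn.
  by apply: ler_sum => i _; rewrite big_ord1 lerXn2r ?nnegrE ?cabs_ge0.
(* The lower pieces may take away 1/2, which leaves 3/2 - 1/2 = 1 amplitude. *)
have hF : \sum_(0 <= m < M) Num.sqrt (sqn (gmx (dft n) (F m) *m probe n)) <= ampl M / 2 * Num.sqrt n%:R.
  apply: (@le_trans _ _ (\sum_(0 <= m < M) 4 * shift M * (wgt m * (bdim m)%:R))).
    by apply: ler_sum => m _; exact: piece_shift_norm.
  have S0 : (0 : R) <= \sum_(0 <= m < M) wgt m * (bdim m)%:R.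
    by apply: sumr_ge0 => m _; rewrite mulr_ge0// ltW// wgt_gt0.
  rewrite -mulr_sumr; have := sum_wgt_bdim (R:=R) M; move: S0.
  have P0 := carrier_gt0 (R:=R) M; have -> : ampl M = wgt M / carrier M :> R by [].
  rewrite /shift -/n; move: (\sum_(0 <= m < M) _) (Num.sqrt _) => S q S0 h.
  have c0 := wgt_gt0 (R:=R) M.
  have -> : 4 * (pi / carrier M) * S = (4 * pi * S) / carrier M by ring.
  have -> : wgt M / carrier M / 2 * q = (wgt M * q / 2) / carrier M by ring.
  rewrite ler_wpM2r ?invr_ge0 ?(ltW P0)//.
  have := pi_lt4 (R:=R); have := pi_ge0 R; move: h; move: (wgt M * q) (pi : R) => u p h p0 p4.
  have : p * S <= 4 * S by rewrite ler_wpM2r// ltW.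
  lra.
have key : ampl M * Num.sqrt n%:R <= Num.sqrt (sqn (gmx (dft n) G *m probe n)).
  have alg (x z u v : R) : 3 / 2 * u * v <= x + z -> z <= u / 2 * v -> u * v <= x by lra.
  have h1 := hM; rewrite MainE in h1.
  have h2 := le_trans h1 (sqrt_sqnD _ _); rewrite sqnN in h2.
  have h3 := le_trans (sqrt_sqn_sum (index_iota 0 M) (fun m => gmx (dft n) (F m) *m probe n)) hF.
  exact: alg h2 h3.
have C0 : (0 : R) <= ampl M * Num.sqrt n%:R := mulr_ge0 (ltW a0) (sqrtr_ge0 _).
have := key; rewrite -(@ler_pXn2r _ 2) ?nnegrE ?sqrtr_ge0//.
by rewrite exprMn !sqr_sqrtr ?sqn_ge0 ?(ltW n0).
Qed.
End LowerBound.

(** * Choice of the multiplicities *)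

Section Multiplicity.
Context {R : realType}.
Variable p : R.
Hypothesis hp : 2 < p.

Definition mult (b : nat) : nat :=
  (Num.truncn (carrier b `^ p / ((bdim b)%:R * 2 ^+ b) : R)).+1.

Let p0 : 0 <= p. Proof. by apply: ltW; apply: lt_trans hp. Qed.

Lemma two_pow_le_bdim b : 2 ^+ b <= (bdim b)%:R :> R.
Proof.
rewrite -natrX ler_nat /bdim leq_exp2l// (@leq_trans (4 ^ b)%N)//.
  by rewrite ltnW// ltn_expl.
by rewrite leq_exp2l// !leqW.
Qed.

Lemma shift_powR b : shift b `^ p * carrier b `^ p = pi `^ p :> R.
Proof.
have P0 := carrier_gt0 (R:=R) b; have /andP[s0 _] := shift_bounds (R:=R) b.
by rewrite -powRM ?(ltW P0) ?(ltW s0)// /shift mulfVK// gt_eqF.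
Qed.

Lemma mult_shift_le b : (bdim b * mult b)%:R * shift b `^ p <= pi `^ p * 2 * wgt b :> R.
Proof.
have n0 := bdimR_gt0 (R:=R) b; have P0 := carrier_gt0 (R:=R) b.
have t0 : 0 < (2 : R) ^+ b by rewrite exprn_gt0.
have X0 : 0 < (carrier b : R) `^ p by rewrite powR_gt0.
(* Rounding up in [mult] adds at most [bdim b] to the dimension, which this bound absorbs: carrier^p
   >= carrier^2 >= [bdim b] * 2^b, since p > 2. *)
have nX : (bdim b)%:R <= carrier b `^ p / 2 ^+ b :> R.
  rewrite ler_pdivlMr//; apply: (@le_trans _ _ (carrier b `^ 2%:R)); last first.
    rewrite ler_powR ?(ltW hp)//; apply: le_trans (bdim_le_carrier b).
    by have := bdim_ge (R:=R) b; lra.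
  rewrite powR_mulrn ?(ltW P0)// expr2; apply: ler_pM; rewrite ?(ltW n0) ?(ltW t0) ?bdim_le_carrier//.
  exact: le_trans (two_pow_le_bdim b) (bdim_le_carrier b).
have rX : (mult b)%:R <= carrier b `^ p / ((bdim b)%:R * 2 ^+ b) + 1 :> R.
  by rewrite /mult -natr1 lerD2r truncn_le divr_ge0 ?mulr_ge0 ?powR_ge0 ?(ltW n0) ?(ltW t0).
have h : (bdim b * mult b)%:R <= 2 * (carrier b `^ p / 2 ^+ b) :> R.
  rewrite natrM; apply: le_trans (ler_wpM2l (ltW n0) rX) _.
  have -> : (bdim b)%:R * (carrier b `^ p / ((bdim b)%:R * 2 ^+ b) + 1) = carrier b `^ p / 2 ^+ b + (bdim b)%:R :> R.
    by field; rewrite !gt_eqF.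
  by rewrite mulr_natl mulr2n lerD2l.
apply: le_trans (ler_wpM2r (powR_ge0 _ _) h) _.
rewrite -(shift_powR b) /wgt exprVn le_eqVlt; apply/orP; left; apply/eqP; ring.
Qed.

Lemma sum_shift_powR n :
  \sum_(0 <= b < n) (bdim b * mult b)%:R * shift b `^ p <= pi `^ p * 4 :> R.
Proof.
apply: (@le_trans _ _ (\sum_(0 <= b < n) pi `^ p * 2 * wgt b)).
  by apply: ler_sum => b _; exact: mult_shift_le.
rewrite -mulr_sumr (_ : pi `^ p * 4 = pi `^ p * 2 * 2); last by ring.
rewrite ler_wpM2l ?mulr_ge0 ?powR_ge0//.
have -> : \sum_(0 <= b < n) wgt b = 2 - 2 * wgt n :> R.
  elim: n => [|n IH]; first by rewrite big_geq// /wgt expr0; ring.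
  by rewrite big_nat_recr//= IH /wgt exprS; field.
by rewrite gerBl mulr_ge0// ltW// wgt_gt0.
Qed.

Lemma mult_unbounded (B : R) : exists b,
  B < (mult b)%:R * (ampl b * Num.sqrt (bdim b)%:R) `^ p.
Proof.
(* The exponent of [bdim b] that survives: p / 2 from the norm of the difference, less 1 from the
   denominator of [mult]. *)
pose k : R := p / 2 - 1; have k0 : (0 : R) < k.
  by rewrite subr_gt0 ltr_pdivlMr// mul1r.
(* The first summand gives p + 2 <= b k, hence 2^{b (p + 2)} <= 2^{b^2 k} <= [bdim b] to the power
   [k]. The product is then at least 2^b, and the second summand makes b exceed [B]. *)
pose b := ((Num.truncn ((p + 2) / k)).+1 + (Num.truncn B).+1)%N; exists b.
have n0 := bdimR_gt0 (R:=R) b; have P0 := carrier_gt0 (R:=R) b; have c0 := wgt_gt0 (R:=R) b.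
have t0 : 0 < (2 : R) ^+ b by rewrite exprn_gt0.
have X0 : 0 < (carrier b : R) `^ p by rewrite powR_gt0.
have a0 := ampl_gt0 (R:=R) b.
have bk : (p + 2) / k <= b%:R.
  rewrite /b natrD; apply: le_trans (ltW (truncnS_gt _)) _.
  by rewrite lerDl.
have bB : B < b%:R.
  rewrite /b natrD; apply: lt_le_trans (truncnS_gt _) _.
  by rewrite lerDr.
have Npow : (2 ^+ b) `^ p * (2 ^+ b) ^+ 2 <= (bdim b)%:R `^ k :> R.
  have -> : (bdim b)%:R = 2 `^ (4 ^ b.+2)%:R :> R by rewrite powR_mulrn// natrX.
  have -> : (2 : R) ^+ b = 2 `^ b%:R by rewrite powR_mulrn.
  rewrite -(powR_mulrn _ (powR_ge0 _ _)) -!powRrM -powRD; last by rewrite pnatr_eq0 implybT.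
  rewrite ler_powR ?ler1n// -mulrDr.
  have h1 : (b%:R * b%:R : R) <= (4 ^ b.+2)%:R.
    rewrite -natrM ler_nat (_ : 4 = 2 * 2)%N// expnMn.
    by apply: leq_mul; rewrite (@leq_trans b.+2)// ltnW// ltn_expl.
  move: bk; rewrite ler_pdivrMr// => bk.
  apply: le_trans (_ : b%:R * b%:R * k <= _); last by rewrite ler_pM2r.
  by rewrite -mulrA ler_wpM2l.
have mX : carrier b `^ p / ((bdim b)%:R * 2 ^+ b) <= (mult b)%:R :> R by rewrite ltW// truncnS_gt.
have cE : (2 ^+ b) `^ p * wgt b `^ p = 1 :> R.
  by rewrite -powRM ?(ltW t0) ?(ltW c0)// /wgt exprVn mulfV ?gt_eqF// powR1.
have sqE : Num.sqrt (bdim b)%:R `^ p = (bdim b)%:R * (bdim b)%:R `^ k :> R.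
  rewrite -powR12_sqrt ?(ltW n0)// -powRrM -[X in _ = X * _](powRr1 (ltW n0)) -powRD.
    by congr (_ `^ _); rewrite /k; field.
  by rewrite (gt_eqF n0) implybT.
have aE : ampl b `^ p * carrier b `^ p = wgt b `^ p :> R.
  by rewrite -powRM ?(ltW a0) ?(ltW P0)// /ampl mulfVK// gt_eqF.
rewrite powRM ?(ltW a0) ?sqrtr_ge0// sqE.
apply: lt_le_trans (ler_wpM2r _ mX); last by rewrite !mulr_ge0 ?powR_ge0 ?(ltW n0).
have -> : carrier b `^ p / ((bdim b)%:R * 2 ^+ b) * (ampl b `^ p * ((bdim b)%:R * (bdim b)%:R `^ k)) =
    wgt b `^ p * (bdim b)%:R `^ k / 2 ^+ b :> R.
  by rewrite -aE; field; rewrite !gt_eqF.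
apply: lt_le_trans bB _; rewrite ler_pdivlMr//.
apply: le_trans (_ : wgt b `^ p * ((2 ^+ b) `^ p * (2 ^+ b) ^+ 2) <= _); last first.
  by rewrite ler_wpM2l ?powR_ge0.
rewrite [leRHS]mulrA [wgt b `^ p * _]mulrC cE mul1r expr2 ler_pM2r//.
by rewrite -natrX ler_nat ltnW// ltn_expl.
Qed.
End Multiplicity.

Theorem theorem4p7 (R : realType) (w : R -> R) (hw : besov_window w)
    (p : R) (hp : 2 < p) :
  exists f : R * R -> R[i], besov w f /\
  exists (H : hilbert R) (A1 A2 B : {linear H -> H}),
    [/\ selfadjoint A1 /\ contractive A1,
        selfadjoint A2 /\ contractive A2,
        selfadjoint B /\ contractive B,
        schatten p (A1 \- A2) &
        exists T1 T2 : {linear H -> H},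
          [/\ is_fun2 f A1 B T1, is_fun2 f A2 B T2 &
              ~ schatten p (T1 \- T2)]].
Proof.
pose f := trigseries (fun=> 1) (lines : nat -> seq (R[i] * (R * R))).
(* A single [h] serves both functions of operators, since shifted and unshifted nodes lie in the
   same annulus. *)
have [h [ih hf]] := localized_symbol hw (cvg_wiener_lines (R:=R)).
exists f; split; first exact: besov_example.
pose r := mult p; pose U b := dft (R:=R) (bdim b).
have hU b : adjm (U b) *m U b = 1%:M by exact: dft_unitary.
have f_h1 b (i l : 'I_(bdim b)) : f (node1 i, node1 l) = inv_fourier h (node1 i, node1 l).
  apply: hf; have := @norm2_range R (node1 i, node1 l) (node1_range i) (node1_range l).
  by move=> /andP[h1 h2]; rewrite !ltW.
have f_h2 b (i l : 'I_(bdim b)) : f (node2 i, node1 l) = inv_fourier h (node2 i, node1 l).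
  apply: hf; have := @norm2_range R (node2 i, node1 l) (node2_range i) (node1_range l).
  by move=> /andP[h1 h2]; rewrite !ltW.
pose A1 := diag_op r (@node1_le1 R); pose A2 := diag_op r (@node2_le1 R).
pose B := rot_op r hU (@node1_le1 R).
pose T1 := fun_op r hU ih f_h1; pose T2 := fun_op r hU ih f_h2.
have near_f (z : R * R) : 5 / 8 <= z.1 <= 7 / 8 -> 5 / 8 <= z.2 <= 7 / 8 ->
    \forall y \near z, f y = inv_fourier h y.
  move=> z1 z2; have := norm2_range z1 z2; move=> /andP[a1 a2].
  have /cvgr_gt/(_ _ a1) n1 := @continuous_norm2 R z.
  have /cvgr_lt/(_ _ a2) n2 := @continuous_norm2 R z.
  near=> y; apply: hf; apply/andP; split; apply: ltW.
    by near: y.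
  by near: y.
have sa (V : forall b, 'M[R[i]]_(bdim b)) hV t (t1 : forall b (i : 'I_(bdim b)), `|t b i| <= 1) :
    selfadjoint (bop (@sop R bdim r V hV _ (real_diag_bound t1)) : {linear block_hilbert bdim r -> block_hilbert bdim r}) /\
    contractive (bop (@sop R bdim r V hV _ (real_diag_bound t1)) : {linear block_hilbert bdim r -> block_hilbert bdim r}).
  split.
    apply: bop_selfadjoint => b; rewrite adjm_spm; congr spm.
    by apply/rowP => i; rewrite !mxE conjc_real.
  apply: bop_contractive => b v; rewrite -[leRHS]mul1r -(expr1n R 2).
  by apply: sqn_spm => // i; rewrite mxE cabs_real.
exists (block_hilbert bdim r), (bop A1), (bop A2), (bop B); split; [exact: sa|exact: sa|exact: sa| |].
  apply: (@schatten_block R bdim r A1 A2 shift _ _ _ _ p (pi `^ p * 4)).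
  - by move=> b; have /andP[/ltW] := shift_bounds (R:=R) b.
  - move=> b c bc; rewrite /shift ler_wpM2l ?pi_ge0// lef_pV2 ?posrE ?carrier_gt0//.
    by rewrite /carrier ler_weXn2l ?ler1n// /carrier_exp leq_mul// leq_exp2l.
  - move=> b v; have -> : A1 b - A2 b = diag_mx (\row_i (node1 i - node2 i)%:C).
      rewrite /A1 /A2 /= /spm !mul1mx /adjm map_mx1 trmx1 !mulmx1 -raddfB /=.
      by congr diag_mx; apply/rowP => i; rewrite !mxE rmorphB.
    apply: sqn_diag => i; rewrite mxE cabs_real /node2 opprD addrA subrr sub0r normrN ger0_norm//.
    by have /andP[/ltW] := shift_bounds (R:=R) b.
  - by move=> b; rewrite muln_gt0 bdim_gt0.
  - by apply: ltW; apply: lt_trans hp.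
  - exact: sum_shift_powR.
exists (bop T1), (bop T2); split.
- have fun1 := @is_fun2_block R bdim r U (fun b => @node1 R b) (fun b => @node1 R b) hU
    (@node1_le1 R) (@node1_le1 R) f h ih f_h1 _ _
    (@node1_range R) (@node1_range R) near_f.
  exact: fun1.
- have fun2 := @is_fun2_block R bdim r U (fun b => @node2 R b) (fun b => @node1 R b) hU
    (@node2_le1 R) (@node1_le1 R) f h ih f_h2 _ _
    (@node2_range R) (@node1_range R) near_f.
  exact: fun2.
move=> /schatten_lower[|M hM]; first by apply: ltW; apply: lt_trans hp.
have [b] := mult_unbounded hp M; apply/negP; rewrite -leNgt; apply: hM.
  by rewrite mulr_ge0 ?sqrtr_ge0 ?ampl_ge0.
(* The [b]-th block alone supplies [mult p b] singular values of the required size, and these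
   already exceed any Schatten bound. *)
move=> n nb; apply: (@singular_value_block_ge R bdim r T1 T2 b (probe (bdim b))) => //.
- by rewrite sqn_probe ?bdim_gt0.
- by rewrite mulr_ge0 ?sqrtr_ge0 ?ampl_ge0.
rewrite exprMn sqr_sqrtr ?ler0n//; apply: le_trans (block_lower b) _.
rewrite le_eqVlt; apply/orP; left; apply/eqP; congr (sqn (_ *m _)).
by rewrite /= /fun_mx -gmxN -gmxD.
Unshelve. all: by end_near. Qed.
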